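(* Let $1<p<\infty$ and let $X=(X,d,\mu)$ be a complete metric space equipped with a doubling measure $\mu$ supporting a $p$-Poincaré inequality. Let $\Omega\subset X$ be a nonempty bounded open set with $C_p(X\setminus\Omega)>0$. Let $E\subset\Omega$ be relatively closed and let $u>0$ be a superharmonic function in $\Omega$ which is $p$-harmonic in $\Omega\setminus E$ and such that $\min\{u,k\}\in N^{1,p}_0(\Omega)$ for all $k>0$. Then there is a constant $\Lambda>0$ such that $$\operatorname{cap}_p(\Omega^b,\Omega^a)=\operatorname{cap}_p(\Omega^b,\Omega_a)=\Lambda(b-a)^{1-p}\quad\text{when }0\le a<b\le C_p\text{-}\operatorname{ess\,inf}_E u,$$ $$\operatorname{cap}_p(\Omega_b,\Omega_a)=\operatorname{cap}_p(\Omega_b,\Omega^a)=\Lambda(b-a)^{1-p}\quad\text{when }0\le a<b<C_p\text{-}\operatorname{ess\,inf}_E u,$$ where $\Omega^b=\{x\in\Omega:u(x)\ge b\}$, $\Omega_a=\{x\in\Omega:u(x)>a\}$ and $\infty^{1-p}$ is interpreted as $0$.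
   Context: Setting: $X=(X,d,\mu)$ is a metric space with at least two points equipped with a positive complete Borel measure $\mu$ (defined on the completion of the Borel $\sigma$-algebra) with $0<\mu(B)<\infty$ for all balls $B$. Doubling: $\mu(B(x,2r))\le C_\mu\,\mu(B(x,r))$ for all balls. $p$-Poincaré inequality: there are $C_{PI}>0$, $\lambda\ge1$ such that $\frac1{\mu(B)}\int_B|u-u_B|\,d\mu\le C_{PI}\,r\bigl(\frac1{\mu(\lambda B)}\int_{\lambda B}g^p\,d\mu\bigr)^{1/p}$ for all balls $B=B(x,r)$, all integrable $u$ on $X$ and all $p$-weak upper gradients $g$ of $u$, where $u_B=\frac1{\mu(B)}\int_Bu\,d\mu$ and $\lambda B=B(x,\lambda r)$. Newtonian spaces: Curves are nonconstant, compact, rectifiable and parameterized by arc length $ds$. A measurable $g\colon X\to[0,\infty]$ is a $p$-weak upper gradient of $f\colon X\to[-\infty,\infty]$ if $|f(\gamma(0))-f(\gamma(l_\gamma))|\le\int_\gamma g\,ds$ for all curves $\gamma\colon[0,l_\gamma]\to X$ outside some family $\Gamma$ for which there is $0\le\rho\in L^p(X)$ with $\int_\gamma\rho\,ds=\infty$ for every $\gamma\in\Gamma$ (the left-hand side is $\infty$ if a term in it is $\pm\infty$). If $f$ has a $p$-weak upper gradient in $L^p_{\rm loc}(X)$, then $g_f$ denotes its a.e. unique minimal one. $N^{1,p}(X)$ is the set of measurable, everywhere defined $f\colon X\to[-\infty,\infty]$ with $\|f\|_{N^{1,p}(X)}^p=\int_X|f|^p\,d\mu+\inf_g\int_Xg^p\,d\mu<\infty$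 (infimum over $p$-weak upper gradients of $f$). For measurable $A\subset X$, $N^{1,p}(A)$ is defined by regarding $(A,d|_A,\mu|_A)$ as a metric space in its own right; for open $V$, $f\in N^{1,p}_{\rm loc}(V)$ if every $x\in V$ has a ball $B(x,r_x)\subset V$ with $f\in N^{1,p}(B(x,r_x))$. $N^{1,p}_0(V)$ is the set of restrictions to $V$ of $f\in N^{1,p}(X)$ with $f=0$ on $X\setminus V$ (such functions are regarded as extended by $0$). Capacities: $C_p(E)=\inf\|u\|_{N^{1,p}(X)}^p$ over $u\in N^{1,p}(X)$ with $u\ge1$ on $E$. For bounded $E\subset A$, $\operatorname{cap}_p(E,A)=\inf\int_Xg_u^p\,d\mu$ over $u\in N^{1,p}(X)$ with $u\ge1$ on $E$ and $u=0$ on $X\setminus A$ ($\infty$ if no such $u$). Moreover, $C_p\text{-}\operatorname{ess\,inf}_E u=\sup\{k\in\mathbb R: C_p(\{x\in E:u(x)<k\})=0\}$, which is $\infty$ if $E=\varnothing$. $p$-harmonicity: For open $V$, $u\in N^{1,p}_{\rm loc}(V)$ is a minimizer in $V$ if $\int_{\{\varphi\ne0\}}g_u^p\,d\mu\le\int_{\{\varphi\ne0\}}g_{u+\varphi}^p\,d\mu$ for all $\varphi\in N^{1,p}_0(V)$. A $p$-harmonic function is a (real-valued) continuous minimizer. For bounded open $G$ with $C_p(X\setminus G)>0$ and $f\in N^{1,p}(G)$, $H_Gf$ is the unique $p$-harmonic function in $G$ with $H_Gf-f\in N^{1,p}_0(G)$. A function $u\colon V\to(-\infty,\infty]$ is superharmonic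 in $V$ if it is lower semicontinuous, not identically $\infty$ in any component of $V$, and for every nonempty open $G$ whose closure is a compact subset of $V$ and with $C_p(X\setminus G)>0$, and every Lipschitz $v$ on $\overline G$ with $v\le u$ on $\partial G$, one has $H_Gv\le u$ in $G$. *)

(* Defs.v *)
From HB Require Import structures.
From mathcomp Require Import all_boot all_order all_algebra.
From mathcomp Require Import all_classical all_reals all_analysis.
From mathcomp Require Import measurable_realfun.

Set Implicit Arguments.
Unset Strict Implicit.
Unset Printing Implicit Defensive.

Import Order.TTheory GRing.Theory Num.Theory.
Import numFieldNormedType.Exports.

Local Open Scope classical_set_scope.
Local Open Scope ring_scope.
Local Open Scope ereal_scope.

(* A metric space and a sigma-algebra on the same carrier. They are linked
   only by [borel_completion] below. *)
#[short(type="metricMeasurableType")]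
HB.structure Definition MetricMeasurable (d : measure_display)
    (R : numDomainType) := {T of Measurable d T & Metric R T}.

#[short(type="completeMetricMeasurableType")]
HB.structure Definition CompleteMetricMeasurable (d : measure_display)
    (R : numDomainType) := {T of Measurable d T & Metric R T & Complete T}.

Section metric_space.
Context {d : measure_display} {R : realType} {X : metricMeasurableType d R}.
Implicit Types (A : set X) (c : R -> X) (l a b : R).

Definition metric_bounded A := exists (x : X) (r : R), A `<=` ball x r.

Definition lipschitz_within A (v : X -> R) := exists L : R,
  forall x y, A x -> A y -> (`|v x - v y| <= L * mdist x y)%R.

Definition curve_length a b c : \bar R := ereal_sup
  [set (\sum_(0 <= i < size s)
          mdist (c (nth b (a :: s) i)) (c (nth b (a :: s) i.+1)))%:E
  | s in itv_partition a b].

(* The restriction of c to [0, l] is a nonconstant rectifiable curve in A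
   parameterized by arc length; the values of c outside [0, l] are irrelevant.
   Continuity on [0, l] follows from the last clause. *)
Definition arc_length_curve A l c :=
  [/\ (0 < l)%R,
      forall t, (0 <= t <= l)%R -> A (c t) &
      forall s t, (0 <= s)%R -> (s <= t)%R -> (t <= l)%R ->
        curve_length s t c = (t - s)%:E].

(* If g \o c is not Lebesgue measurable, this is its lower integral. When g is
   measurable this happens only for a p-exceptional family of curves, so no
   notion below depends on this convention. *)
Definition curve_integral l c (g : X -> \bar R) : \bar R :=
  \int[completed_lebesgue_measure]_(t in `[0%R, l]) g (c t).

End metric_space.

Section metric_measure_space.
Context {d : measure_display} {R : realType} {X : metricMeasurableType d R}.
Variables (p : R) (mu : {measure set X -> \bar R}).
Implicit Types (A E V G : set X) (f g u v h phi : X -> \bar R).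

Definition borel_completion := forall A, measurable A <->
  exists B N : set X, [/\ <<s open >> B, <<s open >> N, mu N = 0,
                  B `<=` A & A `\` B `<=` N].

Definition balls_pos_finite := forall (x : X) (r : R), (0 < r)%R ->
  0 < mu (ball x r) < +oo.

Definition doubling := exists C : R, forall (x : X) (r : R), (0 < r)%R ->
  mu (ball x (2 * r)%R) <= C%:E * mu (ball x r).

(* In what follows a set A stands for the metric measure space
   (A, d|_A, mu|_A); functions are defined on all of X, but only their values
   on A matter. The paper's ambient space is A = setT. *)

Definition p_exceptional A (Gamma : set (R * (R -> X))) := exists rho : X -> \bar R,
  [/\ measurable_fun A rho, forall x, A x -> 0 <= rho x,
      \int[mu]_(x in A) (rho x `^ p) < +oo &
      forall l c, arc_length_curve A l c -> Gamma (l, c) ->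
        curve_integral l c rho = +oo].

(* With the conventions +oo - +oo = -oo and `|-oo| = +oo of \bar R, the left-hand
   side of the inequality is +oo as soon as one of its terms is infinite. *)
Definition weak_upper_gradient A f g :=
  [/\ measurable_fun A g, forall x, A x -> 0 <= g x &
      exists2 Gamma, p_exceptional A Gamma &
        forall l c, arc_length_curve A l c -> ~ Gamma (l, c) ->
          `|f (c 0%R) - f (c l)| <= curve_integral l c g].

Definition Lp_loc A g := measurable_fun A g /\
  forall x, A x -> exists2 r : R, (0 < r)%R &
    \int[mu]_(y in A `&` ball x r) (`|g y| `^ p) < +oo.

Definition minimal_weak_upper_gradient A f g :=
  [/\ weak_upper_gradient A f g, Lp_loc A g &
      forall g', weak_upper_gradient A f g' -> Lp_loc A g' ->
        {ae mu, forall x, A x -> g x <= g' x}].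

Definition min_grad A f : X -> \bar R :=
  xget (cst 0) [set g | minimal_weak_upper_gradient A f g].

Definition N1p_norm_pow A f : \bar R :=
  \int[mu]_(x in A) (`|f x| `^ p) +
  ereal_inf [set \int[mu]_(x in A) (g x `^ p)
            | g in [set g | weak_upper_gradient A f g]].

Definition N1p A f := measurable_fun A f /\ N1p_norm_pow A f < +oo.

Definition N1p_loc V f := forall x, V x -> exists r : R,
  [/\ (0 < r)%R, ball x r `<=` V & N1p (ball x r) f].

Definition N1p_0 V f := N1p setT (f \_ V).

Definition avg A f : \bar R := ((fine (mu A))^-1)%:E * \int[mu]_(x in A) f x.

Definition poincare := exists C lambda : R,
  [/\ (0 < C)%R, (1 <= lambda)%R &
      forall (x : X) (r : R) u g, (0 < r)%R ->
        mu.-integrable setT u -> weak_upper_gradient setT u g ->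
        avg (ball x r) (fun y => `|u y - avg (ball x r) u|) <=
        (C * r)%:E *
          (avg (ball x (lambda * r)%R) (fun y => g y `^ p)) `^ p^-1].

Definition capacity E : \bar R := ereal_inf
  [set N1p_norm_pow setT v
  | v in [set v | N1p setT v /\ forall x, E x -> 1 <= v x]].

Definition rel_capacity E A : \bar R := ereal_inf
  [set \int[mu]_x (min_grad setT v x `^ p)
  | v in [set v | [/\ N1p setT v, forall x, E x -> 1 <= v x &
                      forall x, ~ A x -> v x = 0]]].

Definition cap_ess_inf E u : \bar R := ereal_sup
  [set k%:E | k in [set k : R | capacity [set x | E x /\ u x < k%:E] = 0]].

(* The value of u + phi at points where the sum is undefined is irrelevant, as
   these points form a set of zero capacity. *)
Definition minimizer V u := N1p_loc V u /\
  forall phi, N1p_0 V phi ->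
    \int[mu]_(x in V `&` [set x | phi x != 0]) (min_grad V u x `^ p) <=
    \int[mu]_(x in V `&` [set x | phi x != 0])
      (min_grad V (fun y => u y + phi y) x `^ p).

Definition p_harmonic V u :=
  [/\ forall x, V x -> u x \is a fin_num, {within V, continuous u} &
      minimizer V u].

(* h is (on G) the p-harmonic function H_G f *)
Definition is_harmonic_ext G f h :=
  p_harmonic G h /\ N1p_0 G (fun x => h x - f x).

Definition superharmonic V u :=
  [/\ forall x, V x -> -oo < u x,
      lower_semicontinuous (u : subspace V -> \bar R),
      forall x, V x -> exists2 y, connected_component V x y & u y != +oo &
      forall G (v : X -> R) h,
        open G -> G !=set0 -> compact (closure G) -> closure G `<=` V ->
        0 < capacity (~` G) ->
        lipschitz_within (closure G) v ->
        (forall x, (closure G `\` G) x -> (v x)%:E <= u x) ->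
        is_harmonic_ext G (EFin \o v) h ->
        forall x, G x -> h x <= u x].

End metric_measure_space.

Section superlevel_sets.
Context {R : realType} {T : Type}.
Implicit Types (Omega : set T) (u : T -> \bar R).

Definition superlevel_ge Omega u (b : \bar R) := [set x | Omega x /\ b <= u x].

Definition superlevel_gt Omega u (a : \bar R) := [set x | Omega x /\ a < u x].

End superlevel_sets.

(* (b - a)^(1 - p), with oo^(1 - p) = 0; note that poweR would give +oo *)
Definition gap_pow {R : realType} (p a : R) (b : \bar R) : \bar R :=
  if b is r%:E then ((r - a) `^ (1 - p))%R%:E else 0.

(* Main.v *)
(* Let u_b = min(u, b) in Omega, extended by 0, and let I(b) be the least energy of
   its upper gradients. If b <= C_p-ess inf_E u, then almost every curve avoids the
   part of E where u < b, so p-harmonicity of u outside E makes u_b a minimizer of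
   the energy among functions with values in [0, b] that vanish outside Omega and
   equal b where u >= b. Let v have values in [0, 1], vanish where u < a and equal 1
   where u >= b. Since the gradients of u_a and v live on disjoint sets, testing with
   alpha u_a + beta (b - a) v, where alpha a + beta (b - a) = b, gives
     I(b) <= alpha^p I(a) + (beta (b - a))^p (energy of v).
   For v = (u_b - u_a) / (b - a) equality holds at alpha = beta = 1, and the
   first-order condition there is I(b) / b = I(a) / a, so I(b) = Lambda b. For general
   v and alpha = beta = 1 the inequality is the lower bound for the capacity, which
   (u_b - u_a) / (b - a) attains. *)

Require Import Defs.
From HB Require Import structures.
From mathcomp Require Import all_boot all_order all_algebra.
From mathcomp Require Import all_classical all_reals all_analysis.
From mathcomp Require Import measurable_realfun ring lra.

Set Implicit Arguments.
Unset Strict Implicit.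
Unset Printing Implicit Defensive.

Import Order.TTheory GRing.Theory Num.Theory.
Import numFieldNormedType.Exports.

Local Open Scope classical_set_scope.
Local Open Scope ring_scope.
Local Open Scope ereal_scope.

(** Weak upper gradients are measurable only for the completion of the Borel sets, and a curve may
    run inside a null set, so almost everywhere statements say nothing about a given curve. Each
    gradient is therefore replaced by a Borel majorant that differs from it only on a null set, and
    each exceptional family by the curves on which one Borel function has infinite integral.
    Locality of gradients, on which the splitting over disjoint sets rests, becomes a statement
    about real functions on an interval.

    Since [min_grad] has a default value, minimal gradients have to be constructed: on the whole
    space from a minimizing sequence for the energy, and for [u] on [Omega] minus [E], where only
    local integrability is available, as the supremum of the minimal gradients of the truncations.

    Minimality of [u] can be tested only with perturbations supported off [E], so a competitor is
    first changed on the part of [E] where [u < b], a countable union of sets of zero capacity. That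
    [Lambda] is positive comes from the Poincare inequality and the positive capacity of the
    complement of [Omega]. Strict levels and [b = +oo] follow by monotonicity of the capacity and
    limits in [b]. *)

Section integral_complements.
Context {d : measure_display} {T : measurableType d} {R : realType}.
Variable mu : {measure set T -> \bar R}.

(** For nonnegative functions the integral is a supremum over the simple functions below them. This
    allows curve integrals of functions that are not measurable along the curve to be compared. *)
Lemma ge0_le_integral_nomeas (D : set T) (f g : T -> \bar R) :
  (forall x, D x -> 0 <= f x) -> (forall x, D x -> f x <= g x) ->
  \int[mu]_(x in D) f x <= \int[mu]_(x in D) g x.
Proof.
move=> f0 fg.
have g0 x : D x -> 0 <= g x by move=> Dx; exact: le_trans (f0 _ Dx) (fg _ Dx).
rewrite !ge0_integralE//; apply: le_ereal_sup => _ [h /= hf <-]; exists h => //= x.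
apply: le_trans (hf x) _; rewrite /patch; case: ifPn => // xD.
by apply: fg; rewrite inE in xD.
Qed.

Lemma integral_abs_continuous (h : T -> \bar R) (D : set T) (e : R) :
  measurable D -> measurable_fun D h -> (forall x, D x -> 0 <= h x) ->
  \int[mu]_(x in D) h x < +oo -> (0 < e)%R ->
  exists2 r : R, (0 < r)%R & forall A, measurable A -> A `<=` D -> mu A < r%:E ->
    \int[mu]_(x in A) h x <= e%:E.
Proof.
move=> mD mh h0 hoo e0.
have ih : mu.-integrable D h.
  apply/integrableP; split=> //; rewrite (eq_integral h)// => x; rewrite inE => Dx.
  by rewrite gee0_abs// h0.
have ihT : mu.-integrable setT (h \_ D) by rewrite -integrable_mkcond.
(* An integrable [h] is finite almost everywhere, so a real-valued function has the same
   integrals. *)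
pose k := fine \o (h \_ D).
have mk : measurable_fun setT k.
  by apply: measurableT_comp => //; exact: measurable_int ihT.
have ifT : mu.-integrable setT (EFin \o k).
  apply: (le_integrable measurableT _ _ ihT); first exact/measurable_EFinP.
  move=> x _; rewrite /k /=; case: ((h \_ D) x) => [r| |] //=.
  - by rewrite normr0; exact: leey.
  - by rewrite normr0; exact: leey.
have [r [r0 rP]] := integral_normr_continuous ifT e0.
exists r => // A mA AD Ar; have {rP} := rP A mA Ar.
have -> : \int[mu]_(x in A) h x = \int[mu]_(x in A) `|k x|%:E.
  apply: ge0_ae_eq_integral => //.
  - exact: measurable_funS mh.
  - by apply/measurable_EFinP/measurableT_comp => //; exact: measurable_funTS.
  - by move=> x /AD; exact: h0.
  - apply: filterS (integrable_ae mD ih) => x /= + Ax; move=> /(_ (AD _ Ax)) hfin.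
    have Dx := AD _ Ax; rewrite /k /= patchE mem_set//.
    by rewrite ger0_norm ?fine_ge0 ?h0// fineK.
rewrite /Rintegral => /ltW; rewrite -lee_fin fineK//.
apply: integrable_fin_num => //; apply: (integrableS measurableT) => //.
by apply: integrable_norm.
Qed.

End integral_complements.

(** * Integral bounds on intervals *)

Section interval_integral.
Context {R : realType}.
Implicit Types (h : R -> \bar R) (F : R -> R).

Definition lint (a b : R) h := \int[lebesgue_measure]_(t in `[a, b]) h t.

Lemma lint_ge0 a b h : (forall t, 0 <= h t) -> 0 <= lint a b h.
Proof. by move=> h0; apply: integral_ge0. Qed.

Lemma lint_cat a b c h : measurable_fun setT h -> (forall t, 0 <= h t) ->
  (a <= b)%R -> (b <= c)%R -> lint a c h = lint a b h + lint b c h.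
Proof.
move=> mh h0 ab bc; rewrite /lint (itv_bndbnd_setU (x := BRight b)) ?bnd_simp//.
rewrite ge0_integral_setU//=.
- by rewrite integral_itv_obnd_cbnd//; exact: measurable_funTS.
- exact: measurable_funTS.
- apply/eqP; rewrite -subset0 => x [] /=; rewrite !in_itv/= => /andP[_ xb].
  by rewrite ltNge xb.
Qed.

Lemma le_lint a b h k : measurable_fun setT h -> measurable_fun setT k ->
  (forall t, 0 <= h t) -> (forall t, (a <= t <= b)%R -> h t <= k t) ->
  lint a b h <= lint a b k.
Proof.
move=> mh mk h0 hk; apply: ge0_le_integral => //; exact: measurable_funTS.
Qed.

Lemma lint_sub a b s t h : measurable_fun setT h -> (forall t, 0 <= h t) ->
  (a <= s)%R -> (t <= b)%R -> lint s t h <= lint a b h.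
Proof.
move=> mh h0 as_ tb; apply: ge0_subset_integral => //; first exact: measurable_funTS.
by move=> x /=; rewrite !in_itv/= => /andP[sx xt]; rewrite (le_trans as_ sx) (le_trans xt tb).
Qed.

Lemma lintD a b h k : measurable_fun setT h -> measurable_fun setT k ->
  (forall t, 0 <= h t) -> (forall t, 0 <= k t) ->
  lint a b (fun t => h t + k t) = lint a b h + lint a b k.
Proof. by move=> mh mk h0 k0; apply: ge0_integralD => //; exact: measurable_funTS. Qed.

(** A supremum argument in place of a finite subcover: the supremum of the [t] with [Q a t] has a
    window in which [Q] holds for every subinterval, so it can only be [b], and [b] is attained. It
    turns local estimates on [F s - F t] into global ones. *)
Lemma real_induction (Q : R -> R -> Prop) (a b : R) : (a <= b)%R ->
  (forall s t u, (a <= s)%R -> (s <= t)%R -> (t <= u)%R -> (u <= b)%R ->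
     Q s t -> Q t u -> Q s u) ->
  (forall x, (a <= x <= b)%R -> exists2 e : R, (0 < e)%R &
     forall s t, (a <= s)%R -> (s <= t)%R -> (t <= b)%R ->
       (x - e < s)%R -> (t < x + e)%R -> Q s t) ->
  Q a b.
Proof.
move=> ab Qtrans Qloc.
pose A := [set t : R | (a <= t <= b)%R /\ Q a t].
have Aa : A a.
  split; first by rewrite lexx.
  have /Qloc[e e0 eQ] : (a <= a <= b)%R by rewrite lexx.
  by apply: eQ; rewrite ?lexx// ?ltrBlDr ltrDl.
have supA : has_sup A.
  by split; [exists a | exists b => t [/andP[]]].
have sA : (a <= sup A <= b)%R.
  rewrite ub_le_sup//=; last by case: supA.
  by apply: ge_sup; [exists a | move=> t [/andP[]]].
have [e e0 eQ] := Qloc _ sA.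
have [t [/andP[at_ tb] Qt] st] := sup_adherent e0 supA.
have ts : (t <= sup A)%R by apply: ub_le_sup; [case: supA | split => //; rewrite at_].
move/andP: sA => [as_ sb].
have [bs|bs] := ltP b (sup A + e)%R.
  have Qtb : Q t b by apply: eQ.
  by apply: (Qtrans a t b) => //.
pose u := (sup A + e / 2)%R.
have ub : (u <= b)%R by rewrite /u; apply: le_trans bs; rewrite lerD2l; lra.
have Au : A u.
  split; first by rewrite ub andbT /u; lra.
  apply: (Qtrans a t u) => //; first by rewrite /u; lra.
  by apply: eQ => //; rewrite /u; lra.
have : (u <= sup A)%R by apply: ub_le_sup => //; case: supA.
by rewrite /u; lra.
Qed.

Definition controlled (a b : R) F h := forall s t : R, (a <= s)%R -> (s <= t)%R ->
  (t <= b)%R -> `|F s - F t|%:E <= lint s t h.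

Definition glue (D : set R) h1 h2 (t : R) : \bar R := if t \in D then h2 t else h1 t.

Lemma measurable_glue D h1 h2 : measurable D -> measurable_fun setT h1 ->
  measurable_fun setT h2 -> measurable_fun setT (glue D h1 h2).
Proof.
move=> mD m1 m2; apply: measurable_fun_ifT => //.
apply: (measurable_fun_bool true) => //; rewrite setTI.
by rewrite (_ : _ @^-1` _ = D)//; apply/seteqP; split => x; [exact: set_mem|exact: mem_set].
Qed.

(* F varies at most by the integral of h2 near points of D, and of h1 elsewhere:
   compact subsets of D and of its complement exhausting the interval up to a set
   on which h1 + h2 has small integral make this a local statement. *)
Lemma controlled_glue (a b : R) F h1 h2 (O D : set R) : (a <= b)%R ->
  measurable_fun setT h1 -> measurable_fun setT h2 ->
  (forall t, 0 <= h1 t) -> (forall t, 0 <= h2 t) ->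
  lint a b h1 < +oo -> lint a b h2 < +oo ->
  controlled a b F h1 -> open O ->
  (forall s t, (a <= s)%R -> (s <= t)%R -> (t <= b)%R -> `[s, t] `<=` O ->
     `|F s - F t|%:E <= lint s t h2) ->
  measurable D -> D `<=` O -> controlled a b F (glue D h1 h2).
Proof.
move=> ab m1 m2 h10 h20 i1 i2 F1 oO F2 mD DO.
suff main : forall s t : R, (a <= s)%R -> (s <= t)%R -> (t <= b)%R ->
    `|F s - F t|%:E <= lint s t (glue D h1 h2) by [].
move=> x y ax xy yb.
pose h t := h1 t + h2 t.
have mh : measurable_fun setT h by exact: emeasurable_funD.
have h0 t : 0 <= h t by exact: adde_ge0.
have ih : lint x y h < +oo.
  apply: le_lt_trans (lint_sub mh h0 ax yb) _.
  by rewrite lintD// lte_add_pinfty.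
pose k := glue D h1 h2.
have mk : measurable_fun setT k by exact: measurable_glue.
have k0 t : 0 <= k t by rewrite /k /glue; case: ifP.
apply/lee_addgt0Pr => e e0.
have [r r0 rP] := integral_abs_continuous (mu := lebesgue_measure) (D := `[x, y]%classic)
  (measurable_itv _) (measurable_funTS mh) (fun t _ => h0 t) ih e0.
have r20 : (0 < r / 2)%R by rewrite divr_gt0.
have Ixy A : measurable A -> lebesgue_measure (A `&` `[x, y]%classic) < +oo.
  move=> mA; apply: le_lt_trans (_ : lebesgue_measure `[x, y]%classic < +oo).
    by apply: le_measure; rewrite ?inE//; exact: measurableI.
  by rewrite /= lebesgue_measure_itv/=; case: ifP => // _; rewrite -EFinB ltry.
have mI A : measurable A -> measurable (A `&` `[x, y]%classic).
  by move=> mA; exact: measurableI.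
have [K1 [cK1 K1D rK1]] := lebesgue_regularity_inner (mI _ (measurableC mD))
  (Ixy _ (measurableC mD)) r20.
have [K2 [cK2 K2D rK2]] := lebesgue_regularity_inner (mI _ mD) (Ixy _ mD) r20.
have clK1 : closed K1 by apply: compact_closed => //; exact: Rhausdorff.
have clK2 : closed K2 by apply: compact_closed => //; exact: Rhausdorff.
have mK1 : measurable K1 by exact: closed_measurable.
have mK2 : measurable K2 by exact: closed_measurable.
pose B := `[x, y]%classic `\` (K1 `|` K2).
have mB : measurable B by apply: measurableD => //; exact: measurableU.
have Br : lebesgue_measure B < r%:E.
  have BU : B `<=` ((~` D `&` `[x, y]%classic) `\` K1) `|` ((D `&` `[x, y]%classic) `\` K2).
    move=> t [txy nK]; have [tD|tD] := pselect (D t).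
      by right; split => // tK; apply: nK; right.
    by left; split => // tK; apply: nK; left.
  apply: (@le_lt_trans _ _ (lebesgue_measure (((~` D `&` `[x, y]%classic) `\` K1) `|` ((D `&` `[x, y]%classic) `\` K2)))).
    apply: le_measure; rewrite ?inE//; apply: measurableU; apply: measurableD => //;
      apply: mI => //; exact: measurableC.
  apply: le_lt_trans; first by apply: outer_measureU2.
  by rewrite (splitr r) EFinD lteD.
have Be := rP B mB (@subDsetl _ _ _) Br.
pose H t := k t + (h \_ B) t.
have mhB : measurable_fun setT (h \_ B).
  by apply: (measurable_restrictT h mB).1; exact: measurable_funTS.
have hB0 t : 0 <= (h \_ B) t by rewrite patchE; case: ifP.
have mH : measurable_fun setT H by exact: emeasurable_funD.
have H0 t : 0 <= H t by exact: adde_ge0.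
have HE : lint x y H <= lint x y k + e%:E.
  rewrite lintD// leeD2l// /lint -integral_mkcondr setIidr//; exact: subDsetl.
apply: le_trans HE.
apply: (@real_induction (fun s t => `|F s - F t|%:E <= lint s t H)) => //.
  move=> s t u xs st tu uy Qst Qtu; rewrite (@lint_cat s t u)//.
  apply: le_trans (leeD Qst Qtu); rewrite -EFinD lee_fin.
  by rewrite (le_trans _ (ler_normD _ _))// addrA subrK.
have K1H t : (x <= t <= y)%R -> ~ K2 t -> h1 t <= H t.
  move=> txy tK2; rewrite /H /k /glue; have [tK1|tK1] := pselect (K1 t).
    have [ntD _] := K1D _ tK1; rewrite memNset// leeDl//.
  apply: (le_trans (y := (h \_ B) t)); last by rewrite leeDr//; exact: k0.
  rewrite patchE mem_set; first by rewrite /h leeDl.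
  by split; [rewrite /= in_itv | case].
have K2H t : (x <= t <= y)%R -> ~ K1 t -> h2 t <= H t.
  move=> txy tK1; rewrite /H /k /glue; have [tK2|tK2] := pselect (K2 t).
    have [tD _] := K2D _ tK2; rewrite mem_set// leeDl//.
  apply: (le_trans (y := (h \_ B) t)); last by rewrite leeDr//; exact: k0.
  rewrite patchE mem_set; first by rewrite /h leeDr.
  by split; [rewrite /= in_itv | case].
move=> z /andP[xz zy]; have [zK|zK] := pselect (K2 z).
  have : nbhs z (O `&` ~` K1).
    apply: open_nbhs_nbhs; split; first by apply: openI => //; exact: closed_openC.
    split; first by apply: DO; have [] := K2D _ zK.
    by move=> zK1; have [+ _] := K1D _ zK1; apply; have [] := K2D _ zK.
  move=> /nbhs_ballP[d /= d0 dP]; exists d => // s t xs st ty zs tz.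
  have sub w : (s <= w <= t)%R -> (O `&` ~` K1) w.
    by move=> /andP[sw wt]; apply: dP; rewrite /ball/= ltr_norml; apply/andP; split; lra.
  apply: le_trans (F2 _ _ (le_trans ax xs) st (le_trans ty yb) _) _.
    by move=> w /=; rewrite in_itv => /sub[].
  apply: le_lint => // w /[dup] /sub[_ nw] /andP[sw wt]; apply: K2H => //.
  by rewrite (le_trans xs)// (le_trans wt).
have : nbhs z (~` K2) by apply: open_nbhs_nbhs; split => //; exact: closed_openC.
move=> /nbhs_ballP[d /= d0 dP]; exists d => // s t xs st ty zs tz.
apply: le_trans (F1 _ _ (le_trans ax xs) st (le_trans ty yb)) _.
apply: le_lint => // w /andP[sw wt]; apply: K1H; first by rewrite (le_trans xs)// (le_trans wt).
by apply: dP; rewrite /ball/= ltr_norml; apply/andP; split; lra.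
Qed.

End interval_integral.

Section interval_integral_complements.
Context {R : realType}.
Implicit Types (h : R -> \bar R) (F : R -> R).

(** The endpoint [b] is left out because a first zero of [F], to which this is applied, need not
    belong to [D]. *)
Lemma lint_restrict_left (a b : R) h (D : set R) : measurable_fun setT h ->
  measurable D -> (forall t, (a <= t < b)%R -> D t) ->
  lint a b (h \_ D) = lint a b h.
Proof.
move=> mh mD hD.
have mhD : measurable_fun setT (h \_ D).
  by apply: (measurable_restrictT h mD).1; exact: measurable_funTS.
rewrite /lint -!integral_itv_bndo_bndc; try exact: measurable_funTS.
by apply: eq_integral => t; rewrite inE /= in_itv => tab; rewrite patchE mem_set//; exact: hD.
Qed.

Lemma lint_restrict_right (a b : R) h (D : set R) : measurable_fun setT h ->
  measurable D -> (forall t, (a < t <= b)%R -> D t) ->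
  lint a b (h \_ D) = lint a b h.
Proof.
move=> mh mD hD.
have mhD : measurable_fun setT (h \_ D).
  by apply: (measurable_restrictT h mD).1; exact: measurable_funTS.
rewrite /lint -!integral_itv_obnd_cbnd; try exact: measurable_funTS.
by apply: eq_integral => t; rewrite inE /= in_itv => tab; rewrite patchE mem_set//; exact: hD.
Qed.

Lemma lint_small_length (a b : R) h (e : R) : measurable_fun setT h ->
  (forall t, 0 <= h t) -> lint a b h < +oo -> (0 < e)%R ->
  exists2 r : R, (0 < r)%R & forall s t, (a <= s)%R -> (s <= t)%R -> (t <= b)%R ->
    (t - s < r)%R -> lint s t h <= e%:E.
Proof.
move=> mh h0 ih e0.
have [r r0 rP] := integral_abs_continuous (mu := lebesgue_measure)
  (D := `[a, b]%classic) (measurable_itv _) (measurable_funTS mh)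
  (fun t _ => h0 t) ih e0.
exists r => // s t as_ st tb tsr; apply: rP; first exact: measurable_itv.
  by move=> x /=; rewrite !in_itv/= => /andP[sx xt]; rewrite (le_trans as_ sx) (le_trans xt tb).
by rewrite /= lebesgue_measure_itv/=; case: ifP; rewrite -?EFinB lte_fin.
Qed.

(* F moves only outside its zero set: compare F at both ends with its values at
   the first and at the last zero. *)
Lemma controlled_nonzero (a b : R) F h (D : set R) :
  measurable_fun setT h -> (forall t, 0 <= h t) -> lint a b h < +oo ->
  controlled a b F h -> measurable D ->
  (forall t, (a <= t <= b)%R -> F t != 0%R -> D t) ->
  controlled a b F (h \_ D).
Proof.
move=> mh h0 ih cF mD FD x y ax xy yb.
have mhD : measurable_fun setT (h \_ D).
  by apply: (measurable_restrictT h mD).1; exact: measurable_funTS.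
have hD0 t : 0 <= (h \_ D) t by rewrite patchE; case: ifP.
pose Z := [set z : R | (x <= z <= y)%R /\ F z = 0%R].
have [Z0|/set0P Z0] := eqVneq Z set0.
  rewrite lint_restrict_left//; first exact: cF.
  move=> t /andP[xt ty]; apply: FD.
    by rewrite (le_trans ax)// (le_trans (ltW ty)).
  apply/eqP => Ft; have : Z t by split => //; rewrite xt ltW.
  by rewrite Z0.
have supZ : has_sup Z by split => //; exists y => z [/andP[]].
have infZ : has_inf Z by split => //; exists x => z [/andP[]].
have small := @lint_small_length a b h _ mh h0 ih.
pose t1 := inf Z; pose t2 := sup Z.
have xt1 : (x <= t1)%R by apply: lb_le_inf => // z [/andP[]].
have t2y : (t2 <= y)%R by apply: ge_sup => // z [/andP[]].
have t12 : (t1 <= t2)%R.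
  case: Z0 => z Zz; apply: (@le_trans _ _ z).
    by apply: ge_inf => //; case: infZ.
  by apply: ub_le_sup => //; case: supZ.
(* Zeros of [F] come arbitrarily close to [t1], and [F] varies little on short intervals because the
   integral of [h] is absolutely continuous. *)
have Ft1 : F t1 = 0%R.
  apply/eqP; rewrite -normr_le0; apply/ler_addgt0Pr => e e0; rewrite add0r.
  have [r r0 rP] := small _ e0.
  have [z [/andP[xz zy] Fz] zr] := inf_adherent r0 infZ.
  have t1z : (t1 <= z)%R by apply: ge_inf; [case: infZ | split => //; rewrite xz].
  rewrite -lee_fin; apply: le_trans (rP t1 z _ t1z _ _); rewrite ?(le_trans ax)// ?(le_trans zy)//.
    have := cF t1 z (le_trans ax xt1) t1z (le_trans zy yb).
    by rewrite Fz subr0.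
  by rewrite ltrBlDl.
have Ft2 : F t2 = 0%R.
  apply/eqP; rewrite -normr_le0; apply/ler_addgt0Pr => e e0; rewrite add0r.
  have [r r0 rP] := small _ e0.
  have [z [/andP[xz zy] Fz] zr] := sup_adherent r0 supZ.
  have zt2 : (z <= t2)%R by apply: ub_le_sup; [case: supZ | split => //; rewrite xz].
  rewrite -lee_fin; apply: le_trans (rP z t2 _ zt2 _ _); rewrite ?(le_trans ax)// ?(le_trans t2y)//.
    have := cF z t2 (le_trans ax xz) zt2 (le_trans t2y yb).
    by rewrite Fz sub0r normrN.
  by rewrite ltrBlDr addrC -ltrBlDr.
have Dl t : (x <= t < t1)%R -> D t.
  move=> /andP[xt tt1]; have ty : (t <= y)%R by rewrite (le_trans (ltW tt1))// (le_trans t12).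
  apply: FD; first by rewrite (le_trans ax)// (le_trans ty).
  apply/eqP => Ft; move: tt1; rewrite ltNge => /negP; apply.
  by apply: ge_inf; [case: infZ | split => //; rewrite xt].
have Dr t : (t2 < t <= y)%R -> D t.
  move=> /andP[tt2 ty]; have xt : (x <= t)%R by rewrite (le_trans xt1)// (le_trans t12)// ltW.
  apply: FD; first by rewrite (le_trans ax)// (le_trans ty).
  apply/eqP => Ft; move: tt2; rewrite ltNge => /negP; apply.
  by apply: ub_le_sup; [case: supZ | split => //; rewrite xt].
rewrite (@lint_cat _ x t1 y)// ?(le_trans t12)// (@lint_cat _ t1 t2 y)//.
rewrite (lint_restrict_left mh mD Dl) (lint_restrict_right mh mD Dr).
apply: (@le_trans _ _ (lint x t1 h + lint t2 y h)); last first.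
  by rewrite leeD2l// leeDr// lint_ge0.
have c1 := cF x t1 ax xt1 (le_trans t12 (le_trans t2y yb)).
have c2 := cF t2 y (le_trans ax (le_trans xt1 t12)) t2y yb.
apply: le_trans (leeD c1 c2); rewrite -EFinD lee_fin.
by rewrite Ft1 Ft2 subr0 sub0r normrN ler_normB.
Qed.

(** The image of Lebesgue measure under a translation agrees with it on intervals, hence on all
    Borel sets. *)
Lemma lint_shift (s t : R) h : measurable_fun setT h -> (forall t, 0 <= h t) ->
  lint 0 (t - s)%R (fun w => h (s + w)%R) = lint s t h.
Proof.
move=> mh h0; rewrite /lint.
have mphi : measurable_fun setT ((fun w : R => s + w)%R : measurableTypeR R -> measurableTypeR R).
  exact: measurable_funD.
have -> : `[0%R, (t - s)%R]%classic = ((fun w : R => s + w)%R : _ -> measurableTypeR R) @^-1` `[s, t].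
  by apply/seteqP; split => w /=; rewrite !in_itv/= lerBrDl lerDl.
rewrite -(@ge0_integral_pushforward _ _ _ _ _ _ mphi lebesgue_measure _ h)//; last exact: measurable_funTS.
apply: eq_measure_integral => //= A mA _; apply/esym.
apply: lebesgue_measure_unique => //= _ [[a b]] _ <-.
rewrite /pushforward/= (_ : _ @^-1` _ = `](a - s)%R, (b - s)%R]%classic); last first.
  by apply/seteqP; split => w /=; rewrite !in_itv/= ltrBlDl lerBrDl.
rewrite !lebesgue_measure_itv/= !lte_fin ltrD2r.
by case: ifP => // _; rewrite -!EFinB; congr EFin; lra.
Qed.

(** The identity, seen as a map from the completed to the Borel sigma-algebra, is measurable and
    pushes the completed measure forward to Lebesgue measure. *)
Lemma completed_lebesgue_integralE h (D : set R) : measurable D ->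
  measurable_fun D h -> (forall t, D t -> 0 <= h t) ->
  \int[completed_lebesgue_measure]_(t in D) h t = \int[lebesgue_measure]_(t in D) h t.
Proof.
move=> mD mh h0.
pose CT := caratheodory_type (@wlength R idfun)^*%mu.
have mphi : measurable_fun setT (id : CT -> measurableTypeR R).
  move=> _ Y mY; rewrite setTI; exact: sub_caratheodory.
transitivity (\int[completed_lebesgue_measure]_(t in (id : CT -> measurableTypeR R) @^-1` D) (h \o (id : CT -> measurableTypeR R)) t).
  by [].
rewrite -(@ge0_integral_pushforward _ _ _ _ _ _ mphi completed_lebesgue_measure D h)//.
by move=> t; rewrite inE; exact: h0.
Qed.

End interval_integral_complements.

(** * Curves and Borel functions *)

Section curves.
Context {d : measure_display} {R : realType} {X : metricMeasurableType d R}.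
Implicit Types (A : set X) (c : R -> X) (l s t : R).

Lemma arc_mdist A l c s t : arc_length_curve A l c ->
  (0 <= s)%R -> (s <= t)%R -> (t <= l)%R -> (mdist (c s) (c t) <= t - s)%R.
Proof.
move=> [l0 cA cl] s0; rewrite le_eqVlt => /predU1P[<- _|st tl].
  by rewrite mdistxx subrr.
rewrite -lee_fin -(cl s t s0 (ltW st) tl).
apply: ereal_sup_ubound; exists [:: t]; first exact: itv_partition1.
by rewrite /= big_nat1.
Qed.

Lemma itv_partition_shift (s a b : R) q : itv_partition a b q ->
  itv_partition (s + a)%R (s + b)%R (map (+%R s) q).
Proof.
move=> [pq /eqP lq]; split.
  by rewrite path_map; apply: sub_path pq => x y /=; rewrite ltrD2l.
by rewrite last_map lq.
Qed.

Lemma curve_length_shift c s a b :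
  curve_length a b (fun w => c (s + w)%R) = curve_length (s + a)%R (s + b)%R c.
Proof.
have E q : (\sum_(0 <= i < size q)
    mdist (c (s + nth b (a :: q) i)%R) (c (s + nth b (a :: q) i.+1)%R) =
  \sum_(0 <= i < size (map (+%R s) q))
    mdist (c (nth (s + b) (s + a :: map (+%R s) q) i)%R) (c (nth (s + b) (s + a :: map (+%R s) q) i.+1)%R) :> R)%R.
  rewrite size_map; apply: eq_big_nat => i /= iq.
  rewrite -(map_cons (+%R s)) !(nth_map b)//=; last exact: ltnW.
congr ereal_sup; apply/seteqP; split => _ [q qp <-].
  by exists (map (+%R s) q); [exact: itv_partition_shift | rewrite E].
exists (map (+%R (- s)%R) q).
  by have := itv_partition_shift (- s) qp; rewrite !addKr.
rewrite E -map_comp (eq_map (g := id)) ?map_id// => w /=.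
by rewrite addrA subrr add0r.
Qed.

Lemma arc_sub A l c s t : arc_length_curve A l c ->
  (0 <= s)%R -> (s < t)%R -> (t <= l)%R ->
  arc_length_curve A (t - s)%R (fun w => c (s + w)%R).
Proof.
move=> [l0 cA cl] s0 st tl; split; first by rewrite subr_gt0.
- by move=> w /andP[w0 ws]; apply: cA; apply/andP; split; lra.
- move=> x y x0 xy ys; rewrite curve_length_shift cl; first by congr EFin; lra.
  all: by lra.
Qed.

Lemma arc_subset A B l c : (forall t, (0 <= t <= l)%R -> B (c t)) ->
  arc_length_curve A l c -> arc_length_curve B l c.
Proof. by move=> cB [l0 cA cl]; split. Qed.

(* The values of a curve outside [0, l] are arbitrary, so it is replaced by a
   continuous curve that is constant there. *)
Definition clamp l c (t : R) : X := c (Order.max 0%R (Order.min l t)).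

Lemma clampE l c t : (0 <= t <= l)%R -> clamp l c t = c t.
Proof.
by move=> /andP[t0 tl]; rewrite /clamp; rewrite min_r// max_r.
Qed.

Lemma clamp_dist A l c s t : arc_length_curve A l c ->
  (mdist (clamp l c s) (clamp l c t) <= `|t - s|)%R.
Proof.
wlog st : s t / (s <= t)%R.
  move=> H ac; case: (leP s t) => st; first exact: H.
  by rewrite metric_sym distrC; apply: H => //; exact: ltW.
move=> ac; have [l0 _ _] := ac.
pose k (w : R) := Order.max 0%R (Order.min l w).
have k0 w : (0 <= k w)%R by rewrite /k le_max lexx.
have kl w : (k w <= l)%R by rewrite /k ge_max (ltW l0)/= ge_min lexx.
have kst : (k s <= k t <= k s + (t - s))%R.
  rewrite /k; case: (leP l s) => ls; case: (leP l t) => lt;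
    rewrite ?(max_r (ltW l0)); case: (leP 0%R s) => s0; case: (leP 0%R t) => t0; apply/andP; split; lra.
move/andP: kst => [k1 k2].
apply: le_trans (arc_mdist ac (k0 s) k1 (kl t)) _.
by rewrite ger0_norm ?subr_ge0// lerBlDl.
Qed.

Lemma clamp_continuous A l c : arc_length_curve A l c -> continuous (clamp l c).
Proof.
move=> ac t; apply/cvg_ballP => e e0; apply/nbhs_ballP; exists e => // s ts.
rewrite ballEmdist /=; apply: le_lt_trans (clamp_dist t s ac) _.
by move: ts; rewrite /ball/= distrC.
Qed.

End curves.

Section borel.
Context {d : measure_display} {R : realType} {X : metricMeasurableType d R}.
Implicit Types (A : set X) (c : R -> X) (l s t : R) (f g : X -> \bar R).

(* Along a curve only Borel functions are known to be measurable, not functions that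
   are merely measurable for the completion. *)
Definition borelType : Type := g_sigma_algebraType (@open X).
HB.instance Definition _ := Measurable.on borelType.

Definition borel_set A := @measurable _ borelType A.

Definition borel_ge0 g :=
  measurable_fun (setT : set borelType) (g : borelType -> \bar R) /\
  forall x, 0 <= g x.

Lemma open_borel A : open A -> borel_set A.
Proof. by move=> oA; apply: sub_sigma_algebra. Qed.

Lemma clamp_measurable A l c : arc_length_curve A l c ->
  measurable_fun setT (clamp l c : measurableTypeR R -> borelType).
Proof.
move=> ac; apply: (@measurability _ _ _ borelType setT _ (@open X)) => //.
move=> _ [U oU <-]; rewrite setTI; apply: open_measurable.
by apply: open_comp => // t _; exact: (clamp_continuous ac).
Qed.

Lemma measurable_clamp_comp A l c g : arc_length_curve A l c -> borel_ge0 g ->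
  measurable_fun setT (g \o clamp l c).
Proof.
move=> ac [mg _].
exact: (@measurableT_comp _ _ _ _ borelType _ g _ _ mg (clamp_measurable ac)).
Qed.

Lemma curve_integralE A l c g : arc_length_curve A l c -> borel_ge0 g ->
  curve_integral l c g = lint 0 l (g \o clamp l c).
Proof.
move=> ac bg; rewrite /curve_integral /lint -completed_lebesgue_integralE//.
- by apply: eq_integral => t; rewrite inE /= in_itv => tl; rewrite clampE.
- by apply: measurable_funTS; exact: measurable_clamp_comp ac bg.
- by move=> t _; case: bg => _; exact.
Qed.

Lemma curve_integral_sub A l c g s t : arc_length_curve A l c -> borel_ge0 g ->
  (0 <= s)%R -> (s < t)%R -> (t <= l)%R ->
  curve_integral (t - s)%R (fun w => c (s + w)%R) g = lint s t (g \o clamp l c).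
Proof.
move=> ac bg s0 st tl; have as_ := arc_sub ac s0 st tl.
rewrite (curve_integralE as_ bg) -(@lint_shift _ s t (g \o clamp l c)); last 2 first.
  exact: measurable_clamp_comp ac bg.
  by move=> w; case: bg => _; exact.
apply: eq_integral => w; rewrite inE /= in_itv/= => wts; congr g.
rewrite clampE// clampE//; case/andP: wts => w0 ws; apply/andP; split; lra.
Qed.

End borel.

(** * Powers, Borel representatives and p-integrable Borel functions *)

Section ereal_power.
Context {R : realType}.
Implicit Types (x y : \bar R) (p : R).

Lemma le_poweR x y p : (0 <= p)%R -> 0 <= x -> x <= y -> x `^ p <= y `^ p.
Proof.
move=> p0 x0 xy; apply: gt0_ler_poweR => //; rewrite in_itv/= leey andbT //.
exact: le_trans x0 xy.
Qed.

Lemma poweR_maxe x y p : 0 <= x -> 0 <= y -> (maxe x y) `^ p <= x `^ p + y `^ p.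
Proof.
move=> x0 y0; rewrite maxEle; case: ifP => _; first by rewrite leeDr// poweR_ge0.
by rewrite leeDl// poweR_ge0.
Qed.

Lemma poweRK x p : (0 < p)%R -> 0 <= x -> (x `^ p) `^ p^-1 = x.
Proof. by move=> p0 x0; rewrite -poweRrM mulfV ?gt_eqF// poweRe1. Qed.

Lemma poweRVK x p : (0 < p)%R -> 0 <= x -> (x `^ p^-1) `^ p = x.
Proof. by move=> p0 x0; rewrite -poweRrM mulVf ?gt_eqF// poweRe1. Qed.

End ereal_power.

Section borel_representatives.
Context {d : measure_display} {R : realType} {X : metricMeasurableType d R}.
Variable mu : {measure set X -> \bar R}.
Hypothesis mu_borel : borel_completion mu.
Implicit Types (A N : set X) (f g : X -> \bar R).

Lemma borel_measurable A : borel_set A -> measurable A.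
Proof.
move=> bA; apply/mu_borel; exists A, set0; split => //.
- exact: (@measurable0 _ (@borelType _ _ X)).
- by rewrite setDv.
Qed.

Lemma borel_ge0_measurable g : borel_ge0 g -> measurable_fun setT g.
Proof.
move=> [mg _] _ Y mY; rewrite setTI; apply: borel_measurable.
by have := mg measurableT _ mY; rewrite setTI.
Qed.

Lemma measurable_borelP A : measurable A ->
  exists B N, [/\ borel_set B, borel_set N, mu N = 0, B `<=` A & A `\` B `<=` N].
Proof. by move/mu_borel. Qed.

Lemma borel_hull A : measurable A -> exists D N,
  [/\ borel_set D, borel_set N, mu N = 0, A `<=` D & D `\` A `<=` N].
Proof.
move=> /measurable_borelP[B [N [bB bN N0 BA ABN]]]; exists (B `|` N), N; split => //.
- exact: (@measurableU _ (@borelType _ _ X)).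
- by move=> x Ax; have [Bx|Bx] := pselect (B x); [left | right; apply: ABN].
- by move=> x [[Bx|Nx] nAx] //; exfalso; apply/nAx/BA.
Qed.

(** For rational [q] the set [f > q] contains a Borel set [B q] up to a part of a null set [N q].
    Setting [g = +oo] on the union [M] of the [N q] makes [g] Borel. That [f <= g] holds everywhere,
    and not just almost everywhere, is what preserves upper gradient inequalities on curves inside a
    null set. *)
Lemma borel_rep f : measurable_fun setT f -> (forall x, 0 <= f x) ->
  exists g N, [/\ borel_ge0 g, borel_set N, mu N = 0, (forall x, f x <= g x) &
    forall x, ~ N x -> f x = g x].
Proof.
move=> mf f0.
have /choice[B /choice[N BN]] (q : rat) : exists B N, [/\ borel_set B, borel_set N,
    mu N = 0, B `<=` [set x | (ratr q)%:E < f x] & [set x | (ratr q)%:E < f x] `\` B `<=` N].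
  apply: measurable_borelP; rewrite -[X in measurable X]setTI.
  exact: emeasurable_fun_o_infty.
pose M := \bigcup_q N q.
have bM : borel_set M.
  by apply: (@bigcupT_measurable_rat _ (@borelType _ _ X)) => q; have [] := BN q.
have M0 : mu M = 0.
  apply/negligibleP; first exact: borel_measurable.
  have -> : M = \bigcup_n (if unpickle n is Some q then N q else set0).
    apply/seteqP; split => [x [q _ Nq]|x [n _]].
      exists (pickle q); first by [].
      by rewrite pickleK; exact: Nq.
    by case: unpickle => // q Nq; exists q.
  apply: negligible_bigcup => n; case: unpickle => [q|]; last exact: negligible_set0.
  have [_ bN N0 _ _] := BN q; apply/negligibleP => //; exact: borel_measurable.
pose g x := if x \in M then +oo else f x.
exists g, M; split => //.
- split; last by move=> x; rewrite /g; case: ifP.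
  move=> mT; apply: (@measurability _ _ _ _ setT _ _ (ErealGenOInfty.measurableE R)) => //.
  move=> _ [_ [r ->] <-]; rewrite setTI.
  have -> : g @^-1` `]r%:E, +oo[ = M `|` \bigcup_q (if (r <= ratr q :> R)%R then B q else set0).
    apply/seteqP; split => x.
      rewrite /= /g in_itv/= andbT; have [Mx|Mx] := pselect (M x); first by left.
      rewrite memNset// => rfx; right.
      have [q rq qf] : exists2 q, (r <= ratr q :> R)%R & (ratr q)%:E < f x.
        move: rfx; case: (f x) => [s| |] //.
          by rewrite lte_fin => /rat_in_itvoo[q]; rewrite in_itv/= => /andP[rq qs]; exists q; rewrite ?ltW.
        have [q] := rat_in_itvoo (ltr_pwDr ltr01 (lexx r)); rewrite in_itv/= => /andP[rq _] _.
        by exists q; [exact: ltW|rewrite ltry].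
      exists q => //; rewrite rq; have [_ _ _ _ BNq] := BN q.
      by have [//|Bx] := pselect (B q x); exfalso; apply: Mx; exists q => //; apply: BNq.
    rewrite /= /g in_itv/= andbT => -[Mx|[q _]]; first by rewrite mem_set// ltry.
    case: ifP => // rq Bx; case: ifP => _; first exact: ltry.
    have [_ _ _ BNq _] := BN q; apply: le_lt_trans (BNq _ Bx); by rewrite lee_fin.
  apply: (@measurableU _ (@borelType _ _ X)) => //.
  apply: (@bigcupT_measurable_rat _ (@borelType _ _ X)) => q; case: ifP => _.
    by have [] := BN q.
  exact: (@measurable0 _ (@borelType _ _ X)).
- by move=> x; rewrite /g; case: ifP => //; rewrite leey.
- by move=> x Mx; rewrite /g memNset.
Qed.

End borel_representatives.

Section borel_Lp.
Context {d : measure_display} {R : realType} {X : metricMeasurableType d R}.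
Variables (mu : {measure set X -> \bar R}) (p : R).
Hypothesis mu_borel : borel_completion mu.
Hypothesis p_gt0 : (0 < p)%R.
Implicit Types (A N : set X) (f g h rho : X -> \bar R).

Definition Lp_borel g := borel_ge0 g /\ \int[mu]_x (g x `^ p) < +oo.

Lemma measurable_poweR_comp g : measurable_fun setT g ->
  measurable_fun setT (fun x => g x `^ p).
Proof. by move=> mg; exact: (measurableT_comp (measurable_poweR p) mg). Qed.

Lemma borel_poweR_measurable g : borel_ge0 g -> measurable_fun setT (fun x => g x `^ p).
Proof. by move/(borel_ge0_measurable mu_borel); exact: measurable_poweR_comp. Qed.

Lemma le_int_poweR f g : borel_ge0 f -> borel_ge0 g -> (forall x, f x <= g x) ->
  \int[mu]_x (f x `^ p) <= \int[mu]_x (g x `^ p).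
Proof.
move=> bf bg fg; apply: ge0_le_integral => //.
- by move=> x _; exact: poweR_ge0.
- exact: borel_poweR_measurable.
- exact: borel_poweR_measurable.
- by move=> x _; apply: le_poweR => //; [exact: ltW|case: bf].
Qed.

Lemma Lp_borel_le f g : borel_ge0 f -> Lp_borel g -> (forall x, f x <= g x) -> Lp_borel f.
Proof.
move=> bf [bg ig] fg; split => //; apply: le_lt_trans ig; exact: le_int_poweR.
Qed.

Lemma borel_max f g : borel_ge0 f -> borel_ge0 g -> borel_ge0 (fun x => maxe (f x) (g x)).
Proof.
move=> [mf f0] [mg g0]; split; first exact: measurable_maxe.
by move=> x; rewrite le_max f0.
Qed.

Lemma borel_add f g : borel_ge0 f -> borel_ge0 g -> borel_ge0 (fun x => f x + g x).
Proof.
move=> [mf f0] [mg g0]; split; first exact: emeasurable_funD.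
by move=> x; rewrite adde_ge0.
Qed.

Lemma borel_scale (k : R) f : (0 <= k)%R -> borel_ge0 f -> borel_ge0 (fun x => k%:E * f x).
Proof.
move=> k0 [mf f0]; split; last by move=> x; rewrite mule_ge0.
by apply: emeasurable_funM => //; exact: measurable_cst.
Qed.

Lemma borel_restrict (D : set X) f : borel_set D -> borel_ge0 f -> borel_ge0 (f \_ D).
Proof.
move=> bD [mf f0]; split; last by move=> x; rewrite patchE; case: ifP.
apply: (@measurable_restrictT _ _ (@borelType _ _ X) _ D f bD).1.
exact: measurable_funTS.
Qed.

Lemma borel_glue (D : set X) f g : borel_set D -> borel_ge0 f -> borel_ge0 g ->
  borel_ge0 (fun x => if x \in D then g x else f x).
Proof.
move=> bD [mf f0] [mg g0]; split; last by move=> x; case: ifP.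
apply: (@measurable_fun_ifT _ _ (@borelType _ _ X)) => //.
apply: (measurable_fun_bool true) => //; rewrite setTI.
by rewrite (_ : _ @^-1` _ = D)//; apply/seteqP; split => x; [exact: set_mem|exact: mem_set].
Qed.

Lemma Lp_max f g : Lp_borel f -> Lp_borel g -> Lp_borel (fun x => maxe (f x) (g x)).
Proof.
move=> [bf if_] [bg ig]; split; first exact: borel_max.
apply: (@le_lt_trans _ _ (\int[mu]_x (f x `^ p + g x `^ p))).
  apply: ge0_le_integral => //.
  - by move=> x _; exact: poweR_ge0.
  - exact/borel_poweR_measurable/borel_max.
  - by apply: emeasurable_funD; exact: borel_poweR_measurable.
  - by move=> x _; apply: poweR_maxe; [case: bf|case: bg].
rewrite ge0_integralD//; first by rewrite lte_add_pinfty.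
- by move=> x _; exact: poweR_ge0.
- exact: borel_poweR_measurable.
- by move=> x _; exact: poweR_ge0.
- exact: borel_poweR_measurable.
Qed.

Lemma int_poweR_scale (k : R) f : (0 <= k)%R -> borel_ge0 f ->
  \int[mu]_x ((k%:E * f x) `^ p) = (k `^ p)%:E * \int[mu]_x (f x `^ p).
Proof.
move=> k0 bf; rewrite -ge0_integralZl_EFin ?powR_ge0//.
- by apply: eq_integral => x _; rewrite poweRM// ?lee_fin//; case: bf.
- by move=> x _; exact: poweR_ge0.
- exact: borel_poweR_measurable.
Qed.

Lemma Lp_scale (k : R) f : (0 <= k)%R -> Lp_borel f -> Lp_borel (fun x => k%:E * f x).
Proof.
move=> k0 [bf if_]; split; first exact: borel_scale.
rewrite int_poweR_scale//; apply: lte_mul_pinfty => //; first by rewrite lee_fin powR_ge0.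
Qed.

Lemma Lp_add f g : Lp_borel f -> Lp_borel g -> Lp_borel (fun x => f x + g x).
Proof.
move=> Lf Lg; apply: (@Lp_borel_le _ (fun x => 2%:E * maxe (f x) (g x))).
- by apply: borel_add; [case: Lf|case: Lg].
- by apply: Lp_scale => //; exact: Lp_max.
- move=> x; rewrite -[2%R]/(1 + 1)%R EFinD ge0_muleDl ?lee_fin// !mul1e.
  by apply: leeD; rewrite le_max lexx ?orbT.
Qed.

Lemma Lp_cst0 : Lp_borel (cst 0).
Proof.
split; first by split => //; exact: measurable_cst.
under eq_integral do rewrite poweR0r ?gt_eqF//.
by rewrite integral0.
Qed.

(** The function [(sum_n rho_n^p)^(1/p)] dominates every [rho n], and its energy is just the sum of
    their energies. *)
Lemma Lp_sup_geometric (rho : nat -> X -> \bar R) : (forall n, borel_ge0 (rho n)) ->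
  (forall n, \int[mu]_x (rho n x `^ p) <= (1 / (2 ^ n.+1)%:R)%:E) ->
  exists2 r, Lp_borel r & forall n x, rho n x <= r x.
Proof.
move=> brho irho.
have mrho n : measurable_fun setT (fun x : @borelType _ _ X => rho n x `^ p).
  by case: (brho n) => mg _; exact: (measurableT_comp (measurable_poweR p) mg).
have S0 x : 0 <= \sum_(n <oo) (rho n x `^ p) by apply: nneseries_ge0 => n _ _; exact: poweR_ge0.
have mS : measurable_fun setT (fun x : @borelType _ _ X => \sum_(n <oo) (rho n x `^ p)).
  by apply: ge0_emeasurable_sum => // n x _ _; exact: poweR_ge0.
exists (fun x => (\sum_(n <oo) (rho n x `^ p)) `^ p^-1); last first.
  move=> n x; rewrite -[leLHS](poweRK p_gt0); last by case: (brho n).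
  apply: le_poweR; [by rewrite invr_ge0 ltW|exact: poweR_ge0|].
  rewrite (@nneseriesD1 _ _ n)//; last by move=> k _; exact: poweR_ge0.
  by rewrite leeDl//; apply: nneseries_ge0 => k _ _; exact: poweR_ge0.
split.
  by split; [exact: (measurableT_comp (measurable_poweR p^-1) mS)|move=> x; exact: poweR_ge0].
under eq_integral do rewrite poweRVK//.
rewrite integral_nneseries//; last 2 first.
  by move=> n; exact: borel_poweR_measurable.
  by move=> n x _; exact: poweR_ge0.
apply: (@le_lt_trans _ _ 1); last exact: ltry.
apply: le_trans (epsilon_trick0 predT (ler01 : (0 <= 1 :> R)%R)).
by apply: lee_nneseries => // n *; apply: integral_ge0 => *; exact: poweR_ge0.
Qed.

(** This merges countably many exceptional families into one: a curve on which [r] has finite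
    integral is admissible for every [rho n]. Scaling makes the energies summable. *)
Lemma Lp_countable (rho : nat -> X -> \bar R) : (forall n, Lp_borel (rho n)) ->
  exists2 r, Lp_borel r &
    forall n, exists2 k : R, (0 < k)%R & forall x, rho n x <= k%:E * r x.
Proof.
move=> Lrho.
have /choice[a aP] n : exists a : R, (0 < a)%R /\
    \int[mu]_x ((a%:E * rho n x) `^ p) <= (1 / (2 ^ n.+1)%:R)%:E.
  have [brho irho] := Lrho n.
  have I0 : 0 <= \int[mu]_x (rho n x `^ p) by apply: integral_ge0 => x _; exact: poweR_ge0.
  move: irho I0; case E : (\int[mu]_x (rho n x `^ p)) => [s| |] // _; rewrite lee_fin => s0.
  (* The denominator [s + 1] instead of [s] includes the case of vanishing energy. *)
  pose e : R := (1 / (2 ^ n.+1)%:R / (s + 1))%R.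
  have e0 : (0 < e)%R by rewrite divr_gt0// ?divr_gt0// ?ltr0n ?expn_gt0// ltr_wpDl.
  exists (e `^ p^-1)%R; split; first exact: powR_gt0.
  rewrite int_poweR_scale ?powR_ge0// E -EFinM lee_fin -powRrM mulVf ?gt_eqF// powRr1; last exact: ltW.
  have H (A : R) : (0 <= A -> A / (s + 1) * s <= A)%R.
    by move=> A0; rewrite mulrAC ler_pdivrMr ?ltr_wpDl//; nra.
  by apply: H; rewrite divr_ge0.
have [r Lr rP] := Lp_sup_geometric (fun n => borel_scale (ltW (aP n).1) (Lrho n).1) (fun n => (aP n).2).
exists r => // n; have [a0 _] := aP n; exists (a n)^-1%R; first by rewrite invr_gt0.
move=> x; have := rP n x.
move=> /(lee_wpmul2l (x := ((a n)^-1)%:E)); rewrite muleA -EFinM mulVf ?gt_eqF// mul1e.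
by apply; rewrite lee_fin invr_ge0 ltW.
Qed.

Lemma Lp_null N : borel_set N -> mu N = 0 -> Lp_borel (cst +oo \_ N).
Proof.
move=> bN N0; split.
  by apply: borel_restrict => //; split => [|x]; [exact: measurable_cst|rewrite leey].
have mN := borel_measurable mu_borel bN.
have -> : \int[mu]_x ((cst +oo \_ N) x `^ p) = \int[mu]_(x in N) cst +oo x.
  rewrite [RHS]integral_mkcond; apply: eq_integral => x _; rewrite !patchE.
  by case: ifP => _; rewrite ?poweRyr ?gt_eqF// poweR0r ?gt_eqF.
by rewrite integral_cst// N0 mule0.
Qed.

End borel_Lp.

(** * Weak upper gradients *)

Section weak_gradients.
Context {d : measure_display} {R : realType} {X : metricMeasurableType d R}.
Variables (mu : {measure set X -> \bar R}) (p : R).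
Hypothesis mu_borel : borel_completion mu.
Hypothesis p_gt0 : (0 < p)%R.
Implicit Types (A B N D V Z : set X) (f g h rho : X -> \bar R) (c : R -> X) (l : R).

Lemma le_curve_integral A l c g h : arc_length_curve A l c -> borel_ge0 g ->
  borel_ge0 h -> (forall x, g x <= h x) ->
  curve_integral l c g <= curve_integral l c h.
Proof.
move=> ac bg bh gh; rewrite (curve_integralE ac bg) (curve_integralE ac bh).
apply: le_lint => //.
- exact: measurable_clamp_comp ac bg.
- exact: measurable_clamp_comp ac bh.
- by move=> t; case: bg => _; exact.
- by move=> t _; exact: gh.
Qed.

Lemma curve_integral_scale A l c (k : R) g : (0 <= k)%R -> arc_length_curve A l c ->
  borel_ge0 g -> curve_integral l c (fun x => k%:E * g x) = k%:E * curve_integral l c g.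
Proof.
move=> k0 ac bg; rewrite (curve_integralE ac bg) (curve_integralE ac (borel_scale k0 bg)).
apply: ge0_integralZl_EFin => //.
- by move=> t _; case: bg => _; exact.
- by apply: measurable_funTS; exact: measurable_clamp_comp ac bg.
Qed.

Lemma curve_integral_dominated A l c g h (k : R) : (0 <= k)%R ->
  arc_length_curve A l c -> borel_ge0 g -> borel_ge0 h ->
  (forall x, g x <= k%:E * h x) -> curve_integral l c h < +oo ->
  curve_integral l c g < +oo.
Proof.
move=> k0 ac bg bh gh hoo.
apply: le_lt_trans (le_curve_integral ac bg (borel_scale k0 bh) gh) _.
by rewrite (curve_integral_scale k0 ac bh); apply: lte_mul_pinfty.
Qed.

(** A function that is infinite on [N] has finite integral along a curve only if the curve spends
    zero length in [N]. By [Lp_null] this holds for almost every curve if [N] is a Borel null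
    set. *)
Lemma curve_integral_eq A l c N g h : arc_length_curve A l c -> borel_ge0 g ->
  borel_ge0 h -> borel_set N -> (forall x, ~ N x -> g x = h x) ->
  curve_integral l c (cst +oo \_ N) < +oo ->
  curve_integral l c g = curve_integral l c h.
Proof.
move=> ac bg bh bN gh Noo.
have b1 : borel_ge0 (cst +oo \_ N : X -> \bar R).
  by apply: borel_restrict => //; split => [|x]; [exact: measurable_cst|rewrite leey].
move: Noo; rewrite (curve_integralE ac bg) (curve_integralE ac bh) (curve_integralE ac b1) => Noo.
apply: ge0_ae_eq_integral => //.
- by apply: measurable_funTS; exact: measurable_clamp_comp ac bg.
- by apply: measurable_funTS; exact: measurable_clamp_comp ac bh.
- by move=> t _; case: bg => _; exact.
- by move=> t _; case: bh => _; exact.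
have iN : lebesgue_measure.-integrable `[0%R, l]%classic ((cst +oo \_ N) \o clamp l c).
  apply/integrableP; split; first by apply: measurable_funTS; exact: measurable_clamp_comp ac b1.
  apply: le_lt_trans Noo; apply: ge0_le_integral_nomeas => t _ //.
  by rewrite gee0_abs//; case: b1 => _; exact.
have [M [mM M0 MP]] := integrable_ae (mu := lebesgue_measure) (measurable_itv `[0%R, l]) iN.
exists M; split => //; apply: subset_trans MP => t /=; apply: contra_not => + tl.
move=> /(_ tl).
rewrite patchE; case: ifPn => // + _; rewrite notin_setE => Nt; exact: gh.
Qed.

(* Borel counterpart of [weak_upper_gradient], with the exceptional family given by a
   single rho and with the conditions on g left to the lemmas. *)
Definition wug A f g := exists2 rho, Lp_borel mu p rho &
  forall l c, arc_length_curve A l c -> curve_integral l c rho < +oo ->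
    `|f (c 0%R) - f (c l)| <= curve_integral l c g.

(** Exceptional functions combine by their pointwise maximum, whose finite integral forces both
    integrals to be finite. *)
Lemma wug_max A f g rho : Lp_borel mu p rho -> borel_ge0 g ->
  (exists2 rho0, Lp_borel mu p rho0 &
  forall l c, arc_length_curve A l c -> curve_integral l c rho < +oo ->
     curve_integral l c rho0 < +oo ->
    `|f (c 0%R) - f (c l)| <= curve_integral l c g) -> wug A f g.
Proof.
move=> Lr bg [r0 L0 rP]; exists (fun x => maxe (rho x) (r0 x)); first exact: Lp_max.
have bm := borel_max Lr.1 L0.1.
move=> l c ac mc; apply: (rP _ _ ac); apply: le_lt_trans mc.
  by apply: (le_curve_integral ac) => //; [case: Lr|move=> x; rewrite le_max lexx].
by apply: (le_curve_integral ac) => //; [case: L0|move=> x; rewrite le_max lexx orbT].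
Qed.

Lemma wug_ae A f g h N : borel_ge0 g -> borel_ge0 h -> borel_set N -> mu N = 0 ->
  (forall x, ~ N x -> g x = h x) -> wug A f g -> wug A f h.
Proof.
move=> bg bh bN N0 gh [rho Lr rP].
apply: (wug_max (Lp_null mu_borel p_gt0 bN N0)) => //; exists rho => // l c ac Nc rc.
by rewrite -(curve_integral_eq ac bg bh bN gh Nc); exact: rP.
Qed.

Lemma wug_subset A B f g : B `<=` A -> wug A f g -> wug B f g.
Proof.
move=> BA [rho Lr rP]; exists rho => // l c ac; apply: rP.
by have [_ cB _] := ac; apply: arc_subset ac => t tl; apply: BA; exact: cB.
Qed.

Lemma arc_ends A l c : arc_length_curve A l c -> A (c 0%R) /\ A (c l).
Proof. by move=> [l0 cA _]; split; apply: cA; rewrite ?lexx ltW. Qed.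

Lemma wug_contraction A f f' g (k : R) : (0 <= k)%R -> borel_ge0 g ->
  (forall x y, A x -> A y -> `|f' x - f' y| <= k%:E * `|f x - f y|) ->
  wug A f g -> wug A f' (fun x => k%:E * g x).
Proof.
move=> k0 bg ff' [rho Lr rP]; exists rho => // l c ac rc.
rewrite (curve_integral_scale k0 ac bg).
have [A0 Al] := arc_ends ac; apply: le_trans (ff' _ _ A0 Al) _.
by apply: lee_wpmul2l; [rewrite lee_fin|exact: rP].
Qed.

Lemma wug_lip A f f' g : borel_ge0 g ->
  (forall x y, A x -> A y -> `|f' x - f' y| <= `|f x - f y|) ->
  wug A f g -> wug A f' g.
Proof.
move=> bg ff' [rho Lr rP]; exists rho => // l c ac rc.
have [A0 Al] := arc_ends ac; apply: le_trans (ff' _ _ A0 Al) _; exact: rP.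
Qed.

Lemma wug_eq A f f' g : (forall x, A x -> f x = f' x) -> wug A f g -> wug A f' g.
Proof.
move=> ff' [rho Lr rP]; exists rho => // l c ac rc.
by have [A0 Al] := arc_ends ac; rewrite -!ff'//; exact: rP.
Qed.

Lemma wug_add A (f1 f2 : X -> R) g1 g2 : borel_ge0 g1 -> borel_ge0 g2 ->
  wug A (EFin \o f1) g1 -> wug A (EFin \o f2) g2 ->
  wug A (EFin \o (f1 \+ f2)%R) (fun x => g1 x + g2 x).
Proof.
move=> b1 b2 [r1 L1 P1] W2; apply: (wug_max L1); first exact: borel_add.
have [r2 L2 P2] := W2; exists r2 => // l c ac c1 c2.
rewrite (curve_integralE ac (borel_add b1 b2)).
rewrite (@lintD _ _ _ (g1 \o clamp l c) (g2 \o clamp l c)); last 4 first.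
- exact: measurable_clamp_comp ac b1.
- exact: measurable_clamp_comp ac b2.
- by move=> t; case: b1 => _; exact.
- by move=> t; case: b2 => _; exact.
rewrite -(curve_integralE ac b1) -(curve_integralE ac b2).
apply: le_trans (leeD (P1 _ _ ac c1) (P2 _ _ ac c2)).
rewrite /= lee_fin opprD addrACA; exact: ler_normD.
Qed.

Lemma abse_sub_lty (x y : \bar R) : `|x - y| < +oo -> x \is a fin_num /\ y \is a fin_num.
Proof. by move: x y => [x| |] [y| |]. Qed.

(** A subcurve of an admissible curve is again admissible, so the inequality for endpoints passes to
    all pairs of parameters. Including [g] in the exceptional function makes its integral finite,
    and then [f] cannot be infinite anywhere on the curve. *)
Lemma wug_along A f g : Lp_borel mu p g -> wug A f g ->
  exists2 rho, Lp_borel mu p rho & forall l c, arc_length_curve A l c ->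
    curve_integral l c rho < +oo ->
    [/\ forall t, (0 <= t <= l)%R -> f (c t) \is a fin_num,
        controlled 0 l (fun t => fine (f (c t))) (g \o clamp l c) &
        lint 0 l (g \o clamp l c) < +oo].
Proof.
move=> Lg [r Lr rP]; exists (fun x => maxe (r x) (g x)); first exact: Lp_max.
have [br _] := Lr; have [bg _] := Lg.
move=> l c ac mc.
have rc : curve_integral l c r < +oo.
  apply: le_lt_trans mc; apply: (le_curve_integral ac) => //; first exact: borel_max.
  by move=> x; rewrite le_max lexx.
have gc : lint 0 l (g \o clamp l c) < +oo.
  rewrite -(curve_integralE ac bg).
  apply: le_lt_trans mc; apply: (le_curve_integral ac) => //; first exact: borel_max.
  by move=> x; rewrite le_max lexx orbT.
have mg := measurable_clamp_comp ac bg; have mr := measurable_clamp_comp ac br.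
have g0 t : 0 <= (g \o clamp l c) t by case: bg => _; exact.
have r0 t : 0 <= (r \o clamp l c) t by case: br => _; exact.
have main s t : (0 <= s)%R -> (s < t)%R -> (t <= l)%R ->
    `|f (c s) - f (c t)| <= lint s t (g \o clamp l c).
  move=> s0 st tl; have := rP _ _ (arc_sub ac s0 st tl).
  rewrite !(curve_integral_sub ac)// addr0 [(s + (t - s))%R]addrC subrK; apply.
  apply: le_lt_trans (lint_sub mr r0 s0 tl) _.
  by rewrite -(curve_integralE ac br).
have lb s t : (0 <= s)%R -> (t <= l)%R -> lint s t (g \o clamp l c) < +oo.
  by move=> s0 tl; exact: le_lt_trans (lint_sub mg g0 s0 tl) gc.
have [l0 _ _] := ac.
have ffin t : (0 <= t <= l)%R -> f (c t) \is a fin_num.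
  move=> /andP[t0]; rewrite le_eqVlt => /predU1P[->|tl].
    have /abse_sub_lty[] // := le_lt_trans (main 0%R l (lexx _) l0 (lexx _)) (lb _ _ (lexx _) (lexx _)).
  have /abse_sub_lty[] // := le_lt_trans (main t l t0 tl (lexx _)) (lb _ _ t0 (lexx _)).
split => // s t s0; rewrite le_eqVlt => /predU1P[<- sl|st tl].
  by rewrite subrr normr0 lint_ge0.
apply: le_trans (main _ _ s0 st tl).
have fs : f (c s) \is a fin_num by apply: ffin; rewrite s0 (le_trans (ltW st)).
have ft : f (c t) \is a fin_num by apply: ffin; rewrite (le_trans s0 (ltW st)).
by rewrite -{2}(fineK fs) -{2}(fineK ft).
Qed.

Lemma controlled_ends A f g l c : arc_length_curve A l c -> borel_ge0 g ->
  (forall t, (0 <= t <= l)%R -> f (c t) \is a fin_num) ->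
  controlled 0 l (fun t => fine (f (c t))) (g \o clamp l c) ->
  `|f (c 0%R) - f (c l)| <= curve_integral l c g.
Proof.
move=> ac bg ffin cg; have [l0 _ _] := ac.
have f0 : f (c 0%R) \is a fin_num by apply: ffin; rewrite lexx ltW.
have fl : f (c l) \is a fin_num by apply: ffin; rewrite lexx ltW.
rewrite (curve_integralE ac bg) -(fineK f0) -(fineK fl).
by apply: (cg 0%R l) => //; exact: ltW.
Qed.

Lemma preimage_clamp_measurable A l c D : arc_length_curve A l c -> borel_set D ->
  measurable (clamp l c @^-1` D).
Proof.
by move=> ac bD; rewrite -[X in measurable X]setTI; exact: (clamp_measurable ac).
Qed.

(** [controlled_nonzero] is applied along each curve. A Borel superset [D] stands in for the set
    where [f] is nonzero, which need not be Borel itself. *)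
Lemma wug_nonzero A f g D : Lp_borel mu p g -> wug A f g -> borel_set D ->
  (forall x, A x -> f x != 0 -> D x) -> wug A f (g \_ D).
Proof.
move=> Lg W bD fD; have [rho Lr rP] := wug_along Lg W; exists rho => // l c ac rc.
have [ffin cg ig] := rP _ _ ac rc; have bg := Lg.1.
apply: (controlled_ends ac) => //; first exact: borel_restrict.
have mD := preimage_clamp_measurable ac bD.
have := @controlled_nonzero _ 0%R l _ _ (clamp l c @^-1` D) (measurable_clamp_comp ac bg) _ ig cg mD.
have -> : (g \_ D) \o clamp l c = (g \o clamp l c) \_ (clamp l c @^-1` D).
  by apply/funext => t; rewrite /= !patchE.
apply; first by move=> t; case: bg => _; exact.
move=> t tl F0; rewrite /= clampE//; apply: fD; first by case: ac => _ + _; exact.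
by apply: contra_neq F0 => ->.
Qed.

(** Only inside [V] is [h] an upper gradient. The preimage of [V] under a curve is open, and its
    subintervals are curves in [V], which is the situation of [controlled_glue]. *)
Lemma wug_glue A V D f g h : Lp_borel mu p g -> Lp_borel mu p h -> open V ->
  borel_set D -> D `<=` V -> wug A f g -> wug (A `&` V) f h ->
  wug A f (fun x => if x \in D then h x else g x).
Proof.
move=> Lg Lh oV bD DV Wg Wh; have bg := Lg.1; have bh := Lh.1.
have [r1 L1 P1] := wug_along Lg Wg; have [r2 L2 P2] := wug_along Lh Wh.
apply: (wug_max L1); first exact: borel_glue.
exists (fun x => maxe (r2 x) (h x)); first exact: Lp_max.
move=> l c ac c1 mc.
have c2 : curve_integral l c r2 < +oo.
  apply: le_lt_trans mc; apply: (le_curve_integral ac); first by case: L2.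
    by apply: borel_max => //; case: L2.
  by move=> x; rewrite le_max lexx.
have hc : curve_integral l c h < +oo.
  apply: le_lt_trans mc; apply: (le_curve_integral ac) => //.
    by apply: borel_max => //; case: L2.
  by move=> x; rewrite le_max lexx orbT.
have [ffin cg ig] := P1 _ _ ac c1.
apply: (controlled_ends ac) => //; first exact: borel_glue.
pose V' := clamp l c @^-1` V.
have oV' : open V' by apply: open_comp => // t _; exact: (clamp_continuous ac).
have [l0 cA _] := ac.
have mr2 := measurable_clamp_comp ac L2.1.
apply: (@controlled_glue _ 0%R l _ (g \o clamp l c) (h \o clamp l c) V' (clamp l c @^-1` D)) => //.
- exact: ltW.
- exact: measurable_clamp_comp ac bg.
- exact: measurable_clamp_comp ac bh.
- by move=> t; case: bg => _; exact.
- by move=> t; case: bh => _; exact.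
- by rewrite -(curve_integralE ac bh).
- move=> s t s0; rewrite le_eqVlt => /predU1P[<- sl _|st tl sub].
    by rewrite subrr normr0 lint_ge0// => x; case: bh => _; exact.
  have as_ := arc_sub ac s0 st tl.
  have as2 : arc_length_curve (A `&` V) (t - s)%R (fun w => c (s + w)%R).
    apply: arc_subset as_ => w /andP[w0 ws].
    have sw : (s <= s + w <= t)%R by apply/andP; split; lra.
    have swl : (0 <= s + w <= l)%R by apply/andP; split; lra.
    split; first exact: cA.
    by have := sub (s + w)%R; rewrite /= in_itv/= /V' /= clampE//; apply.
  have [|fin2 cg2 _] := P2 _ _ as2.
    rewrite (curve_integral_sub ac)//; last by case: L2.
    apply: le_lt_trans (lint_sub mr2 _ s0 tl) _; first by move=> w; case: L2.1 => _; exact.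
    by rewrite -(curve_integralE ac)//; case: L2.
  have := controlled_ends as2 bh fin2 cg2.
  rewrite (curve_integral_sub ac)// addr0 [(s + (t - s))%R]addrC subrK => hst.
  have fs : f (c s) \is a fin_num by apply: ffin; rewrite s0 (le_trans (ltW st)).
  have ft : f (c t) \is a fin_num by apply: ffin; rewrite (le_trans s0 (ltW st)).
  by move: hst; rewrite -{1}(fineK fs) -{1}(fineK ft).
- exact: preimage_clamp_measurable ac bD.
- by move=> t; exact: DV.
Qed.

Lemma wug_to_weak A f g : measurable A -> borel_ge0 g -> wug A f g ->
  weak_upper_gradient p mu A f g.
Proof.
move=> mA bg [rho [br ir] rP]; split.
- by apply: measurable_funTS; exact: borel_ge0_measurable.
- by move=> x _; case: bg => _; exact.
exists [set lc | curve_integral lc.1 lc.2 rho = +oo].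
  exists rho; split.
  - by apply: measurable_funTS; exact: borel_ge0_measurable.
  - by move=> x _; case: br => _; exact.
  - apply: le_lt_trans ir; apply: ge0_subset_integral => //.
      exact: borel_poweR_measurable.
    by move=> x _; exact: poweR_ge0.
  - by [].
by move=> l c ac /= rc; apply: rP => //; rewrite ltey; apply/eqP.
Qed.

Lemma measurable_rep A f : measurable A -> measurable_fun A f ->
  (forall x, A x -> 0 <= f x) ->
  exists g N, [/\ borel_ge0 g, borel_set N, mu N = 0, (forall x, A x -> f x <= g x) &
    forall x, ~ N x -> g x = (f \_ A) x].
Proof.
move=> mA mf f0.
have [||g [N [bg bN N0 fg fE]]] := @borel_rep _ _ _ mu mu_borel (f \_ A).
- exact: (measurable_restrictT f mA).1.
- by move=> x; rewrite patchE; case: ifPn => //; rewrite inE => /f0.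
exists g, N; split => //; last by move=> x /fE.
by move=> x Ax; apply: le_trans (fg x); rewrite patchE mem_set.
Qed.

Lemma int_rep A N f g : measurable A -> borel_ge0 g -> borel_set N -> mu N = 0 ->
  measurable_fun A f -> (forall x, A x -> 0 <= f x) ->
  (forall x, ~ N x -> g x = (f \_ A) x) ->
  \int[mu]_x (g x `^ p) = \int[mu]_(x in A) (f x `^ p).
Proof.
move=> mA bg bN N0 mf f0 gf; rewrite [RHS]integral_mkcond.
have mN := borel_measurable mu_borel bN.
apply: ge0_ae_eq_integral => //.
- exact: borel_poweR_measurable.
- apply: (measurable_restrictT _ mA).1.
  exact: (measurableT_comp (measurable_poweR p) mf).
- by move=> x _; exact: poweR_ge0.
- by move=> x _; rewrite patchE; case: ifP => // _; exact: poweR_ge0.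
- exists N; split => // x /=; apply: contra_notP => Nx _.
  by rewrite gf// !patchE; case: ifP => // _; rewrite poweR0r ?gt_eqF.
Qed.

(** Larger gradients keep the inequality, and a larger [rho] still has infinite integral on the
    exceptional family, so Borel majorants replace both. *)
Lemma weak_to_wug A f g : measurable A -> weak_upper_gradient p mu A f g ->
  exists h N, [/\ borel_ge0 h, borel_set N, mu N = 0,
    (forall x, ~ N x -> h x = (g \_ A) x) & wug A f h].
Proof.
move=> mA [mg g0 [Gamma [rho [mr r0 ir rG]] gP]].
have [h [N [bh bN N0 gh hE]]] := measurable_rep mA mg g0.
exists h, N; split => //.
have [r [M [br bM M0 rr rE]]] := measurable_rep mA mr r0.
exists r; first by split => //; rewrite (int_rep mA br bM M0 mr r0 rE).
have cle l c (k k' : X -> \bar R) : arc_length_curve A l c -> (forall x, A x -> 0 <= k x) ->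
    (forall x, A x -> k x <= k' x) -> curve_integral l c k <= curve_integral l c k'.
  move=> [l0 cA _] k0 kk; apply: ge0_le_integral_nomeas => t /=; rewrite in_itv => tl.
    by apply/k0/cA.
  by apply/kk/cA.
move=> l c ac rc; apply: le_trans (cle l c g h ac g0 gh); apply: gP => // GG.
have := rG _ _ ac GG => E; have := cle l c rho r ac r0 rr.
by rewrite E leye_eq => /eqP E2; move: rc; rewrite E2.
Qed.

End weak_gradients.

Section integral_comparison.
Context {d : measure_display} {T : measurableType d} {R : realType}.
Variable mu : {measure set T -> \bar R}.

Lemma ge0_integrable (D : set T) (f : T -> \bar R) : measurable_fun D f ->
  (forall x, D x -> 0 <= f x) -> \int[mu]_(x in D) f x < +oo -> mu.-integrable D f.
Proof.
move=> mf f0 foo; apply/integrableP; split => //.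
apply: le_lt_trans foo; apply: ge0_le_integral_nomeas => x Dx //.
by rewrite gee0_abs// f0.
Qed.

Lemma integral_le_negligible_lt (f g : T -> \bar R) : measurable_fun setT f ->
  measurable_fun setT g -> (forall x, 0 <= f x) -> (forall x, f x <= g x) ->
  \int[mu]_x g x < +oo -> \int[mu]_x g x <= \int[mu]_x f x ->
  mu [set x | f x < g x] = 0.
Proof.
move=> mf mg f0 fg goo gf.
have g0 x : 0 <= g x by exact: le_trans (f0 x) (fg x).
have foo : \int[mu]_x f x < +oo by apply: le_lt_trans goo; exact: ge0_le_integral.
have If : mu.-integrable setT f by exact: ge0_integrable.
have Ig : mu.-integrable setT g by exact: ge0_integrable.
have mgf : measurable_fun setT (g \- f) by exact: emeasurable_funB.
have fin_f : {ae mu, forall x, setT x -> f x \is a fin_num} by exact: integrable_ae.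
have E0 : \int[mu]_x `|(g \- f) x| = 0.
  have -> : \int[mu]_x `|(g \- f) x| = \int[mu]_x (g x - f x).
    apply: ae_eq_integral => //; first exact: measurableT_comp.
    apply: filterS fin_f => x /= /(_ Logic.I) fx _.
    by rewrite gee0_abs// sube_ge0 ?fx.
  rewrite integralB//; apply/eqP; rewrite sube_eq ?add0e; last 2 first.
  - by rewrite integrable_fin_num.
  - by rewrite fin_num_adde_defr// fin_numN integrable_fin_num.
  by rewrite eq_le gf/=; exact: ge0_le_integral.
have mL : measurable [set x | f x < g x].
  by rewrite -[X in measurable X]setTI; exact: measurable_lte.
have /(_ E0) ae0 := (ae_eq_integral_abs mu measurableT mgf).1.
apply/negligibleP => //; have [N [mN N0 NP]] : mu.-negligible (~` [set x | setT x -> (g \- f) x = cst 0 x]) by exact: ae0.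
have [M [mM M0 MP]] : mu.-negligible (~` [set x | setT x -> f x \is a fin_num]) by exact: fin_f.
apply: (@negligibleS _ _ _ mu (N `|` M)); last first.
  apply: negligibleU; apply/negligibleP => //.
move=> x /= fgx; apply: contrapT => /not_orP[nN nM].
have fx : f x \is a fin_num by apply: contrapT => nf; apply: nM; apply: MP => /= /(_ Logic.I).
have : g x - f x = 0 by apply: contrapT => ne; apply: nN; apply: NP => /= /(_ Logic.I).
move: fgx fx; case: (f x) => [a| |] //; case: (g x) => [b| |] //.
rewrite lte_fin => ab _ [] /eqP; rewrite subr_eq0 => /eqP E.
by move: ab; rewrite E ltxx.
Qed.

End integral_comparison.

(** * Minimal energies and minimal gradients *)

Section weak_gradient_limits.
Context {d : measure_display} {R : realType} {X : metricMeasurableType d R}.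
Variables (mu : {measure set X -> \bar R}) (p : R).
Hypothesis mu_borel : borel_completion mu.
Hypothesis p_gt0 : (0 < p)%R.
Implicit Types (A B N D V Z : set X) (f g h rho : X -> \bar R) (c : R -> X) (l : R).

Lemma borel_esups (h_ : nat -> X -> \bar R) : (forall n, borel_ge0 (h_ n)) ->
  borel_ge0 (fun x => esups (h_ ^~ x) 0%N).
Proof.
move=> bh; split; first by apply: measurable_fun_esups => n; case: (bh n).
move=> x; apply: le_trans (_ : h_ 0%N x <= _); first by case: (bh 0%N) => _; exact.
by apply: ereal_sup_ubound; exists 0%N.
Qed.

Lemma borel_einfs (h_ : nat -> X -> \bar R) : (forall n, borel_ge0 (h_ n)) ->
  borel_ge0 (fun x => einfs (h_ ^~ x) 0%N).
Proof.
move=> bh; split; first by apply: measurable_fun_einfs => n; case: (bh n).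
move=> x; apply: le_ereal_inf_tmp => _ [n _ <-]; by case: (bh n) => _; exact.
Qed.

Lemma le_esups (u : nat -> \bar R) n : u n <= esups u 0%N.
Proof. by apply: ereal_sup_ubound; exists n. Qed.

Lemma einfs_le (u : nat -> \bar R) n : einfs u 0%N <= u n.
Proof. by apply: ereal_inf_lbound; exists n. Qed.

Lemma Lp_countable_finite (rho : nat -> X -> \bar R) : (forall n, Lp_borel mu p (rho n)) ->
  exists2 r, Lp_borel mu p r & forall A l c, arc_length_curve A l c ->
    curve_integral l c r < +oo -> forall n, curve_integral l c (rho n) < +oo.
Proof.
move=> Lrho; have [r Lr rP] := Lp_countable mu_borel p_gt0 Lrho.
exists r => // A l c ac rc n; have [k k0 kP] := rP n.
exact: (curve_integral_dominated (ltW k0) ac (Lrho n).1 Lr.1 kP rc).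
Qed.

(** An upper gradient inequality involves only the two endpoints of a curve, so for each pair of
    points a single index [n] is enough. *)
Lemma wug_sup A f (f_ h_ : nat -> X -> \bar R) : (forall n, borel_ge0 (h_ n)) ->
  (forall n, wug mu p A (f_ n) (h_ n)) ->
  (forall x y, A x -> A y -> exists n, f x = f_ n x /\ f y = f_ n y) ->
  wug mu p A f (fun x => esups (h_ ^~ x) 0%N).
Proof.
move=> bh Wn fE.
have /choice[rho rP] n : exists r, Lp_borel mu p r /\ forall l c, arc_length_curve A l c ->
    curve_integral l c r < +oo -> `|f_ n (c 0%R) - f_ n (c l)| <= curve_integral l c (h_ n).
  by have [r Lr rP] := Wn n; exists r.
have [r Lr rfin] := Lp_countable_finite (fun n => (rP n).1).
exists r => // l c ac rc; have [A0 Al] := arc_ends ac.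
have [n [-> ->]] := fE _ _ A0 Al.
apply: le_trans ((rP n).2 _ _ ac (rfin _ _ _ ac rc n)) _.
by apply: (le_curve_integral ac) => //; [exact: borel_esups|move=> x; exact: le_esups].
Qed.

(** Dominated convergence along each curve on which [m 0] has finite integral; the other curves are
    exceptional, since [m 0] is p-integrable. *)
Lemma wug_decreasing A f (m : nat -> X -> \bar R) : Lp_borel mu p (m 0%N) ->
  (forall n, borel_ge0 (m n)) -> (forall n x, m n.+1 x <= m n x) ->
  (forall n, wug mu p A f (m n)) -> wug mu p A f (fun x => einfs (m ^~ x) 0%N).
Proof.
move=> L0 bm dm Wn.
have /choice[rho rP] n : exists r, Lp_borel mu p r /\ forall l c, arc_length_curve A l c ->
    curve_integral l c r < +oo -> `|f (c 0%R) - f (c l)| <= curve_integral l c (m n).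
  by have [r Lr rP] := Wn n; exists r.
have [r Lr rfin] := Lp_countable_finite (fun n => (rP n).1).
exists (fun x => maxe (r x) (m 0%N x)); first exact: Lp_max.
have bM : borel_ge0 (fun x => maxe (r x) (m 0%N x)) by apply: borel_max => //; case: Lr.
move=> l c ac Mc.
have rc : curve_integral l c r < +oo.
  apply: le_lt_trans Mc; apply: (le_curve_integral ac) => //; first by case: Lr.
  by move=> x; rewrite le_max lexx.
have m0c : curve_integral l c (m 0%N) < +oo.
  apply: le_lt_trans Mc; apply: (le_curve_integral ac) => //.
  by move=> x; rewrite le_max lexx orbT.
have bi := borel_einfs bm.
have mono x : {homo m ^~ x : n k / (n <= k)%N >-> k <= n}.
  by apply/nonincreasing_seqP => n; exact: dm.
have D1 : {ae lebesgue_measure, forall t, `[0%R, l]%classic t ->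
    (m n \o clamp l c) t @[n --> \oo] --> ((fun x => einfs (m ^~ x) 0%N) \o clamp l c) t}.
  apply: aeW => t _ /=; have := ereal_nonincreasing_cvgn (mono (clamp l c t)).
  suff -> : einfs (m ^~ (clamp l c t)) 0%N = ereal_inf [set m n (clamp l c t) | n in setT] by [].
  congr ereal_inf; by apply/seteqP; split => _ [n _ <-]; exists n.
have D2 : lebesgue_measure.-integrable `[0%R, l]%classic (m 0%N \o clamp l c).
  apply: ge0_integrable; first exact: measurable_funTS (measurable_clamp_comp ac (bm 0%N)).
    by move=> t _; case: (bm 0%N) => _; exact.
  by move: m0c; rewrite (curve_integralE ac (bm 0%N)).
have D3 : {ae lebesgue_measure, forall t, forall n, `[0%R, l]%classic t ->
    `|(m n \o clamp l c) t| <= (m 0%N \o clamp l c) t}.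
  apply: aeW => t n _ /=; rewrite gee0_abs; first exact: mono.
  by case: (bm n) => _; exact.
have [_ _ cvgm] := @dominated_convergence _ _ _ lebesgue_measure `[0%R, l]%classic (measurable_itv _)
  (fun n => m n \o clamp l c) ((fun x => einfs (m ^~ x) 0%N) \o clamp l c) (m 0%N \o clamp l c)
  (fun n => measurable_funTS (measurable_clamp_comp ac (bm n)))
  (measurable_funTS (measurable_clamp_comp ac bi)) D1 D2 D3.
have {}cvgm : curve_integral l c (m n) @[n --> \oo] --> curve_integral l c (fun x => einfs (m ^~ x) 0%N).
  rewrite (curve_integralE ac bi) /lint.
  rewrite (_ : (fun n => _) = (fun n => lint 0 l (m n \o clamp l c))); last first.
    by apply/funext => n; rewrite (curve_integralE ac (bm n)).
  exact: cvgm.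
rewrite -(cvg_lim _ cvgm)//; apply: lime_ge; first by apply/cvg_ex; eexists; exact: cvgm.
by apply: nearW => n; exact: (rP n).2 (rfin _ _ _ ac rc n).
Qed.

Lemma borel_lt_set g h : borel_ge0 g -> borel_ge0 h -> borel_set [set x | h x < g x].
Proof.
move=> [mg _] [mh _]; rewrite -[X in borel_set X]setTI.
by apply: (@measurable_lte _ (@borelType _ _ X)).
Qed.

(** Gluing with [V] the whole space and [D] the Borel set where [h < g]. *)
Lemma wug_mine A f g h : Lp_borel mu p g -> Lp_borel mu p h ->
  wug mu p A f g -> wug mu p A f h ->
  Lp_borel mu p (fun x => mine (g x) (h x)) /\ wug mu p A f (fun x => mine (g x) (h x)).
Proof.
move=> Lg Lh Wg Wh; have bD := borel_lt_set Lg.1 Lh.1.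
have -> : (fun x => mine (g x) (h x)) =
    fun x => if x \in [set x | h x < g x] then h x else g x.
  apply/funext => x; case: (boolP (x \in _)) => [|]; rewrite ?inE ?notin_setE /=.
    by move=> hg; rewrite minC /Order.min hg.
  by move/negP; rewrite -leNgt => gh; rewrite min_l.
split.
  apply: (@Lp_borel_le _ _ _ mu p mu_borel p_gt0 _ g) => //.
    by apply: borel_glue; [|case: Lg|case: Lh].
  by move=> x; case: ifPn => //; rewrite inE => /ltW.
apply: (wug_glue mu_borel (V := setT)) => //; first exact: openT.
by rewrite setIT.
Qed.

(** Minimality of the total energy can be reached by a minimizing sequence; [energy_minimal_le] then
    upgrades it to minimality almost everywhere. *)
Definition energy_minimal f m := [/\ Lp_borel mu p m, wug mu p setT f m &
  forall g, borel_ge0 g -> wug mu p setT f g ->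
    \int[mu]_x (m x `^ p) <= \int[mu]_x (g x `^ p)].

Fixpoint running_min (g_ : nat -> X -> \bar R) n : X -> \bar R :=
  if n is k.+1 then fun x => mine (running_min g_ k x) (g_ n x) else g_ 0%N.

(** Since minima of gradients are gradients, a minimizing sequence may be made decreasing. Its
    pointwise infimum is then a gradient, and no weak compactness is involved. *)
Lemma exists_energy_minimal f g : Lp_borel mu p g -> wug mu p setT f g ->
  exists m, energy_minimal f m.
Proof.
move=> Lg Wg.
pose S := [set \int[mu]_x (g x `^ p) | g in [set g | borel_ge0 g /\ wug mu p setT f g]].
have S0 : 0 <= ereal_inf S.
  by apply: le_ereal_inf_tmp => _ [k _ <-]; apply: integral_ge0 => x _; exact: poweR_ge0.
have Sfin : ereal_inf S \is a fin_num.
  rewrite ge0_fin_numE//; apply: le_lt_trans Lg.2.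
  by apply: ereal_inf_lbound; exists g => //; split => //; case: Lg.
have /choice[g_ gP] n : exists k, [/\ Lp_borel mu p k, wug mu p setT f k &
    \int[mu]_x (k x `^ p) < ereal_inf S + (n.+1%:R^-1)%:E].
  have n0 : (0 < n.+1%:R^-1 :> R)%R by rewrite invr_gt0.
  have [_ [k [bk Wk] <-] kS] := lb_ereal_inf_adherent n0 Sfin.
  exists k; split => //; split => //; apply: lt_trans kS _.
  by rewrite lte_add_pinfty ?ltry// -ge0_fin_numE.
have rm n : Lp_borel mu p (running_min g_ n) /\ wug mu p setT f (running_min g_ n).
  elim: n => [|n [Ln Wn]]; first by have [] := gP 0%N.
  by have [L1 W1 _] := gP n.+1; exact: wug_mine.
have rle n x : running_min g_ n x <= g_ n x.
  by case: n => //= n; rewrite ge_min lexx orbT.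
pose m x := einfs (running_min g_ ^~ x) 0%N.
have bm : borel_ge0 m by apply: borel_einfs => n; have [[]] := rm n.
have Em n : \int[mu]_x (m x `^ p) <= \int[mu]_x (g_ n x `^ p).
  have [[bg _] _ _] := gP n; apply: le_int_poweR => // x.
  by apply: le_trans (rle n x); exact: einfs_le.
exists m; split.
- split => //; apply: le_lt_trans (Em 0%N) _; by have [[]] := gP 0%N.
- apply: wug_decreasing => [|n|n x|n]; [exact: (rm 0%N).1|exact: (rm n).1.1| |exact: (rm n).2].
  by rewrite /= ge_min lexx.
move=> k bk Wk; apply: (@le_trans _ _ (ereal_inf S)); last first.
  by apply: ereal_inf_lbound; exists k.
apply/lee_addgt0Pr => e e0.
have [n ne] : exists n, (n.+1%:R^-1 < e)%R.
  by have [n _ /(_ n (leqnn n))] := near_infty_natSinv_lt (PosNum e0); exists n.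
apply: le_trans (Em n) _; have [_ _ /ltW/le_trans] := gP n; apply.
by rewrite leeD2l// lee_fin ltW.
Qed.

End weak_gradient_limits.

(** * Separability of doubling spaces *)

Section separability.
Context {d : measure_display} {R : realType} {X : metricMeasurableType d R}.
Variable mu : {measure set X -> \bar R}.
Hypothesis mu_borel : borel_completion mu.
Hypothesis mu_balls : balls_pos_finite mu.
Hypothesis mu_doubling : doubling mu.
Implicit Types (x y : X) (e : R).

Lemma metric_ball_open x e : open (ball x e).
Proof.
rewrite openE => y; rewrite ballEmdist /= => xy; apply/nbhs_ballP.
exists (e - mdist x y)%R; first by rewrite /= subr_gt0.
move=> z; rewrite !ballEmdist /= ltrBrDl; apply: le_lt_trans; exact: metric_triangle.
Qed.

Lemma ball_measurable x e : measurable (ball x e).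
Proof.
by apply: (borel_measurable mu_borel); apply: open_borel; exact: metric_ball_open.
Qed.

Lemma doubling_iter : exists2 C : R, (0 < C)%R & forall x e n, (0 < e)%R ->
  mu (ball x (2 ^+ n * e)%R) <= (C ^+ n)%:E * mu (ball x e).
Proof.
have [C0 C0P] := mu_doubling; pose C := Order.max 1%R C0.
have C_gt0 : (0 < C)%R by rewrite /C lt_max ltr01.
have CP x e : (0 < e)%R -> mu (ball x (2 * e)%R) <= C%:E * mu (ball x e).
  move=> e0; apply: le_trans (C0P x e e0) _; apply: lee_wpmul2r => //.
  by rewrite lee_fin /C le_max lexx orbT.
exists C => // x e n e0; elim: n => [|n IH]; first by rewrite !expr0 mul1r mul1e.
rewrite exprS -mulrA; apply: le_trans (CP _ _ _) _; first by rewrite mulr_gt0// exprn_gt0.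
rewrite [in leRHS]exprS EFinM -muleA; apply: lee_wpmul2l => //; by rewrite lee_fin ltW.
Qed.

Definition separated_in (B : set X) e (q : seq X) :=
  (forall y, y \in q -> B y) /\
  forall i j, (i < j < size q)%N -> (e <= mdist (nth point q i) (nth point q j))%R.

(** The balls of radius [e / 2] around the points are disjoint, lie in the ball [B] of radius
    [r + e], and by doubling each carries at least the fraction [C^-n] of its measure. Hence there
    are at most [C^n] points. *)
Lemma separated_bound (x : X) (r e : R) : (0 < r)%R -> (0 < e)%R -> exists N : nat,
  forall q, separated_in (ball x r) e q -> (size q <= N)%N.
Proof.
move=> r0 e0; have [C C0 CP] := doubling_iter.
have e20 : (0 < e / 2)%R by rewrite divr_gt0.
pose B := ball x (r + e)%R.
have re0 : (0 < r + e)%R by rewrite addr_gt0.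
(* A ball of radius [2 (r + e)] around any of the points contains [B]. *)
have [n nP] : exists n, (2 * (r + e) <= 2 ^+ n * (e / 2))%R.
  have [n _ nP] := near_infty_natSinv_lt (PosNum (divr_gt0 e20 (mulr_gt0 (ltr0Sn R 1) re0))).
  exists n; rewrite -ler_pdivrMr//.
  have /= := nP n (leqnn n); rewrite invf_plt ?posrE ?divr_gt0 ?mulr_gt0// => H.
  rewrite invf_div in H; apply: le_trans (ltW H) _.
  by rewrite -natrX ler_nat ltn_expl.
exists (Num.bound (C ^+ n)) => q [qB qsep].
rewrite leqNgt; apply/negP => /ltnW Nq.
pose F (i : nat) : set X := if (i < size q)%N then ball (nth point q i) (e / 2)%R else set0.
have mF i : measurable (F i).
  by rewrite /F; case: ifP => _; [exact: ball_measurable|exact: measurable0].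
have Fsub i : F i `<=` B.
  rewrite /F; case: ifP => [iq y Fy|_ y []]; rewrite /B.
  apply: (@ball_triangle _ _ (nth point q i)); first exact: (qB _ (mem_nth _ iq)).
  by apply: le_ball Fy; lra.
have triv : trivIset setT F.
  apply: ltn_trivIset => j i ij; rewrite -subset0 => y; rewrite /F => -[].
  case: ifP => [iq yi|_ []]; case: ifP => [jq yj|_ []].
  have := qsep i j; rewrite ij jq => /(_ isT); rewrite leNgt => /negP; apply.
  have := ball_triangle yi (ball_sym yj).
  by rewrite ballEmdist /= -splitr.
have mB := mu_balls x re0.
have BF i : (i < size q)%N -> mu B <= (C ^+ n)%:E * mu (F i).
  move=> iq; rewrite /F iq; apply: le_trans (CP _ _ n e20).
  apply: le_measure; rewrite ?inE; try exact: ball_measurable.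
  move=> y xy; apply: (le_ball nP).
  have /ball_sym qx := qB _ (mem_nth point iq).
  by apply: le_ball (ball_triangle qx xy); lra.
have sumF : \sum_(i < size q) mu (F i) <= mu B.
  rewrite -measure_semi_additive_ord_I//; last 2 first.
  - exact: sub_trivIset triv.
  - by apply: bigsetU_measurable.
  apply: le_measure; rewrite ?inE; first exact: bigsetU_measurable.
    exact: ball_measurable.
  by rewrite -bigcup_mkord => y [i _]; exact: Fsub.
have : (size q)%:R%:E * mu B <= (C ^+ n)%:E * mu B.
  apply: (@le_trans _ _ ((C ^+ n)%:E * \sum_(i < size q) mu (F i))); last first.
    by apply: lee_wpmul2l => //; rewrite lee_fin exprn_ge0// ltW.
  rewrite ge0_sume_distrr; last by move=> i _; exact: measure_ge0.
  have -> (k : nat) : k%:R%:E * mu B = \sum_(i < k) mu B.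
    elim: k => [|k IH]; first by rewrite mul0e big_ord0.
    by rewrite big_ord_recr/= -IH -natr1 EFinD ge0_muleDl ?lee_fin// mul1e.
  by apply: lee_sum => i _; exact: BF.
move/andP: mB => [B0 Boo].
move: B0 Boo; rewrite -/B; case: (mu B) => [b| |] // b0 _.
rewrite -!EFinM lee_fin ler_pM2r; last by rewrite -lte_fin.
apply/negP; rewrite -ltNge; apply: (@lt_le_trans _ _ (Num.bound (C ^+ n))%:R%R).
  by have := archi_boundP (exprn_ge0 n (ltW C0)).
by rewrite ler_nat.
Qed.

Lemma finite_net (x : X) (r e : R) : (0 < r)%R -> (0 < e)%R -> exists q : seq X,
  forall y, ball x r y -> exists2 z, z \in q & (mdist z y < e)%R.
Proof.
move=> r0 e0; have [N NP] := separated_bound x r0 e0.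
apply: contrapT => nonet.
suff H n : exists q, separated_in (ball x r) e q /\ size q = n.
  by have [q [qs qn]] := H N.+1; have := NP _ qs; rewrite qn ltnn.
elim: n => [|n [q [[qB qs] qn]]].
  by exists [::]; split => //; split => // i j; rewrite ltn0 andbF.
have [y [xy yq]] : exists y, ball x r y /\ forall z, z \in q -> (e <= mdist z y)%R.
  apply: contrapT => H; apply: nonet; exists q => y xy.
  apply: contrapT => H2; apply: H; exists y; split => // z zq.
  by rewrite leNgt; apply/negP => zy; apply: H2; exists z.
exists (rcons q y); split; last by rewrite size_rcons qn.
split.
  by move=> z; rewrite mem_rcons inE => /predU1P[->|/qB].
move=> i j; rewrite size_rcons ltnS => /andP[ij]; rewrite leq_eqVlt => /predU1P[jE|jq].
  rewrite jE !nth_rcons ltnn eqxx -jE; have iq : (i < size q)%N by rewrite -jE.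
  by rewrite jE iq; apply: yq; exact: mem_nth.
by rewrite !nth_rcons (ltn_trans ij jq) jq; apply: qs; rewrite ij.
Qed.

Lemma separable_sequence : exists s : nat -> X,
  forall y e, (0 < e)%R -> exists n, (mdist (s n) y < e)%R.
Proof.
have /choice[Q QP] (nk : nat * nat) : exists q : seq X,
    forall y, ball (point : X) nk.1.+1%:R y -> exists2 z, z \in q & (mdist z y < nk.2.+1%:R^-1)%R.
  by apply: finite_net; rewrite ?invr_gt0.
pose s n := if unpickle n is Some (nk, i) then nth point (Q nk) i else (point : X).
exists s => y e e0.
have [n yn] : exists n : nat, ball (point : X) n.+1%:R y.
  exists (Num.bound (mdist (point : X) y)); rewrite ballEmdist/=.
  apply: lt_trans (archi_boundP (mdist_ge0 _ _)) _; by rewrite ltr_nat.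
have [k _ kP] := near_infty_natSinv_lt (PosNum e0).
have [z zq zy] := QP (n, k) _ yn.
exists (pickle ((n, k), index z (Q (n, k)))); rewrite /s pickleK nth_index//.
by apply: lt_trans zy _; exact: (kP k (leqnn k)).
Qed.

End separability.

Section minimal_gradients.
Context {d : measure_display} {R : realType} {X : metricMeasurableType d R}.
Variables (mu : {measure set X -> \bar R}) (p : R).
Hypothesis mu_borel : borel_completion mu.
Hypothesis mu_balls : balls_pos_finite mu.
Hypothesis mu_doubling : doubling mu.
Hypothesis p_gt0 : (0 < p)%R.
Implicit Types (A B N D V Z : set X) (f g h m rho : X -> \bar R) (c : R -> X) (l : R).

Lemma wug_restrict B f g : borel_set B -> borel_ge0 g -> wug mu p B f g ->
  wug mu p B f (g \_ B).
Proof.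
move=> bB bg [rho Lr rP]; exists rho => // l c ac rc; apply: le_trans (rP _ _ ac rc) _.
have [_ cB _] := ac.
rewrite (curve_integralE ac bg) (curve_integralE ac (borel_restrict bB bg)).
apply: le_lint.
- exact: measurable_clamp_comp ac bg.
- exact: measurable_clamp_comp ac (borel_restrict bB bg).
- by move=> t; case: bg => _; exact.
by move=> t tl /=; rewrite patchE mem_set// clampE//; exact: cB.
Qed.

(** Lindelof argument: balls around a dense sequence with radii [1 / (k + 1)] are countably many.
    Only those on which [P] is known to hold almost everywhere contribute to the exceptional union,
    and they cover [V]. *)
Lemma open_cover_negligible V (P : X -> Prop) : open V ->
  (forall x, V x -> exists2 r : R, (0 < r)%R &
     forall y e, (0 < e)%R -> ball y e `<=` ball x r -> ball y e `<=` V ->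
       {ae mu, forall z, ball y e z -> P z}) ->
  {ae mu, forall x, V x -> P x}.
Proof.
move=> oV VP; have [s sP] := separable_sequence mu_borel mu_balls mu_doubling.
pose b (nk : nat * nat) := ball (s nk.1) (nk.2.+1%:R^-1 : R)%R.
pose good nk := {ae mu, forall z, b nk z -> P z}.
pose F n : set X := if unpickle n is Some nk then
  (if `[< good nk >] then [set z | ~ (b nk z -> P z)] else set0) else set0.
apply: (@negligibleS _ _ _ mu (\bigcup_n F n)); last first.
  apply: negligible_bigcup => n; rewrite /F; case: unpickle => [nk|]; last exact: negligible_set0.
  by case: asboolP => [gd|_]; [exact: gd|exact: negligible_set0].
move=> x /= /not_implyP[Vx nPx].
have [r r0 rP] := VP x Vx.
have [r' /= r'0 r'V] : exists2 r' : R, (0 < r')%R & ball x r' `<=` V.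
  have /nbhs_ballP[r' r'0 r'V] : nbhs x V by apply: open_nbhs_nbhs.
  by exists r'.
(* A ball of radius less than [e] that contains [x] lies in the ball of radius [2 e] around [x]. *)
pose e := (Order.min r r' / 2)%R.
have e0 : (0 < e)%R by rewrite divr_gt0// lt_min r0.
have [k _ kP] := near_infty_natSinv_lt (PosNum e0).
have k0 : (0 < k.+1%:R^-1 :> R)%R by rewrite invr_gt0.
have [n nx] := sP x _ k0.
have bx : ball (s n) (k.+1%:R^-1 : R)%R x by rewrite ballEmdist.
have sub r1 : (2 * e <= r1)%R -> b (n, k) `<=` ball x r1.
  move=> er y by_; apply: (le_ball er); apply: le_ball (ball_triangle (ball_sym bx) by_).
  by have ke : (k.+1%:R^-1 < e)%R := kP k (leqnn k); rewrite mulrDl mul1r lerD// ltW.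
have rr : (2 * e = Order.min r r')%R by rewrite /e mulrC divfK.
exists (pickle (n, k)) => //; rewrite /F pickleK.
case: asboolP => [_|]; first by apply/not_implyP.
case; apply: rP => //.
- by apply: sub; rewrite rr ge_min lexx.
- by apply: subset_trans r'V; apply: sub; rewrite rr ge_min lexx orbT.
Qed.

(* On a small ball where h is p-integrable, min(m, h) may replace m without losing
   the upper gradient property, so minimality of the energy forces m <= h there. *)
Lemma energy_minimal_le f f' m U V h : energy_minimal mu p f m -> open U ->
  open V -> U `<=` V ->
  (forall x, U x -> f x = f' x) -> weak_upper_gradient p mu V f' h ->
  Lp_loc p mu V h -> {ae mu, forall x, U x -> m x <= h x}.
Proof.
move=> [Lm Wm Em] oU oV UV ff' Wh [mh hloc].
have mV : measurable V by apply: (borel_measurable mu_borel); exact: open_borel.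
have [k [N [bk bN N0 kE Wk]]] := weak_to_wug mu_borel p_gt0 mV Wh.
have h0 : forall x, V x -> 0 <= h x by case: Wh.
apply: open_cover_negligible => // x Ux.
have [r r0 rh] := hloc x (UV _ Ux); exists r => // y e e0 yx yU.
have yV := subset_trans yU UV.
pose B := ball y e.
have bB : borel_set B by apply: open_borel; exact: metric_ball_open.
have mB : measurable B by exact: (borel_measurable mu_borel).
have bkB := borel_restrict bB bk.
have LkB : Lp_borel mu p (k \_ B).
  split => //; rewrite (@int_rep _ _ _ mu p mu_borel p_gt0 B N h)//.
  - apply: le_lt_trans rh.
    rewrite (eq_integral (fun y => `|h y| `^ p)); last first.
      by move=> z; rewrite inE => Bz; rewrite gee0_abs// h0//; exact: yV.
    apply: ge0_subset_integral => //.
    + apply: measurableI => //; exact: (ball_measurable mu_borel).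
    + apply: (measurable_funS mV); first exact: subIsetl.
      apply: (measurableT_comp (measurable_poweR p)); exact: measurableT_comp.
    + by move=> z _; exact: poweR_ge0.
    + by move=> z Bz; split; [exact: yV|exact: yx].
  - exact: measurable_funS mh.
  - by move=> z Bz; apply: h0; exact: yV.
  - move=> z Nz; rewrite !patchE; case: ifPn => // zB.
    by rewrite kE// patchE mem_set//; apply: yV; rewrite inE in zB.
have WkB : wug mu p B f (k \_ B).
  apply: wug_restrict => //; apply: (wug_eq (f := f')).
    by move=> z Bz; rewrite ff'//; exact: yU.
  exact: wug_subset Wk.
pose D := B `&` [set z | (k \_ B) z < m z].
have bD : borel_set D.
  apply: (@measurableI _ (@borelType _ _ X)) => //.
  by apply: borel_lt_set => //; case: Lm.
pose G z := if z \in D then (k \_ B) z else m z.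
have bG : borel_ge0 G by apply: borel_glue => //; case: Lm.
have WG : wug mu p setT f G.
  apply: (wug_glue mu_borel (V := B)) => //; first exact: metric_ball_open.
    by move=> z [].
  by rewrite setTI.
have Gm z : G z <= m z.
  by rewrite /G; case: ifPn => //; rewrite inE => -[_ /ltW].
have G0 z : 0 <= G z by case: bG => _; exact.
have mu0 : mu [set z | G z `^ p < m z `^ p] = 0.
  apply: integral_le_negligible_lt.
  - exact: borel_poweR_measurable.
  - by apply: borel_poweR_measurable => //; case: Lm.
  - by move=> z; exact: poweR_ge0.
  - by move=> z; apply: le_poweR => //; exact: ltW.
  - by case: Lm.
  - exact: Em.
have mS : measurable [set z | G z `^ p < m z `^ p].
  rewrite -[X in measurable X]setTI; apply: measurable_lte => //.
    exact: borel_poweR_measurable.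
  by apply: borel_poweR_measurable => //; case: Lm.
apply: (@negligibleS _ _ _ mu ([set z | G z `^ p < m z `^ p] `|` N)); last first.
  apply: negligibleU; apply/negligibleP => //; exact: (borel_measurable mu_borel).
move=> z /= /not_implyP[Bz /negP]; rewrite -ltNge => hm.
have [Nz|Nz] := pselect (N z); [by right|left].
have kh : (k \_ B) z = h z.
  by rewrite patchE mem_set// kE// patchE mem_set//; exact: yV.
have zD : D z by split => //=; rewrite kh.
rewrite /= /G mem_set// kh ltNge; apply/negP => le_mh.
have p'0 : (0 <= p^-1)%R by rewrite invr_ge0 ltW.
have := le_poweR p'0 (poweR_ge0 _ _) le_mh.
rewrite !poweRK//; [|by apply: h0; exact: yV|by case: Lm => -[_ +] _; exact].
by rewrite leNgt hm.
Qed.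

Lemma Lp_borel_loc g A : measurable A -> Lp_borel mu p g -> Lp_loc p mu A g.
Proof.
move=> mA [bg ig]; have mg := borel_ge0_measurable mu_borel bg; split.
  exact: measurable_funTS.
move=> x _; exists 1%R => //; apply: le_lt_trans ig.
rewrite (eq_integral (fun y => g y `^ p)); last first.
  by move=> z _; rewrite gee0_abs//; case: bg => _; exact.
apply: ge0_subset_integral => //.
- by apply: measurableI => //; exact: (ball_measurable mu_borel).
- exact: borel_poweR_measurable.
- by move=> z _; exact: poweR_ge0.
Qed.

Lemma energy_minimal_minimal f m : energy_minimal mu p f m ->
  minimal_weak_upper_gradient p mu setT f m.
Proof.
move=> Em; have [Lm Wm _] := Em; split.
- by apply: wug_to_weak => //; case: Lm.
- exact: Lp_borel_loc.
- by move=> g' Wg' Lg'; apply: (energy_minimal_le Em) Wg' Lg' => //; exact: openT.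
Qed.

Lemma min_gradP A f g : minimal_weak_upper_gradient p mu A f g ->
  minimal_weak_upper_gradient p mu A f (min_grad p mu A f).
Proof. by move=> gm; exact: (@xgetPex _ (cst 0) [set g | minimal_weak_upper_gradient p mu A f g] (ex_intro _ g gm)). Qed.

(** [min_grad] picks some minimal gradient; any two of them bound each other almost everywhere, so
    their energies agree. *)
Lemma min_grad_energy f m : energy_minimal mu p f m ->
  \int[mu]_x (min_grad p mu setT f x `^ p) = \int[mu]_x (m x `^ p).
Proof.
move=> Em; have mm := energy_minimal_minimal Em.
have [[mg g0 _] Lg gmin] := min_gradP mm.
have [Wm Lm mmin] := mm.
have [Wg _ _] := min_gradP mm.
have [mmg _ _] := Wm.
apply: ge0_ae_eq_integral => //.
- exact: (measurableT_comp (measurable_poweR p) mg).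
- exact: (measurableT_comp (measurable_poweR p) mmg).
- by move=> x _; exact: poweR_ge0.
- by move=> x _; exact: poweR_ge0.
have H1 := gmin _ Wm Lm; have H2 := mmin _ Wg Lg.
have H : {ae mu, forall x, setT x -> min_grad p mu setT f x `^ p = m x `^ p}.
  apply: filterS2 H1 H2 => x /= gm mg' _; congr (_ `^ _).
  by apply/eqP; rewrite eq_le gm// mg'.
exact: H.
Qed.

End minimal_gradients.

(** * Newtonian functions and capacities *)

Section newtonian_functions.
Context {d : measure_display} {R : realType} {X : metricMeasurableType d R}.
Variables (mu : {measure set X -> \bar R}) (p : R).
Hypothesis mu_borel : borel_completion mu.
Hypothesis p_gt0 : (0 < p)%R.
Implicit Types (A B E N D V Z : set X) (f g h m rho v : X -> \bar R) (c : R -> X) (l : R).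

Lemma N1p_wug A f : measurable A -> N1p p mu A f ->
  exists2 g, Lp_borel mu p g & wug mu p A f g.
Proof.
move=> mA [mf]; rewrite /N1p_norm_pow => foo.
have f0 : 0 <= \int[mu]_(x in A) (`|f x| `^ p) by apply: integral_ge0 => x _; exact: poweR_ge0.
have /ereal_inf_lt[_ [g Wg <-] goo] : ereal_inf [set \int[mu]_(x in A) (g x `^ p)
    | g in [set g | weak_upper_gradient p mu A f g]] < +oo.
  by apply: le_lt_trans foo; rewrite leeDr.
have [mg g0 _] := Wg.
have [h [N [bh bN N0 hE Wh]]] := weak_to_wug mu_borel p_gt0 mA Wg.
exists h => //; split => //; by rewrite (int_rep mu_borel p_gt0 mA bh bN N0 mg g0 hE).
Qed.

Lemma wug_N1p f g : measurable_fun setT f -> \int[mu]_x (`|f x| `^ p) < +oo ->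
  Lp_borel mu p g -> wug mu p setT f g -> N1p p mu setT f.
Proof.
move=> mf foo [bg goo] Wg; split => //; rewrite /N1p_norm_pow.
apply: lte_add_pinfty => //; apply: le_lt_trans goo.
by apply: ereal_inf_lbound; exists g => //; exact: wug_to_weak.
Qed.

(** Besides the gradient, [|f|] itself receives a Borel majorant [w], so that it can be integrated
    along curves. *)
Lemma N1p_norm_pow_lt f (e : \bar R) : measurable_fun setT f ->
  N1p_norm_pow p mu setT f < e -> exists w h, [/\ Lp_borel mu p w, Lp_borel mu p h,
    forall x, `|f x| <= w x, wug mu p setT f h &
    \int[mu]_x (w x `^ p) + \int[mu]_x (h x `^ p) < e].
Proof.
move=> mf foo.
have f0 : 0 <= \int[mu]_x (`|f x| `^ p) by apply: integral_ge0 => x _; exact: poweR_ge0.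
have mnf : measurable_fun setT (fun x => `|f x|) by exact: measurableT_comp.
have [w [N [bw bN N0 fw wE]]] := measurable_rep mu_borel measurableT mnf (fun x _ => abse_ge0 (f x)).
have iw := int_rep mu_borel p_gt0 measurableT bw bN N0 mnf (fun x _ => abse_ge0 (f x)) wE.
pose I := ereal_inf [set \int[mu]_(x in setT) (g x `^ p)
    | g in [set g | weak_upper_gradient p mu setT f g]].
have I0 : 0 <= I.
  by apply: le_ereal_inf_tmp => _ [g _ <-]; apply: integral_ge0 => x _; exact: poweR_ge0.
have ffin : \int[mu]_x (`|f x| `^ p) \is a fin_num.
  by rewrite ge0_fin_numE//; apply: (lt_le_trans (y := e)) (leey _); apply: le_lt_trans foo; rewrite leeDl.
have /ereal_inf_lt[_ [g Wg <-] goo] : I < e - \int[mu]_x (`|f x| `^ p).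
  by rewrite lteBrDr// addeC.
have [mg g0 _] := Wg.
have [h [M [bh bM M0 hE Wh]]] := weak_to_wug mu_borel p_gt0 measurableT Wg.
have ih := int_rep mu_borel p_gt0 measurableT bh bM M0 mg g0 hE.
have ioo : \int[mu]_x (w x `^ p) + \int[mu]_x (h x `^ p) < e.
  by rewrite iw ih addeC -lteBrDr.
have loo : \int[mu]_x (h x `^ p) < +oo.
  apply: (lt_le_trans (y := e)) (leey _); apply: le_lt_trans ioo; rewrite leeDr//.
  by apply: integral_ge0 => x _; exact: poweR_ge0.
exists w, h; split => //; last by move=> x; exact: fw.
by split => //; rewrite iw ltey_eq ffin.
Qed.

(** Almost every curve misses [Z] altogether. This is stronger than spending zero length in [Z], and
    it lets a function be changed on [Z] without affecting its gradients. *)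
Definition avoided Z := exists2 rho, Lp_borel mu p rho &
  forall l c, arc_length_curve setT l c -> curve_integral l c rho < +oo ->
    forall t, (0 <= t <= l)%R -> ~ Z (c t).

Lemma avoided_subset Z Z' : Z' `<=` Z -> avoided Z -> avoided Z'.
Proof.
by move=> ZZ [rho Lr rP]; exists rho => // l c ac rc t tl /ZZ; exact: (rP l c ac rc).
Qed.

Lemma avoided_bigcup (Z : nat -> set X) : (forall n, avoided (Z n)) ->
  avoided (\bigcup_n Z n).
Proof.
move=> aZ; have /choice[rho rP] n : exists r, Lp_borel mu p r /\
    forall l c, arc_length_curve setT l c -> curve_integral l c r < +oo ->
    forall t, (0 <= t <= l)%R -> ~ Z n (c t).
  by have [r Lr rP] := aZ n; exists r.
have [r Lr rfin] := Lp_countable_finite mu_borel p_gt0 (fun n => (rP n).1).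
exists r => // l c ac rc t tl [n _]; apply: (rP n).2 tl => //; exact: rfin ac rc n.
Qed.

Lemma wug_avoided Z f f' g : avoided Z -> borel_ge0 g ->
  (forall x, ~ Z x -> f x = f' x) -> wug mu p setT f g -> wug mu p setT f' g.
Proof.
move=> [rZ LZ ZP] bg ff' [rho Lr rP].
apply: (wug_max mu_borel LZ bg); exists rho => // l c ac cZ cr.
have [l0 _ _] := ac; rewrite -!ff'; first exact: rP.
  by apply: (ZP l c) => //; rewrite lexx ltW.
by apply: (ZP l c) => //; rewrite lexx ltW.
Qed.

(* With 2^n (|v_n| + g_n) <= rho for functions v_n >= 1 on Z, a curve on which rho
   has finite integral would satisfy |v_n| >= 1/2 throughout for n large. *)
Lemma avoided_capacity0 Z : capacity p mu Z = 0 -> avoided Z.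
Proof.
move=> capZ.
(* The last factor compensates for the scaling by [2^n] in [rho] below, whose energy is then at most
   [2^-(n+1)]. *)
pose e n : R := (1 / (2 ^ n.+1)%:R / ((2 ^+ n) `^ p))%R.
have e0 n : (0 < e n)%R by rewrite divr_gt0 ?powR_gt0 ?exprn_gt0// divr_gt0// ltr0n expn_gt0.
have /choice[w /choice[h /choice[r whr]]] n : exists w h r, [/\ Lp_borel mu p w, borel_ge0 h,
    \int[mu]_x (w x `^ p) + \int[mu]_x (h x `^ p) < (e n)%:E, Lp_borel mu p r &
    forall l c, arc_length_curve setT l c -> curve_integral l c r < +oo ->
    forall t, (0 <= t <= l)%R -> Z (c t) -> forall s, (0 <= s <= l)%R ->
    1 <= w (c s) + curve_integral l c h].
  have /ereal_inf_lt[_ [v [[mv vN] vZ] <-] ve] : capacity p mu Z < (e n)%:E by rewrite capZ lte_fin.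
  have [w [h [Lw Lh vw Wh whe]]] := N1p_norm_pow_lt mv ve.
  have [r Lr rP] := wug_along mu_borel Lh Wh.
  exists w, h, r; split => //; first by case: Lh.
  move=> l c ac rc t tl Zt s sl.
  have [fin ctr ioo] := rP l c ac rc.
  have := vZ _ Zt; have := vw (c s); have := fin t tl; have := fin s sl.
  have st_le : `|fine (v (c s)) - fine (v (c t))|%:E <= curve_integral l c h.
    rewrite (curve_integralE ac Lh.1).
    have mh := measurable_clamp_comp ac Lh.1.
    have h0 x : 0 <= (h \o clamp l c) x by case: Lh => -[_ +] _; exact.
    move/andP: tl => [t0 tl]; move/andP: sl => [s0 sl].
    case: (leP s t) => st.
      apply: le_trans (lint_sub mh h0 s0 tl); exact: ctr.
    rewrite distrC; apply: le_trans (lint_sub mh h0 t0 sl); apply: ctr => //; exact: ltW.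
  move: st_le; case: (v (c s)) => [a| |] //; case: (v (c t)) => [b| |] // + _ _ + b1.
  rewrite /= => ab aw; rewrite lee_fin in b1.
  apply: (@le_trans _ _ (`|a|%:E + `|a - b|%:E)); last exact: leeD.
  by rewrite -EFinD lee_fin; have := ler_norm (b - a)%R; rewrite distrC; have := ler_norm a; lra.
pose rho n x := (2 ^+ n)%:E * maxe (w n x) (h n x).
have brho n : borel_ge0 (rho n).
  apply: borel_scale; first exact: exprn_ge0.
  by apply: borel_max; have [[]] := whr n.
have irho n : \int[mu]_x (rho n x `^ p) <= (1 / (2 ^ n.+1)%:R)%:E.
  have [[bw _] bh we _ _] := whr n.
  rewrite (@int_poweR_scale _ _ _ mu p mu_borel) ?exprn_ge0//; last exact: borel_max.
  have k0 : (0 < (2 ^+ n) `^ p :> R)%R by rewrite powR_gt0// exprn_gt0.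
  apply: (@le_trans _ _ (((2 ^+ n) `^ p)%:E * (e n)%:E)); last first.
    by rewrite -EFinM lee_fin /e mulrC divfK// gt_eqF.
  apply: lee_wpmul2l; first by rewrite lee_fin ltW.
  apply: le_trans (ltW we).
  rewrite -ge0_integralD//; first last.
  - exact: borel_poweR_measurable.
  - by move=> x _; exact: poweR_ge0.
  - exact: borel_poweR_measurable.
  - by move=> x _; exact: poweR_ge0.
  apply: ge0_le_integral => //.
  - by move=> x _; exact: poweR_ge0.
  - by apply: borel_poweR_measurable => //; exact: borel_max.
  - by apply: emeasurable_funD; exact: borel_poweR_measurable.
  - by move=> x _; apply: poweR_maxe; [case: bw|case: bh].
have [r1 L1 r1P] := Lp_sup_geometric mu_borel p_gt0 brho irho.
have [r2 L2 r2P] := Lp_countable_finite mu_borel p_gt0 (fun n => let: And5 _ _ _ L _ := whr n in L).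
exists (fun x => maxe (r1 x) (r2 x)); first exact: Lp_max.
move=> l c ac rc t tl Zt.
have b1 := L1.1; have b2 := L2.1; have b12 := borel_max b1 b2.
have c1 : curve_integral l c r1 < +oo.
  by apply: le_lt_trans rc; apply: (le_curve_integral ac) => // x; rewrite le_max lexx.
have c2 : curve_integral l c r2 < +oo.
  by apply: le_lt_trans rc; apply: (le_curve_integral ac) => // x; rewrite le_max lexx orbT.
have [l0 cA _] := ac.
have I0 : 0 <= curve_integral l c r1.
  by rewrite (curve_integralE ac b1) lint_ge0// => s; case: b1 => _; exact.
case E : (curve_integral l c r1) I0 c1 => [I| |] // I0 _; rewrite lee_fin in I0.
have small n g : borel_ge0 g -> (forall x, (2 ^+ n)%:E * g x <= r1 x) ->
    (2 ^+ n)%:E * curve_integral l c g <= I%:E.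
  move=> bg gr; rewrite -E -(curve_integral_scale _ ac bg); last exact: exprn_ge0.
  by apply: (le_curve_integral ac) => //; apply: borel_scale => //; exact: exprn_ge0.
(* On a curve that meets [Z], integrating [1 <= w + curve_integral l c h] over the curve gives
   [l <= int w + l int h]. Both integrals are at most [I / 2^n], which is impossible for large
   [n]. *)
have key n : (l * 2 ^+ n <= I * (1 + l))%R.
  have [[bw _] bh _ _ wc] := whr n.
  have wr x : (2 ^+ n)%:E * w n x <= r1 x.
    apply: le_trans (r1P n x); apply: lee_wpmul2l; first by rewrite lee_fin exprn_ge0.
    by rewrite le_max lexx.
  have hr x : (2 ^+ n)%:E * h n x <= r1 x.
    apply: le_trans (r1P n x); apply: lee_wpmul2l; first by rewrite lee_fin exprn_ge0.
    by rewrite le_max lexx orbT.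
  have sw := small n _ bw wr; have sh := small n _ bh hr.
  have n0 : (0 < 2 ^+ n :> R)%R by exact: exprn_gt0.
  have lw : l%:E <= curve_integral l c (w n) + l%:E * curve_integral l c (h n).
    have mw := measurable_clamp_comp ac bw.
    have h0 : 0 <= curve_integral l c (h n).
      by rewrite (curve_integralE ac bh) lint_ge0// => s; case: bh => _; exact.
    have cst_int (k : \bar R) : lint 0%R l (cst k) = k * l%:E.
      rewrite /lint integral_cst//= lebesgue_measure_itv/= lte_fin l0.
      by rewrite -EFinB subr0.
    rewrite (curve_integralE ac bw) -[X in X <= _]mul1e -cst_int.
    rewrite [X in _ + X]muleC -cst_int -lintD//; last by move=> s; case: bw => _; exact.
    apply: le_lint => //; first exact: emeasurable_funD.
    move=> s sl; rewrite /= clampE//; exact: (wc l c ac (r2P _ _ _ ac c2 n) t tl Zt s sl).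
  move: sw sh lw; case: (curve_integral l c (w n)) => [a| |];
    case: (curve_integral l c (h n)) => [b| |];
    rewrite ?gt0_muley ?gt0_muleNy ?lte_fin// -?EFinM ?lee_fin//.
  by move=> aI bI lab; have := ler_wpM2l (ltW n0) lab; have := ler_wpM2l (ltW l0) bI; nra.
have [n nP] : exists n : nat, (I * (1 + l) / l < 2 ^+ n)%R.
  exists (Num.bound (I * (1 + l) / l)).
  have X0 : (0 <= I * (1 + l) / l)%R by rewrite divr_ge0 ?mulr_ge0// ?ltW// addr_gt0.
  apply: lt_le_trans (archi_boundP X0) _; rewrite -natrX ler_nat; exact/ltnW/ltn_expl.
by move: nP; rewrite ltr_pdivrMr// ltNge mulrC key.
Qed.

End newtonian_functions.

Section relative_capacity.
Context {d : measure_display} {R : realType} {X : metricMeasurableType d R}.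
Variables (mu : {measure set X -> \bar R}) (p : R).
Hypothesis mu_borel : borel_completion mu.
Hypothesis mu_balls : balls_pos_finite mu.
Hypothesis mu_doubling : doubling mu.
Hypothesis p_gt0 : (0 < p)%R.
Implicit Types (A B E N D V Z : set X) (f g h m rho v : X -> \bar R).

(** The energy of [min_grad] is that of an energy-minimal Borel gradient, so the capacity can be
    bounded through Borel gradients alone. *)
Lemma rel_capacity_ge E A (k : \bar R) :
  (forall v g, N1p p mu setT v -> (forall x, E x -> 1 <= v x) ->
     (forall x, ~ A x -> v x = 0) -> Lp_borel mu p g -> wug mu p setT v g ->
     k <= \int[mu]_x (g x `^ p)) -> k <= rel_capacity p mu E A.
Proof.
move=> H; apply: le_ereal_inf_tmp => _ [v [Nv vE vA] <-].
have [g Lg Wg] := N1p_wug mu_borel p_gt0 measurableT Nv.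
have [m Em] := exists_energy_minimal mu_borel p_gt0 Lg Wg.
rewrite (min_grad_energy mu_borel mu_balls mu_doubling p_gt0 Em).
by have [Lm Wm _] := Em; exact: (H v m).
Qed.

Lemma rel_capacity_le E A v g : N1p p mu setT v -> (forall x, E x -> 1 <= v x) ->
  (forall x, ~ A x -> v x = 0) -> borel_ge0 g -> wug mu p setT v g ->
  rel_capacity p mu E A <= \int[mu]_x (g x `^ p).
Proof.
move=> Nv vE vA bg Wg.
have [h Lh Wh] := N1p_wug mu_borel p_gt0 measurableT Nv.
have [m Em] := exists_energy_minimal mu_borel p_gt0 Lh Wh.
have [_ _ /(_ g bg Wg)] := Em; apply: le_trans.
rewrite -(min_grad_energy mu_borel mu_balls mu_doubling p_gt0 Em).
by apply: ereal_inf_lbound; exists v.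
Qed.

Lemma le_rel_capacity E E' A A' : E `<=` E' -> A' `<=` A ->
  rel_capacity p mu E A <= rel_capacity p mu E' A'.
Proof.
move=> EE AA; apply: le_ereal_inf => _ [v [Nv vE vA] <-]; exists v => //.
split => // [x /EE|x nA]; first exact: vE.
by apply: vA => /AA.
Qed.

End relative_capacity.

(** * Truncations of the superharmonic function *)

Section real_contractions.
Context {R : realType}.
Implicit Types (a s t : R).

Lemma min_contraction a s t :
  (`|Order.min a s - Order.min a t| <= `|s - t|)%R.
Proof.
have h1 := ler_norm (s - t)%R; have h2 := ler_norm (t - s)%R.
rewrite (distrC t s) in h2; rewrite ler_norml.
case: (ltP a s) => as_; case: (ltP a t) => at_; apply/andP; split; lra.
Qed.

Lemma max_contraction a s t :
  (`|Order.max a s - Order.max a t| <= `|s - t|)%R.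
Proof.
have h1 := ler_norm (s - t)%R; have h2 := ler_norm (t - s)%R.
rewrite (distrC t s) in h2; rewrite ler_norml.
case: (ltP a s) => as_; case: (ltP a t) => at_; apply/andP; split; lra.
Qed.

End real_contractions.

Section balanced_slopes.
Context {R : realType}.

(* First-order condition at s = 0 for (1 + s c)^p n1 + (1 - s a)^p n2. *)
Lemma balanced_slopes (p a c n1 n2 : R) : (0 < p)%R -> (0 < a)%R -> (0 < c)%R ->
  (forall al be : R, (0 <= al)%R -> (0 <= be)%R -> (al * a + be * c = a + c)%R ->
     (n1 + n2 <= al `^ p * n1 + be `^ p * n2)%R) -> (c * n1 = a * n2)%R.
Proof.
move=> p0 a0 c0 H.
pose f (s : R) : R := ((1 + s * c) `^ p * n1 + (1 - s * a) `^ p * n2)%R.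
(* The pair [al = 1 + s c], [be = 1 - s a] satisfies the constraint for all [s], and
   [|s| < 1 / (a + c)] keeps both positive. *)
pose e := ((a + c)^-1)%R.
have ac0 : (0 < a + c)%R by rewrite addr_gt0.
have e0 : (0 < e)%R by rewrite invr_gt0.
have ea : (e * (a + c) = 1)%R by rewrite /e mulVf// gt_eqF.
have pos (s : R) : s \in `](- e)%R, e[%R -> (0 < 1 + s * c)%R /\ (0 < 1 - s * a)%R.
  by rewrite in_itv/= => /andP[s1 s2]; split; nra.
have affine (s k : R) : is_derive s 1%R (fun t : R => (1 + t * k)%R) k.
  have -> : (fun t : R => (1 + t * k)%R) = (cst 1 + k \*: (id : R -> R))%R.
    by apply/funext => t /=; rewrite /GRing.scale_fun /= mulrC.
  have := is_deriveD (is_derive_cst (1 : R)%R s 1%R) (is_deriveZ k (is_derive_id s 1%R)).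
  by rewrite add0r [_ *: _]mulr1.
have pow (s k : R) : (0 < 1 + s * k)%R ->
    is_derive s 1%R (fun t : R => (1 + t * k) `^ p)%R (p * (1 + s * k) `^ (p - 1) * k)%R.
  move=> sk; apply: (@is_derive1_comp _ (fun y : R => y `^ p)%R (fun t : R => 1 + t * k)%R).
  exact: is_derive1_powR.
have fE : f = (n1 \*: (fun t : R => (1 + t * c) `^ p) + n2 \*: (fun t : R => (1 + t * - a) `^ p))%R.
  apply/funext => t; transitivity (n1 * (1 + t * c) `^ p + n2 * (1 + t * - a) `^ p)%R => //.
  by rewrite /f mulrN mulrC [X in (_ + X)%R]mulrC.
have der (s : R) : s \in `](- e)%R, e[%R -> is_derive s 1%R f
    (n1 * (p * (1 + s * c) `^ (p - 1) * c) + n2 * (p * (1 + s * - a) `^ (p - 1) * - a))%R.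
  move=> /pos[s1 s2].
  have D1 := pow s c s1.
  have D2 : is_derive s 1%R (fun t : R => (1 + t * - a) `^ p)%R (p * (1 + s * - a) `^ (p - 1) * - a)%R.
    by apply: pow; rewrite mulrN.
  by rewrite fE; exact: is_deriveD (is_deriveZ n1 D1) (is_deriveZ n2 D2).
have f0 : is_derive (0%R : R) 1%R f 0%R.
  apply: (@derive1_at_min _ f (- e)%R e 0%R).
  - by rewrite ltW// (lt_trans _ e0)// oppr_lt0.
  - by move=> t /der[].
  - by rewrite in_itv/= e0 oppr_lt0 e0.
  - move=> t /pos[t1 t2]; rewrite /f !mul0r addr0 subr0 powR1 !mul1r.
    by apply: H; [exact: ltW|exact: ltW|ring].
have z0 : (0%R : R) \in `](- e)%R, e[%R by rewrite in_itv/= e0 oppr_lt0 e0.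
have E := @derive_val _ _ _ _ _ _ _ (der _ z0); have E0 := @derive_val _ _ _ _ _ _ _ f0.
move: E; rewrite E0 !mul0r addr0 powR1 !mulr1 => E.
have : (p * (c * n1 - a * n2) = 0)%R by rewrite [RHS]E; ring.
move/eqP; rewrite mulf_eq0 gt_eqF//= subr_eq0 => /eqP //.
Qed.

End balanced_slopes.

Section zero_gradient.
Context {d : measure_display} {R : realType} {X : metricMeasurableType d R}.
Variables (mu : {measure set X -> \bar R}) (p : R).
Hypothesis mu_borel : borel_completion mu.
Hypothesis mu_balls : balls_pos_finite mu.
Hypothesis p_gt0 : (0 < p)%R.

Lemma ae_meets_ball (P : X -> Prop) x r : (0 < r)%R -> {ae mu, forall y, P y} ->
  exists2 y, ball x r y & P y.
Proof.
move=> r0 aeP; apply: contrapT => nP.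
have /andP[+ _] := mu_balls x r0; rewrite lt_neqAle => /andP[/eqP + _]; apply.
apply/esym/negligibleP; first exact: ball_measurable.
apply: (negligibleS _ aeP) => y xy Py; by apply: nP; exists y.
Qed.

(** With a zero gradient the Poincare inequality makes [f] equal to its average almost everywhere on
    each ball. The balls around a fixed point all contain the unit ball, which has positive measure,
    so the constants coincide. *)
Lemma zero_gradient_constant (f : X -> R) : poincare p mu ->
  mu.-integrable setT (EFin \o f) -> weak_upper_gradient p mu setT (EFin \o f) (cst 0) ->
  exists c : R, {ae mu, forall x, f x = c}.
Proof.
move=> [C [la [C0 la1 PI]]] If Wf.
have mB x r : measurable (ball x r : set X) by exact: ball_measurable.
have on_ball x r : (0 < r)%R -> exists c : R, {ae mu, forall y, ball x r y -> f y = c}.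
  move=> r0; pose A := avg mu (ball x r) (EFin \o f).
  have /andP[B0 Boo] := mu_balls x r0.
  have Ifin : \int[mu]_(y in ball x r) (EFin \o f) y \is a fin_num.
    apply: integrable_fin_num => //; exact: (integrableS measurableT).
  have Afin : A \is a fin_num by rewrite /A /avg fin_numM.
  have := PI x r _ _ r0 If Wf; rewrite -/A.
  have -> : avg mu (ball x (la * r)%R) (fun y => (cst 0 y : \bar R) `^ p) = 0.
    by rewrite /avg integral0_eq ?mule0// => y _; apply: poweR0r; rewrite gt_eqF.
  rewrite poweR0r ?invr_eq0 ?gt_eqF// mule0 /avg => le0.
  have mA : measurable_fun (ball x r) (fun y => (EFin \o f) y - A).
    apply: measurable_funTS; apply: emeasurable_funB; last exact: measurable_cst.
    by case/integrableP: If.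
  have /(ae_eq_integral_abs _ (mB x r) mA) ae0 :
      \int[mu]_(y in ball x r) `|(EFin \o f) y - A| = 0.
    apply/eqP; rewrite eq_le integral_ge0// andbT.
    have m0 : (0 < (fine (mu (ball x r)))^-1)%R by rewrite invr_gt0 fine_gt0// B0.
    by rewrite -(@lee_pmul2l _ (((fine (mu (ball x r)))^-1)%:E))// mule0.
  exists (fine A); apply: filterS ae0 => y /[apply] /=.
  rewrite -{1}(fineK Afin) -EFinB => -[] /eqP; rewrite subr_eq0 => /eqP //.
pose x0 : X := point.
have /choice[c cP] (n : nat) : exists c : R, {ae mu, forall y, ball x0 n.+1%:R y -> f y = c}.
  exact: on_ball.
exists (c 0%N).
have cn n : c n = c 0%N.
  have H : {ae mu, forall y, (ball x0 n.+1%:R y -> f y = c n) /\ (ball x0 1%:R y -> f y = c 0%N)}.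
    by apply: filterS2 (cP n) (cP 0%N) => y.
  have [y xy [Hn H0]] := @ae_meets_ball _ x0 1%R ltr01 H.
  rewrite -Hn ?H0//; by apply: le_ball xy; rewrite ler1n.
have : {ae mu, forall y n, ball x0 n.+1%:R y -> f y = c n} by exact/ae_foralln.
apply: filterS => y /(_ (Num.bound (mdist x0 y))) ->; first exact: cn.
rewrite ballEmdist /=; apply: lt_trans (archi_boundP (mdist_ge0 _ _)) _.
by rewrite ltr_nat.
Qed.

End zero_gradient.

Section truncations.
Context {d : measure_display} {R : realType} {X : metricMeasurableType d R}.
Variables (mu : {measure set X -> \bar R}) (p : R) (Omega E : set X) (u : X -> \bar R).
Hypothesis mu_borel : borel_completion mu.
Hypothesis mu_balls : balls_pos_finite mu.
Hypothesis mu_doubling : doubling mu.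
Hypothesis p_gt0 : (0 < p)%R.
Hypothesis Omega_bounded : metric_bounded Omega.
Hypothesis Omega_open : open Omega.
Hypothesis E_rel_closed : exists2 F : set X, closed F & E = F `&` Omega.
Hypothesis u_gt0 : forall x, Omega x -> 0 < u x.
Hypothesis u_harmonic : p_harmonic p mu (Omega `\` E) u.
Hypothesis u_trunc : forall k : R, (0 < k)%R ->
  N1p_0 p mu Omega (fun x => Order.min (u x) k%:E).
Implicit Types (a b : R) (x : X).

(** Truncation makes the values finite even where [u] is infinite, so real arithmetic applies. *)
Definition level b x : R := if x \in Omega then fine (Order.min (u x) b%:E) else 0%R.

Lemma levelE b x : (0 <= b)%R -> Omega x -> (level b x)%:E = Order.min (u x) b%:E.
Proof.
move=> b0 Ox; rewrite /level mem_set// fineK//; have := u_gt0 Ox.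
case: (u x) => [r| |] // r0; by rewrite -EFin_min.
Qed.

Lemma level_out b x : ~ Omega x -> level b x = 0%R.
Proof. by move=> Ox; rewrite /level memNset. Qed.

Lemma level_ge0 b x : (0 <= b)%R -> (0 <= level b x)%R.
Proof.
move=> b0; have [Ox|/(level_out b)->//] := pselect (Omega x).
by rewrite -lee_fin levelE// le_min ltW ?u_gt0// lee_fin.
Qed.

Lemma level_le b x : (0 <= b)%R -> (level b x <= b)%R.
Proof.
move=> b0; have [Ox|/(level_out b)->//] := pselect (Omega x).
by rewrite -lee_fin levelE// ge_min lexx orbT.
Qed.

Lemma level_top b x : (0 <= b)%R -> Omega x -> b%:E <= u x -> level b x = b.
Proof. by move=> b0 Ox bu; apply: EFin_inj; rewrite levelE// min_r. Qed.

Lemma level_lt b x : (0 <= b)%R -> Omega x -> u x <= b%:E -> (level b x)%:E = u x.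
Proof. by move=> b0 Ox ub; rewrite levelE// min_l. Qed.

Lemma level_min a b x : (0 <= a)%R -> (a <= b)%R -> level a x = Order.min a (level b x).
Proof.
move=> a0 ab; have b0 := le_trans a0 ab.
have [Ox|Ox] := pselect (Omega x); last by rewrite !level_out// min_r.
apply: EFin_inj; rewrite EFin_min !levelE// minCA minA [in RHS]minC.
by rewrite [RHS]min_r// ge_min lee_fin ab orbT.
Qed.

Lemma level_pos b x : (0 < b)%R -> Omega x -> (0 < level b x)%R.
Proof.
move=> b0 Ox; rewrite -lte_fin levelE ?ltW// lt_min u_gt0// lte_fin//.
Qed.

Lemma level_contraction a b x y : (0 <= a)%R -> (a <= b)%R ->
  (`|level a x - level a y| <= `|level b x - level b y|)%R.
Proof.
move=> a0 ab; by rewrite !(level_min _ a0 ab); exact: min_contraction.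
Qed.

Lemma N1p_level b : (0 < b)%R -> N1p p mu setT (EFin \o level b).
Proof.
move=> b0; have := u_trunc b0; rewrite /N1p_0.
suff -> : (fun x => Order.min (u x) b%:E) \_ Omega = EFin \o level b by [].
apply/funext => x; rewrite patchE /=; have [Ox|Ox] := pselect (Omega x).
  by rewrite mem_set// levelE// ltW.
by rewrite memNset// level_out.
Qed.

Lemma exists_level_gradient b : (0 < b)%R ->
  exists m, energy_minimal mu p (EFin \o level b) m.
Proof.
move=> b0; have [g Lg Wg] := N1p_wug mu_borel p_gt0 measurableT (N1p_level b0).
exact: exists_energy_minimal Lg Wg.
Qed.

Lemma measurable_Omega : measurable Omega.
Proof. by apply: (borel_measurable mu_borel); exact: open_borel. Qed.

Lemma Omega_finite : mu Omega < +oo.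
Proof.
have [x [r Or]] := Omega_bounded.
have r0 : (0 < Order.max r 1)%R by rewrite lt_max ltr01 orbT.
apply: (@le_lt_trans _ _ (mu (ball x (Order.max r 1%R)))).
  apply: le_measure; rewrite ?inE; first exact: measurable_Omega.
    exact: ball_measurable.
  by apply: subset_trans Or _; apply: le_ball; rewrite le_max lexx.
by have /andP[] := mu_balls x r0.
Qed.

(** The exponent [q] is kept free: [p] serves for membership in the Newtonian space, [1] for
    integrability in the Poincare inequality. *)
Lemma bounded_in_Lp (q : R) (w : X -> R) b : (0 < q)%R -> measurable_fun setT (EFin \o w) ->
  (forall x, (`|w x| <= b)%R) -> (forall x, ~ Omega x -> w x = 0%R) ->
  \int[mu]_x (`|(w x)%:E| `^ q) < +oo.
Proof.
move=> q0 mw wb w0; have mO := measurable_Omega.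
apply: (@le_lt_trans _ _ (\int[mu]_(x in Omega) cst (b%:E `^ q) x)).
  rewrite [leRHS]integral_mkcond; apply: ge0_le_integral_nomeas => x _; first exact: poweR_ge0.
  rewrite patchE; have [Ox|Ox] := pselect (Omega x).
    by rewrite mem_set//; apply: le_poweR; [exact: ltW|exact: abse_ge0|rewrite lee_fin].
  by rewrite memNset// w0// abse0 poweR0r ?gt_eqF.
rewrite integral_cst//; apply: lte_mul_pinfty; first exact: poweR_ge0.
  exact: fin_num_poweR.
exact: Omega_finite.
Qed.

Local Notation V := (Omega `\` E).

Lemma V_open : open V.
Proof.
have [F clF ->] := E_rel_closed.
have -> : Omega `\` (F `&` Omega) = Omega `&` ~` F.
  apply/seteqP; split => x [Ox nx]; split => //; first by move=> Fx; apply: nx.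
  by move=> [].
by apply: openI => //; exact: closed_openC.
Qed.

Lemma u_fin x : V x -> u x \is a fin_num.
Proof. by case: u_harmonic => + _ _; exact. Qed.

Lemma sublevel_open b : open (V `&` [set x | u x < b%:E]).
Proof.
have [_ uc _] := u_harmonic; have oV := V_open.
rewrite openE => x [Vx ux]; rewrite /interior.
have ucx : {for x, continuous u}.
  by rewrite (continuous_open_subspace u oV) in uc; apply: uc; rewrite inE.
apply: filterI; first by apply: open_nbhs_nbhs.
apply: (ucx [set y | y < b%:E]); apply: open_nbhs_nbhs; split => //.
exact: open_ereal_lt_ereal.
Qed.


(** * The minimal gradient of u off E *)

Section domain_gradient.
Variable M : nat -> X -> \bar R.
Hypothesis MP : forall n, energy_minimal mu p (EFin \o level n.+1%:R) (M n).

Let G x := esups (M ^~ x) 0%N.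

Let bM n : borel_ge0 (M n).
Proof. by have [[]] := MP n. Qed.

Let bG : borel_ge0 G.
Proof. exact: borel_esups. Qed.

Lemma gradient_level_mono j k : (j <= k)%N ->
  {ae mu, forall x, setT x -> M j x <= M k x}.
Proof.
move=> jk; have [Lk Wk _] := MP k.
apply: (energy_minimal_le mu_borel mu_balls mu_doubling p_gt0 (MP j) openT openT) => //.
  apply: wug_to_weak => //; apply: (wug_lip _ _ Wk) => // x y _ _.
  rewrite /= lee_fin; apply: level_contraction; rewrite ?ler0n// ler_nat//.
exact: (Lp_borel_loc mu_borel).
Qed.

Lemma gradient_level_local j k :
  {ae mu, forall x, (V `&` [set x | u x < k.+1%:R%:E]) x -> (k <= j)%N -> M j x <= M k x}.
Proof.
have [kj|kj] := leqP k j; last by apply: aeW.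
have [Lk Wk _] := MP k.
have H : {ae mu, forall x, (V `&` [set x | u x < k.+1%:R%:E]) x -> M j x <= M k x}.
  apply: (energy_minimal_le mu_borel mu_balls mu_doubling p_gt0 (f' := EFin \o level k.+1%:R)
    (MP j) (sublevel_open _) openT) => //.
  - move=> x [[Ox _] /= uk]; rewrite !level_lt// ?ltW//.
    by apply: (lt_le_trans uk); rewrite lee_fin ler_nat.
  - exact: wug_to_weak.
  - exact: (Lp_borel_loc mu_borel).
by apply: filterS H => x H Ux _; exact: H.
Qed.

(** For [j <= k] the lower truncation is a contraction of the higher one. For [j >= k] both
    truncations coincide with [u] on the open set where [u < k + 1], so locality applies. Hence the
    supremum [G] is controlled there by [M k]. *)
Lemma domain_gradient_le k :
  {ae mu, forall x, (V `&` [set x | u x < k.+1%:R%:E]) x -> G x <= M k x}.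
Proof.
have H1 : {ae mu, forall x j, (j <= k)%N -> M j x <= M k x}.
  apply/ae_foralln => j; have [jk|jk] := leqP j k; last by apply: aeW.
  by apply: filterS (gradient_level_mono jk) => x H _; exact: H.
have H2 : {ae mu, forall x j, (V `&` [set x | u x < k.+1%:R%:E]) x -> (k <= j)%N -> M j x <= M k x}.
  by apply/ae_foralln => j; exact: gradient_level_local.
apply: filterS2 H1 H2 => x H1 H2 Ux; apply: ge_ereal_sup => _ [j _ <-].
by have [/H1//|/ltnW kj] := leqP j k; exact: H2.
Qed.

Lemma domain_gradient_Lp_loc : Lp_loc p mu V G.
Proof.
have mG := borel_ge0_measurable mu_borel bG.
have mV : measurable V by apply: (borel_measurable mu_borel); exact: open_borel V_open.
split; first exact: measurable_funTS.
move=> x Vx.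
have [k uk] : exists k, u x < k.+1%:R%:E.
  have := u_fin Vx; case: (u x) => [s| |] // _; exists (Num.bound `|s|%R).
  rewrite lte_fin; apply: le_lt_trans (ler_norm _) _.
  by apply: lt_trans (archi_boundP (normr_ge0 _)) _; rewrite ltr_nat.
have /nbhs_ballP[r /= r0 rU] : nbhs x (V `&` [set x | u x < k.+1%:R%:E]).
  by apply: open_nbhs_nbhs; split; [exact: sublevel_open|].
exists r => //; have [[bk ik] _ _] := MP k.
apply: le_lt_trans ik.
have mB : measurable (V `&` ball x r) by apply: measurableI => //; exact: ball_measurable.
have mGp : measurable_fun setT (fun y => `|G y| `^ p).
  by apply: (measurableT_comp (measurable_poweR p)); exact: measurableT_comp.
have mMp := borel_poweR_measurable p mu_borel (bM k).
apply: (@le_trans _ _ (\int[mu]_(y in V `&` ball x r) (M k y `^ p))).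
  apply: ae_ge0_le_integral => //.
  - by move=> y _; exact: poweR_ge0.
  - exact: measurable_funTS.
  - by move=> y _; exact: poweR_ge0.
  - exact: measurable_funTS.
  apply: filterS (domain_gradient_le k) => y GM [_ yB].
  rewrite gee0_abs; last by case: bG.
  by apply: le_poweR; [exact: ltW|case: bG|apply: GM; exact: rU].
apply: ge0_subset_integral => //; by move=> y _; exact: poweR_ge0.
Qed.

Lemma level_eventually x : V x -> exists k, forall n, (k <= n)%N ->
  (level n.+1%:R x)%:E = u x.
Proof.
move=> Vx; have := u_fin Vx; case E' : (u x) => [s| |] // _; exists (Num.bound `|s|%R) => n kn.
rewrite level_lt ?E'//; first by case: Vx.
rewrite lee_fin; apply: le_trans (ler_norm _) _.
apply: ltW; apply: lt_le_trans (archi_boundP (normr_ge0 _)) _; rewrite ler_nat; exact: leqW.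
Qed.

Lemma domain_gradient_wug : wug mu p V u G.
Proof.
apply: (wug_sup mu_borel p_gt0 (f_ := fun n => EFin \o level n.+1%:R)) => //.
  by move=> n; have [_ Wn _] := MP n; exact: wug_subset Wn.
move=> x y Vx Vy; have [i iP] := level_eventually Vx; have [j jP] := level_eventually Vy.
by exists (maxn i j); rewrite /= iP ?leq_maxl// jP// leq_maxr.
Qed.

(** This ensures that [min_grad] of [u] on [Omega] minus [E] is a true minimal gradient and not the
    default value. *)
Lemma domain_gradient_minimal : minimal_weak_upper_gradient p mu V u G.
Proof.
have mV : measurable V by apply: (borel_measurable mu_borel); exact: open_borel V_open.
split; [exact: wug_to_weak domain_gradient_wug|exact: domain_gradient_Lp_loc|].
move=> g' Wg' Lg'.
have H1 : {ae mu, forall x k, (V `&` [set x | u x < k.+1%:R%:E]) x -> G x <= M k x}.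
  by apply/ae_foralln => k; exact: domain_gradient_le.
have H2 : {ae mu, forall x k, (V `&` [set x | u x < k.+1%:R%:E]) x -> M k x <= g' x}.
  apply/ae_foralln => k.
  apply: (energy_minimal_le mu_borel mu_balls mu_doubling p_gt0 (MP k) (sublevel_open _) V_open _ _ Wg' Lg').
    by move=> x [].
  by move=> x [[Ox _] /= uk]; rewrite level_lt// ltW.
apply: filterS2 H1 H2 => x H1 H2 Vx.
have [k kP] := level_eventually Vx.
have Ux : (V `&` [set x | u x < k.+2%:R%:E]) x.
  split => //=; rewrite -(kP k)// lte_fin.
  by apply: le_lt_trans (level_le _ _) _; rewrite ?ler0n// ltr_nat.
exact: le_trans (H1 k.+1 Ux) (H2 k.+1 Ux).
Qed.

End domain_gradient.

Lemma exists_domain_gradient : exists M : nat -> X -> \bar R,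
  forall n, energy_minimal mu p (EFin \o level n.+1%:R) (M n).
Proof.
have /choice[M MP] (n : nat) : exists m, energy_minimal mu p (EFin \o level n.+1%:R) m.
  exact: exists_level_gradient.
by exists M.
Qed.

Lemma abse_EFinB (x y x' y' : R) : (`|x - y| <= `|x' - y'|)%R ->
  `|x%:E - y%:E| <= `|x'%:E - y'%:E|.
Proof. by []. Qed.

(* On the open set where u < b the excess (u - b)_+ vanishes, so it does not
   contribute to an upper gradient of w + (u - b)_+ there. *)
Lemma competitor_gradient b (w : X -> R) k : (0 < b)%R -> Lp_borel mu p k ->
  wug mu p V (EFin \o w) k -> exists K, [/\ borel_ge0 K,
    wug mu p V (fun x => u x + (w x - level b x)%:E) K, Lp_loc p mu V K &
    forall x, V x -> u x < b%:E -> K x = k x].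
Proof.
move=> b0 Lk Wk; have [M MP] := exists_domain_gradient.
pose D := ~` (V `&` [set x | u x < b%:E]).
have bD : borel_set D.
  by apply: (@measurableC _ (@borelType _ _ X)); apply: open_borel; exact: sublevel_open.
(* These are truncations of [(u - b)_+], which vanish off [D]. The truncations are used because they
   have p-integrable gradients on the whole space. *)
pose psi n x : R := (Order.max b (level n.+1%:R x) - b)%R.
have Lp_M n : Lp_borel mu p (M n) by case: (MP n).
have bM n : borel_ge0 (M n \_ D) by apply: borel_restrict => //; case: (Lp_M n).
have Wpsi n : wug mu p setT (EFin \o psi n) (M n).
  have [_ Wn _] := MP n; apply: (wug_lip _ _ Wn) => [|x y _ _]; first by case: (Lp_M n).
  apply: abse_EFinB; rewrite /psi opprB addrA subrK; exact: max_contraction.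
have psi0 n x : psi n x != 0%R -> D x.
  move=> px [[Ox nE] /= ub]; move: px; rewrite /psi max_l ?subrr ?eqxx//.
  by rewrite -lee_fin levelE// ge_min ltW.
have Wpsi' n : wug mu p V (EFin \o psi n) (M n \_ D).
  apply: (@wug_subset _ _ _ _ _ setT) => //.
  by apply: (wug_nonzero mu_borel) => // x _ /=; rewrite eqe; exact: psi0.
pose Psi x : R := (fine (u x) - level b x)%R.
pose G' x := esups ((fun n => M n \_ D) ^~ x) 0%N.
have bG' : borel_ge0 G' by exact: borel_esups.
have WPsi : wug mu p V (EFin \o Psi) G'.
  apply: (wug_sup mu_borel p_gt0 (f_ := fun n => EFin \o psi n)) => //.
  move=> x y Vx Vy; have [i iP] := level_eventually Vx; have [j jP] := level_eventually Vy.
  have key z n : V z -> (level n.+1%:R z)%:E = u z -> Psi z = psi n z.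
    move=> [Oz _] uz; rewrite /Psi /psi -uz /=.
    have [ub|bu] := leP (u z) b%:E.
      have -> : level b z = level n.+1%:R z.
        by apply: EFin_inj; rewrite uz level_lt// ltW.
      by rewrite subrr max_l ?subrr// -lee_fin uz.
    by rewrite (level_top (ltW b0) Oz (ltW bu)) max_r// -lee_fin uz ltW.
  exists (maxn i j); rewrite /=; split; congr EFin; apply: key => //.
    by apply: iP; exact: leq_maxl.
  by apply: jP; exact: leq_maxr.
exists (fun x => k x + G' x); split.
- by apply: borel_add => //; case: Lk.
- apply: (wug_eq _ (wug_add mu_borel _ _ Wk WPsi)) => //; last by case: Lk.
  move=> x Vx; rewrite /= /Psi -[X in _ = X + _](fineK (u_fin Vx)) -EFinD; congr EFin.
  by rewrite addrCA.
- have [mG locG] := domain_gradient_Lp_loc MP.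
  pose G x := esups (M ^~ x) 0%N.
  have bGM : borel_ge0 G by apply: borel_esups => n; case: (Lp_M n).
  have G'G x : G' x <= G x.
    apply: ge_ereal_sup => _ [n _ <-]; apply: le_trans (le_esups (M ^~ x) n).
    rewrite patchE; case: ifP => // _; by case: (Lp_M n) => -[_ +] _; exact.
  have bkG : borel_ge0 (fun x => k x + G' x) by apply: borel_add => //; case: Lk.
  split; first by apply: measurable_funTS; exact: borel_ge0_measurable.
  move=> x Vx; have [r r0 rG] := locG x Vx; exists r => //.
  have bB : borel_set (V `&` ball x r).
    apply: (@measurableI _ (@borelType _ _ X)); apply: open_borel; first exact: V_open.
    exact: metric_ball_open.
  have mB := borel_measurable mu_borel bB.
  have LGB : Lp_borel mu p (G \_ (V `&` ball x r)).
    split; first exact: borel_restrict.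
    apply: le_lt_trans rG; rewrite [leRHS]integral_mkcond.
    apply: ge0_le_integral_nomeas => y _; first exact: poweR_ge0.
    rewrite !patchE; case: ifP => _; last by rewrite poweR0r ?gt_eqF//.
    by have Gy : 0 <= G y := bGM.2 y; rewrite (gee0_abs Gy).
  have [_ ikG] := Lp_add mu_borel p_gt0 Lk LGB.
  apply: le_lt_trans ikG; rewrite integral_mkcond.
  apply: ge0_le_integral_nomeas => y _; rewrite patchE.
    by case: ifP => // _; exact: poweR_ge0.
  case: ifPn => yB; last exact: poweR_ge0.
  have k0 : 0 <= k y by case: Lk => -[_ +] _; exact.
  have G'0 : 0 <= G' y by case: bG' => _; exact.
  rewrite gee0_abs ?adde_ge0//; apply: le_poweR; [exact: ltW|exact: adde_ge0|].
  by rewrite leeD2l// patchE yB.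
- move=> x Vx ub; suff -> : G' x = 0 by rewrite adde0.
  apply/eqP; rewrite eq_le; apply/andP; split; last by case: bG' => _; exact.
  apply: ge_ereal_sup => _ [n _ <-]; rewrite patchE memNset//.
  by move=> /(_ (conj Vx ub)).
Qed.

(* [w] competes with the level through phi = w - level, restricted to the harmonic
   domain; at the remaining points of Omega both equal b, up to an avoided set. *)
Lemma energy_minimality b m (w : X -> R) k : (0 < b)%R ->
  avoided mu p (E `&` [set x | u x < b%:E]) ->
  energy_minimal mu p (EFin \o level b) m ->
  measurable_fun setT (EFin \o w) -> (forall x, (0 <= w x <= b)%R) ->
  (forall x, ~ Omega x -> w x = 0%R) ->
  (forall x, Omega x -> b%:E <= u x -> w x = b) ->
  Lp_borel mu p k -> wug mu p setT (EFin \o w) k ->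
  \int[mu]_x (m x `^ p) <= \int[mu]_x (k x `^ p).
Proof.
move=> b0 avb Em mw w0b wout wtop Lk Wk.
have [Lm Wm _] := Em; have bk := Lk.1; have bm := Lm.1.
have bV : borel_set V by apply: open_borel; exact: V_open.
have mV : measurable V by exact: (borel_measurable mu_borel).
pose w' x : R := if x \in V then w x else level b x.
have Wk' : wug mu p setT (EFin \o w') k.
  apply: (wug_avoided mu_borel avb bk _ Wk) => x nZ; congr EFin; rewrite /w'.
  have [Vx|nV] := pselect (V x); first by rewrite mem_set.
  rewrite memNset//; have [Ox|Ox] := pselect (Omega x); last by rewrite level_out// wout.
  have Ex : E x by apply: contrapT => nE; apply: nV.
  have bu : b%:E <= u x by rewrite leNgt; apply/negP => ub; apply: nZ.
  by rewrite wtop// level_top// ltW.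
pose phi x : R := (w' x - level b x)%R.
have mlev : measurable_fun setT (EFin \o level b) by case: (N1p_level b0).
have mw' : measurable_fun setT (EFin \o w').
  rewrite (_ : EFin \o w' = fun x => if x \in V then (EFin \o w) x else (EFin \o level b) x).
    apply: measurable_fun_ifT => //; apply: (measurable_fun_bool true) => //; rewrite setTI.
    by rewrite (_ : _ @^-1` _ = V)//; apply/seteqP; split => x; [exact: set_mem|exact: mem_set].
  by apply/funext => x; rewrite /= /w'; case: ifP.
have mphi : measurable_fun setT (EFin \o phi).
  exact: (emeasurable_funB mw' mlev).
have lev0b x : (0 <= level b x <= b)%R by rewrite level_ge0 ?level_le ?ltW.
have phib x : (`|phi x| <= b)%R.
  have /andP[? ?] := lev0b x; have /andP[? ?] := w0b x.
  by rewrite /phi /w' ler_norml; case: ifP => _; apply/andP; split; lra.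
have phiV x : ~ V x -> phi x = 0%R by move=> nV; rewrite /phi /w' memNset// subrr.
have Wphi : wug mu p setT (EFin \o phi) (fun x => k x + m x).
  apply: (wug_add mu_borel bk bm Wk').
  apply: (wug_lip bm _ Wm) => x y _ _; apply: abse_EFinB.
  by rewrite -opprD normrN.
have Nphi : N1p_0 p mu V (EFin \o phi).
  rewrite /N1p_0 (_ : (EFin \o phi) \_ V = EFin \o phi); last first.
    apply/funext => x; rewrite patchE /=; have [Vx|nV] := pselect (V x); first by rewrite mem_set.
    by rewrite memNset// phiV.
  apply: (wug_N1p mu_borel mphi _ (Lp_add mu_borel p_gt0 Lk Lm) Wphi).
  by apply: (bounded_in_Lp p_gt0 mphi phib) => x nO; apply: phiV => -[].
have [_ _ [_ /(_ _ Nphi) umin]] := u_harmonic.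
pose S := V `&` [set x | (EFin \o phi) x != 0].
have mS : measurable S.
  apply: measurableI => //; rewrite -[X in measurable X]setTI.
  exact: emeasurable_neq.
(* Where [u >= b] both [w] and the level equal [b]. On the remaining set, where [u < b], the
   gradient of [u] dominates [m], and that of the competitor is at most [k]. *)
have SU : S `<=` V `&` [set x | u x < b%:E].
  move=> x [Vx] /= phix; split => //=; rewrite ltNge; apply/negP => bu.
  have Ox : Omega x by case: Vx.
  move: phix; rewrite /phi /w' mem_set// (wtop _ Ox bu) (level_top (ltW b0) Ox bu) subrr.
  by rewrite eqxx.
have [M MP] := exists_domain_gradient.
have umm := min_gradP (domain_gradient_minimal MP).
have [Wu Lu _] := umm; have [mu_ u0 _] := Wu.
have i1 : {ae mu, forall x, (V `&` [set x | u x < b%:E]) x -> m x <= min_grad p mu V u x}.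
  apply: (energy_minimal_le mu_borel mu_balls mu_doubling p_gt0 Em (sublevel_open _) V_open _ _ Wu Lu).
    by move=> x [].
  by move=> x [[Ox _] /= ub]; rewrite level_lt// ltW.
pose q := min_grad p mu V (fun y => u y + (EFin \o phi) y).
(* If no minimal gradient of the competitor existed, [q] would be the default zero and the bound by
   [k] would hold trivially. *)
have [mq q0 qk] : [/\ measurable_fun V q, forall x, V x -> 0 <= q x &
    {ae mu, forall x, (V `&` [set x | u x < b%:E]) x -> q x <= k x}].
  have [[g gm]|nog] := pselect (exists g, minimal_weak_upper_gradient p mu V (fun y => u y + (EFin \o phi) y) g).
    have [Wq Lq qmin] := min_gradP gm; have [mq q0 _] := Wq.
    split => //.
    have [K [bK WK LK Kk]] := competitor_gradient b0 Lk (@wug_subset _ _ _ _ _ _ V _ _ (@subsetT _ _) Wk').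
    have := qmin K (wug_to_weak mu_borel mV bK WK) LK.
    by apply: filterS => x qK [Vx ub]; rewrite -(Kk x)//; exact: qK.
  have q00 : q = cst 0.
    by rewrite /q /min_grad; apply: xgetPN => g gm; apply: nog; exists g.
  rewrite q00; split => //.
  by apply: aeW => x _; exact: bk.2.
have mk := borel_poweR_measurable p mu_borel bk.
have mm := borel_poweR_measurable p mu_borel bm.
have SV : S `<=` V by move=> x [].
have iS : \int[mu]_(x in S) (m x `^ p) <= \int[mu]_(x in S) (k x `^ p).
  apply: (@le_trans _ _ (\int[mu]_(x in S) (min_grad p mu V u x `^ p))).
    apply: ae_ge0_le_integral => //.
    - by move=> x _; exact: poweR_ge0.
    - exact: measurable_funTS.
    - by move=> x _; exact: poweR_ge0.
    - apply: (measurable_funS mV SV); exact: (measurableT_comp (measurable_poweR p) mu_).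
    - apply: filterS i1 => x mx Sx; apply: le_poweR; [exact: ltW|by case: bm|].
      by apply: mx; exact: SU.
  apply: le_trans umin _; apply: ae_ge0_le_integral => //.
  - by move=> x _; exact: poweR_ge0.
  - apply: (measurable_funS mV SV); exact: (measurableT_comp (measurable_poweR p) mq).
  - by move=> x _; exact: poweR_ge0.
  - exact: measurable_funTS.
  - apply: filterS qk => x qx Sx; apply: le_poweR; [exact: ltW|by apply: q0; exact: SV|].
    by apply: qx; exact: SU.
have [D [N [bD bN N0 SD DSN]]] := borel_hull mu_borel mS.
(* Minimality of [u] says nothing outside [S]. There [phi] vanishes, and writing the level as
   [w' - phi] gives it a gradient that equals [k] off a Borel hull of [S]; hence [m <= k] almost
   everywhere outside [S]. *)
have Wlev : wug mu p setT (EFin \o level b) (fun x => k x + ((fun x => k x + m x) \_ D) x).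
  have Wphi' : wug mu p setT (EFin \o (fun x => - phi x)%R) ((fun x => k x + m x) \_ D).
    apply: (wug_nonzero mu_borel (Lp_add mu_borel p_gt0 Lk Lm)) => //.
      apply: (wug_lip _ _ Wphi); first exact: borel_add.
      by move=> x y _ _; apply: abse_EFinB; rewrite -opprD normrN.
    move=> x _ /=; rewrite eqe oppr_eq0 => phix; apply: SD; split => //.
    by apply: contrapT => nV; move: phix; rewrite phiV// eqxx.
  apply: (wug_eq _ (wug_add mu_borel bk _ Wk' Wphi')); last by apply: borel_restrict => //; exact: borel_add.
  by move=> x _; rewrite /= /phi opprB addrC subrK.
have i3 : {ae mu, forall x, setT x -> m x <= k x + ((fun x => k x + m x) \_ D) x}.
  have bb : borel_ge0 (fun x => k x + ((fun x => k x + m x) \_ D) x).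
    by apply: borel_add => //; apply: borel_restrict => //; exact: borel_add.
  apply: (energy_minimal_le mu_borel mu_balls mu_doubling p_gt0 Em openT openT) => //.
    exact: wug_to_weak Wlev.
  apply: (Lp_borel_loc mu_borel) => //; apply: (Lp_add mu_borel p_gt0 Lk).
  apply: (Lp_borel_le mu_borel p_gt0 _ (Lp_add mu_borel p_gt0 Lk Lm)).
    by apply: borel_restrict => //; exact: borel_add.
  move=> x; rewrite patchE; case: ifP => // _; by case: (borel_add bk bm).
have mSC : measurable (~` S) by exact: measurableC.
have iSC : \int[mu]_(x in ~` S) (m x `^ p) <= \int[mu]_(x in ~` S) (k x `^ p).
  apply: ae_ge0_le_integral => //.
  - by move=> x _; exact: poweR_ge0.
  - exact: measurable_funTS.
  - by move=> x _; exact: poweR_ge0.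
  - exact: measurable_funTS.
  have NN : {ae mu, forall x, ~ N x}.
    exists N; split => //; first exact: (borel_measurable mu_borel).
    by move=> x /= /contrapT.
  apply: filterS2 i3 NN => x mx nN nS; apply: le_poweR; [exact: ltW|by case: bm|].
  have := mx Logic.I; rewrite patchE memNset ?adde0// => Dx.
  by apply: nN; apply: DSN.
have split_int (g : X -> \bar R) : measurable_fun setT (fun x => g x `^ p) ->
    \int[mu]_x (g x `^ p) = \int[mu]_(x in S) (g x `^ p) + \int[mu]_(x in ~` S) (g x `^ p).
  move=> mg; rewrite -ge0_integral_setU//; first by rewrite setUCr.
  - by rewrite setUCr.
  - by move=> x _; exact: poweR_ge0.
  - by apply/disj_setPCl.
by rewrite !split_int//; exact: leeD.
Qed.

(** * Splitting of energies and the energies of the levels *)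

Lemma disjoint_integral k1 k2 D1 D2 : borel_ge0 k1 -> borel_ge0 k2 ->
  borel_set D1 -> borel_set D2 -> mu (D1 `&` D2) = 0 ->
  \int[mu]_x (((k1 \_ D1) x + (k2 \_ D2) x) `^ p) =
  \int[mu]_x ((k1 \_ D1) x `^ p) + \int[mu]_x ((k2 \_ D2) x `^ p).
Proof.
move=> b1 b2 bD1 bD2 D0.
have c1 := borel_restrict bD1 b1; have c2 := borel_restrict bD2 b2.
rewrite -ge0_integralD//; first last.
- exact: borel_poweR_measurable.
- by move=> x _; exact: poweR_ge0.
- exact: borel_poweR_measurable.
- by move=> x _; exact: poweR_ge0.
have mD : measurable (D1 `&` D2).
  by apply: measurableI; exact: (borel_measurable mu_borel).
apply: ge0_ae_eq_integral => //.
- by apply: borel_poweR_measurable => //; exact: borel_add.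
- by apply: emeasurable_funD; exact: borel_poweR_measurable.
- by move=> x _; exact: poweR_ge0.
- by move=> x _; rewrite adde_ge0// poweR_ge0.
exists (D1 `&` D2); split => // x /=; apply: contra_notP => nD _.
rewrite !patchE; case: ifPn => x1; case: ifPn => x2.
- by exfalso; apply: nD; rewrite !inE in x1 x2.
- by rewrite poweR0r ?gt_eqF// !adde0.
- by rewrite poweR0r ?gt_eqF// !add0e.
- by rewrite adde0 poweR0r ?gt_eqF// adde0.
Qed.

(** The sets are measurable only for the completion. Borel hulls of disjoint sets may meet, but only
    in a null set, which energies do not see. *)
Lemma null_hulls (S1 S2 : set X) : measurable S1 -> measurable S2 ->
  S1 `&` S2 = set0 -> exists D1 D2, [/\ borel_set D1, borel_set D2, S1 `<=` D1,
    S2 `<=` D2 & mu (D1 `&` D2) = 0].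
Proof.
move=> m1 m2 S0; have [D1 [N1 [b1 bN1 N10 SD1 DS1]]] := borel_hull mu_borel m1.
have [D2 [N2 [b2 bN2 N20 SD2 DS2]]] := borel_hull mu_borel m2.
exists D1, D2; split => //.
have mm (A : set X) : borel_set A -> measurable A by move=> ?; exact: (borel_measurable mu_borel).
apply/negligibleP; first by apply: measurableI; exact: mm.
apply: (@negligibleS _ _ _ mu (N1 `|` N2)); last first.
  by apply: negligibleU; apply/negligibleP => //; exact: mm.
move=> x [x1 x2]; have [s1|s1] := pselect (S1 x); last by left; apply: DS1.
right; apply: DS2; split => // s2.
by have : (S1 `&` S2) x by []; rewrite S0.
Qed.

Lemma measurable_level a : (0 <= a)%R -> measurable_fun setT (EFin \o level a).
Proof.
rewrite le_eqVlt => /predU1P[<-|a0]; last by case: (N1p_level a0).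
rewrite (_ : EFin \o level 0%R = cst 0); first exact: measurable_cst.
apply/funext => x /=; congr EFin; apply/eqP.
by rewrite eq_le level_ge0// level_le.
Qed.

(* The test function is al * level a + be * (b - a) * v, whose two terms have
   gradients supported on almost disjoint sets. *)
Lemma competitor_energy a b m (v : X -> R) k1 k2 (al be : R) : (0 <= a)%R -> (a < b)%R ->
  avoided mu p (E `&` [set x | u x < b%:E]) ->
  energy_minimal mu p (EFin \o level b) m -> measurable_fun setT (EFin \o v) ->
  (forall x, (0 <= v x <= 1)%R) ->
  (forall x, ~ superlevel_ge Omega u a%:E x -> v x = 0%R) ->
  (forall x, superlevel_ge Omega u b%:E x -> v x = 1%R) ->
  Lp_borel mu p k1 -> wug mu p setT (EFin \o level a) k1 ->
  Lp_borel mu p k2 -> wug mu p setT (EFin \o v) k2 ->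
  (0 <= al)%R -> (0 <= be)%R -> (al * a + be * (b - a) = b)%R ->
  \int[mu]_x (m x `^ p) <= (al `^ p)%:E * \int[mu]_x (k1 x `^ p) +
     ((be * (b - a)) `^ p)%:E * \int[mu]_x (k2 x `^ p).
Proof.
move=> a0 ab avb Em mv v01 vout vtop L1 W1 L2 W2 al0 be0 albe.
have b0 : (0 < b)%R by exact: le_lt_trans ab.
have ba0 : (0 <= b - a)%R by rewrite subr_ge0 ltW.
have mla := measurable_level a0.
pose S1 := [set x | (EFin \o level a) x != a%:E].
pose S2 := [set x | (EFin \o v) x != 0].
have mS1 : measurable S1 by rewrite -[X in measurable X]setTI; exact: emeasurable_neq.
have mS2 : measurable S2 by rewrite -[X in measurable X]setTI; exact: emeasurable_neq.
have S12 : S1 `&` S2 = set0.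
  rewrite -subset0 => x [/= la vx].
  have [Ox au] : superlevel_ge Omega u a%:E x.
    by apply: contrapT => nx; move: vx; rewrite /S2 /= vout// eqxx.
  by move: la; rewrite /S1 /= level_top// eqxx.
have [D1 [D2 [bD1 bD2 SD1 SD2 D120]]] := null_hulls mS1 mS2 S12.
have Wl1 : wug mu p setT (EFin \o level a) (k1 \_ D1).
  (* Subtracting the constant [a] gives a function that is nonzero only on [S1], so its gradient may
     be restricted to [D1]. *)
  have W1' : wug mu p setT (EFin \o (fun x => level a x - a)%R) k1.
    apply: (wug_lip L1.1 _ W1) => x y _ _; apply: abse_EFinB.
    by rewrite opprB addrA subrK.
  have W1'' : wug mu p setT (EFin \o (fun x => level a x - a)%R) (k1 \_ D1).
    apply: (wug_nonzero mu_borel L1 W1' bD1) => x _ /=; rewrite eqe subr_eq0 => xa.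
    by apply: SD1; rewrite /S1 /= eqe.
  apply: (wug_lip _ _ W1''); first by apply: borel_restrict => //; case: L1.
  move=> x y _ _; apply: abse_EFinB.
  by rewrite [X in (_ <= `|X|)%R](_ : _ = level a x - level a y)%R//; ring.
have Wl2 : wug mu p setT (EFin \o v) (k2 \_ D2).
  by apply: (wug_nonzero mu_borel L2 W2 bD2) => x _ vx; exact: SD2.
have c1 := borel_restrict bD1 L1.1; have c2 := borel_restrict bD2 L2.1.
pose be' := (be * (b - a))%R.
have be'0 : (0 <= be')%R by rewrite mulr_ge0.
have e1 := borel_scale al0 L1.1; have e2 := borel_scale be'0 L2.1.
pose w x : R := (al * level a x + be' * v x)%R.
have scale_wug (f : X -> R) g (r : R) : (0 <= r)%R -> borel_ge0 g -> wug mu p setT (EFin \o f) g ->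
    wug mu p setT (EFin \o (fun x => r * f x)%R) (fun x => r%:E * g x).
  move=> r0 bg Wg; apply: (wug_contraction r0 bg _ Wg) => x y _ _ /=.
  by rewrite -EFinM lee_fin -mulrBr normrM ger0_norm.
have Ww : wug mu p setT (EFin \o w)
    (fun x => al%:E * (k1 \_ D1) x + be'%:E * (k2 \_ D2) x).
  by apply: (wug_add mu_borel _ _ (scale_wug _ _ _ al0 c1 Wl1) (scale_wug _ _ _ be'0 c2 Wl2));
    exact: borel_scale.
have patchZ (r : R) (g : X -> \bar R) D : (fun x => r%:E * (g \_ D) x) = (fun x => r%:E * g x) \_ D.
  by apply/funext => x; rewrite !patchE; case: ifP => //; rewrite mule0.
have KE : (fun x => al%:E * (k1 \_ D1) x + be'%:E * (k2 \_ D2) x) =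
    (fun x => ((fun x => al%:E * k1 x) \_ D1) x + ((fun x => be'%:E * k2 x) \_ D2) x).
  by rewrite -!patchZ.
rewrite KE in Ww.
have restrict_le g D : borel_set D -> borel_ge0 g -> forall x, (g \_ D) x <= g x.
  by move=> bD [_ g0] x; rewrite patchE; case: ifP.
have LD1 : Lp_borel mu p ((fun x => al%:E * k1 x) \_ D1).
  apply: (@Lp_borel_le _ _ _ mu p mu_borel p_gt0 _ (fun x => al%:E * k1 x)).
  - exact: borel_restrict.
  - exact: Lp_scale.
  - exact: restrict_le.
have LD2 : Lp_borel mu p ((fun x => be'%:E * k2 x) \_ D2).
  apply: (@Lp_borel_le _ _ _ mu p mu_borel p_gt0 _ (fun x => be'%:E * k2 x)).
  - exact: borel_restrict.
  - exact: Lp_scale.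
  - exact: restrict_le.
apply: (@le_trans _ _ (\int[mu]_x ((((fun x => al%:E * k1 x) \_ D1) x + ((fun x => be'%:E * k2 x) \_ D2) x) `^ p))).
  apply: (energy_minimality b0 avb Em _ _ _ _ (Lp_add mu_borel p_gt0 LD1 LD2) Ww).
  - rewrite (_ : EFin \o w = fun x => al%:E * (EFin \o level a) x + be'%:E * (EFin \o v) x)//.
    by apply: emeasurable_funD; apply: emeasurable_funM => //; exact: measurable_cst.
  - move=> x; have /andP[v0 v1] := v01 x.
    have l0 := level_ge0 x a0; have l1 := level_le x a0.
    apply/andP; split; first by rewrite addr_ge0// mulr_ge0.
    rewrite -[leRHS]albe; apply: lerD; first exact: ler_wpM2l.
    by rewrite -[leRHS]mulr1; exact: ler_wpM2l.
  - by move=> x Ox; rewrite /w level_out// vout ?mulr0 ?addr0// => -[].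
  - move=> x Ox bu; rewrite /w vtop// level_top//; first by rewrite mulr1.
    by apply: le_trans bu; rewrite lee_fin ltW.
rewrite disjoint_integral//; apply: leeD.
  rewrite -(@int_poweR_scale _ _ _ mu p mu_borel)//; last by case: L1.
  apply: le_int_poweR => //; first exact: borel_restrict.
  exact: restrict_le.
rewrite -(@int_poweR_scale _ _ _ mu p mu_borel)//; last by case: L2.
apply: le_int_poweR => //; first exact: borel_restrict.
exact: restrict_le.
Qed.

Lemma Lp_energy g : Lp_borel mu p g ->
  exists2 r : R, (0 <= r)%R & \int[mu]_x (g x `^ p) = r%:E.
Proof.
move=> [_]; have : 0 <= \int[mu]_x (g x `^ p) by apply: integral_ge0 => x _; exact: poweR_ge0.
by case: (\int[mu]_x (g x `^ p)) => [r| |] // r0 _; exists r.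
Qed.

(** The extremal function for the capacity between the levels [a] and [b]. *)
Definition ramp a b x : R := ((b - a)^-1 * (level b x - level a x))%R.

Lemma level_diff_contraction a b x y : (0 <= a)%R -> (a <= b)%R ->
  (`|(level b x - level a x) - (level b y - level a y)| <= `|level b x - level b y|)%R.
Proof.
move=> a0 ab.
have lE z : (level b z - level a z = Order.max a (level b z) - a)%R.
  by rewrite (level_min z a0 ab); case: (leP a (level b z)) => _ //; rewrite !subrr.
rewrite !lE opprB addrA subrK; exact: max_contraction.
Qed.

Lemma ramp_ge0_le1 a b x : (0 <= a)%R -> (a < b)%R -> (0 <= ramp a b x <= 1)%R.
Proof.
move=> a0 ab; have ba : (0 < b - a)%R by rewrite subr_gt0.
have b0 := ltW (le_lt_trans a0 ab); have lb := level_le x b0.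
rewrite /ramp (level_min x a0 (ltW ab)); apply/andP; split.
  by rewrite mulr_ge0 ?invr_ge0 ?(ltW ba)// subr_ge0 ge_min lexx orbT.
rewrite mulrC ler_pdivrMr// mul1r.
by case: (leP a (level b x)) => _; [rewrite lerD2r|rewrite subrr ltW].
Qed.

Lemma ramp_out a b x : (0 <= a)%R -> (a < b)%R ->
  ~ superlevel_gt Omega u a%:E x -> ramp a b x = 0%R.
Proof.
move=> a0 ab nx; rewrite /ramp; have b0 := ltW (le_lt_trans a0 ab).
have [Ox|Ox] := pselect (Omega x); last by rewrite !level_out// subrr mulr0.
have ua : u x <= a%:E by rewrite leNgt; apply/negP => au; apply: nx.
suff -> : level b x = level a x by rewrite subrr mulr0.
by apply: EFin_inj; rewrite !level_lt// (le_trans ua)// lee_fin ltW.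
Qed.

Lemma ramp_top a b x : (0 <= a)%R -> (a < b)%R ->
  superlevel_ge Omega u b%:E x -> ramp a b x = 1%R.
Proof.
move=> a0 ab [Ox bu]; have b0 := ltW (le_lt_trans a0 ab).
rewrite /ramp (level_top b0 Ox bu) level_top//; last by apply: le_trans bu; rewrite lee_fin ltW.
by rewrite mulVf// gt_eqF// subr_gt0.
Qed.

Lemma measurable_ramp a b : (0 <= a)%R -> (a < b)%R -> measurable_fun setT (EFin \o ramp a b).
Proof.
move=> a0 ab; have b0 := ltW (le_lt_trans a0 ab).
rewrite (_ : _ \o _ = fun x => ((b - a)^-1)%:E * ((EFin \o level b) x - (EFin \o level a) x))//.
apply: emeasurable_funM; first exact: measurable_cst.
by apply: emeasurable_funB; exact: measurable_level.
Qed.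

Lemma wug_ramp a b k : (0 <= a)%R -> (a < b)%R -> borel_ge0 k ->
  wug mu p setT (EFin \o (fun x => level b x - level a x)%R) k ->
  wug mu p setT (EFin \o ramp a b) (fun x => ((b - a)^-1)%:E * k x).
Proof.
move=> a0 ab bk; have i0 : (0 <= (b - a)^-1)%R by rewrite invr_ge0 subr_ge0 ltW.
apply: (wug_contraction i0 bk) => x y _ _.
by rewrite /= -EFinM lee_fin -mulrBr normrM ger0_norm.
Qed.

(** The gradient [mb] splits into a gradient [g1] of [level a] and a gradient [g2] of the
    difference, with energies satisfying [n1 + n2 = Ib]. Comparison with other gradients of
    [level a] gives [n1 = Ia], and the balance [(b - a) n1 = a n2] then yields the
    proportionality. *)
Lemma level_energies a b ma mb (Ia Ib : R) : (0 < a)%R -> (a < b)%R ->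
  avoided mu p (E `&` [set x | u x < b%:E]) ->
  energy_minimal mu p (EFin \o level a) ma -> energy_minimal mu p (EFin \o level b) mb ->
  \int[mu]_x (ma x `^ p) = Ia%:E -> \int[mu]_x (mb x `^ p) = Ib%:E ->
  (b * Ia = a * Ib)%R /\ exists k, [/\ Lp_borel mu p k,
    wug mu p setT (EFin \o (fun x => level b x - level a x)%R) k &
    \int[mu]_x (k x `^ p) = (Ib - Ia)%:E].
Proof.
move=> a_gt0 ab avb Ea Eb iIa iIb; have a0 := ltW a_gt0.
have b0 := lt_trans a_gt0 ab; have ba0 : (0 < b - a)%R by rewrite subr_gt0.
have [La Wa mina] := Ea; have [Lb Wb minb] := Eb; have bb := Lb.1.
pose S1 := [set x | (EFin \o level a) x != a%:E].
pose S2 := [set x | (EFin \o level b) x - (EFin \o level a) x != 0].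
have mla := measurable_level a0; have mlb := measurable_level (ltW b0).
have mS1 : measurable S1 by rewrite -[X in measurable X]setTI; exact: emeasurable_neq.
have mS2 : measurable S2.
  by rewrite -[X in measurable X]setTI; apply: emeasurable_neq => //; exact: emeasurable_funB.
have S12 : S1 `&` S2 = set0.
  rewrite -subset0 => x [].
  rewrite /S1 /S2 /= -EFinB !eqe (level_min x a0 (ltW ab)).
  by case: (leP a (level b x)) => _; rewrite ?eqxx// subrr eqxx.
have [D1 [D2 [bD1 bD2 SD1 SD2 D120]]] := null_hulls mS1 mS2 S12.
pose g1 := mb \_ D1; pose g2 := mb \_ D2.
have bg1 : borel_ge0 g1 by exact: borel_restrict.
have bg2 : borel_ge0 g2 by exact: borel_restrict.
have restrict_le g D : borel_ge0 g -> forall x, (g \_ D) x <= g x.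
  by move=> [_ g0] x; rewrite patchE; case: ifP.
have Lg1 : Lp_borel mu p g1 by apply: (Lp_borel_le mu_borel p_gt0 bg1 Lb); exact: restrict_le.
have Lg2 : Lp_borel mu p g2 by apply: (Lp_borel_le mu_borel p_gt0 bg2 Lb); exact: restrict_le.
have W1 : wug mu p setT (EFin \o level a) g1.
  have W1' : wug mu p setT (EFin \o (fun x => level a x - a)%R) mb.
    apply: (wug_lip bb _ Wb) => x y _ _; apply: abse_EFinB.
    by rewrite opprB addrA subrK; apply: level_contraction => //; exact: ltW.
  have W1'' : wug mu p setT (EFin \o (fun x => level a x - a)%R) g1.
    apply: (wug_nonzero mu_borel Lb W1' bD1) => x _ /=; rewrite eqe subr_eq0 => xa.
    by apply: SD1; rewrite /S1 /= eqe.
  apply: (wug_lip bg1 _ W1'') => x y _ _; apply: abse_EFinB.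
  by rewrite [X in (_ <= `|X|)%R](_ : _ = level a x - level a y)%R//; ring.
have W2 : wug mu p setT (EFin \o (fun x => level b x - level a x)%R) g2.
  apply: (wug_nonzero mu_borel Lb _ bD2).
    apply: (wug_lip bb _ Wb) => x y _ _; apply: abse_EFinB.
    by apply: level_diff_contraction => //; exact: ltW.
  by move=> x _ /= xab; apply: SD2.
have [n1 n10 in1] := Lp_energy Lg1; have [n2 n20 in2] := Lp_energy Lg2.
have n12 : (n1 + n2 <= Ib)%R.
  rewrite -lee_fin EFinD -in1 -in2 -disjoint_integral// -iIb.
  apply: ae_ge0_le_integral => //.
  - by move=> x _; exact: poweR_ge0.
  - by apply: borel_poweR_measurable => //; exact: borel_add.
  - by move=> x _; exact: poweR_ge0.
  - exact: borel_poweR_measurable.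
  exists (D1 `&` D2); split => //.
    by apply: measurableI; exact: (borel_measurable mu_borel).
  move=> x /=; apply: contra_notP => nD _; apply: le_poweR; first exact: ltW.
    by apply: adde_ge0; [case: bg1|case: bg2].
  rewrite !patchE; case: ifPn => x1; case: ifPn => x2; rewrite ?adde0 ?add0e//; last by case: bb.
  by exfalso; apply: nD; rewrite !inE in x1 x2.
have vout x : ~ superlevel_ge Omega u a%:E x -> ramp a b x = 0%R.
  by move=> nx; apply: ramp_out => // -[Ox /ltW au]; apply: nx.
have i0 : (0 <= (b - a)^-1)%R by rewrite invr_ge0 ltW.
have comp k1 (J al be : R) : Lp_borel mu p k1 -> wug mu p setT (EFin \o level a) k1 ->
    \int[mu]_x (k1 x `^ p) = J%:E -> (0 <= al)%R -> (0 <= be)%R ->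
    (al * a + be * (b - a) = b)%R -> (Ib <= al `^ p * J + be `^ p * n2)%R.
  move=> L1 Wk1 iJ al0 be0 albe.
  have := competitor_energy a0 ab avb Eb (measurable_ramp a0 ab) (fun x => ramp_ge0_le1 x a0 ab)
    vout (fun x => ramp_top a0 ab) L1 Wk1 (Lp_scale mu_borel i0 Lg2) (wug_ramp a0 ab bg2 W2) al0 be0 albe.
  rewrite (@int_poweR_scale _ _ _ mu p mu_borel)// iIb iJ in2 -!EFinM -EFinD lee_fin mulrA.
  by rewrite -powRM ?mulr_ge0 ?(ltW ba0)// mulfK// gt_eqF.
have aE : (1 * a + 1 * (b - a) = b)%R by rewrite !mul1r addrC subrK.
have Ib12 : (Ib <= n1 + n2)%R.
  by have := comp _ _ _ _ Lg1 W1 in1 ler01 ler01 aE; rewrite !powR1 !mul1r.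
have slopes : ((b - a) * n1 = a * n2)%R.
  apply: (@balanced_slopes R p) => // al be al0 be0 albe.
  have albe' : (al * a + be * (b - a) = b)%R by rewrite [LHS]albe addrC subrK.
  exact: le_trans n12 (comp _ _ _ _ Lg1 W1 in1 al0 be0 albe').
have Ian1 : (Ia <= n1)%R by rewrite -lee_fin -iIa -in1; exact: mina.
(* Using [ma] in place of [g1] in the competitor gives [n1 + n2 <= Ia + n2]. *)
have n1Ia : (n1 <= Ia)%R.
  have := comp _ _ _ _ La Wa iIa ler01 ler01 aE; rewrite !powR1 !mul1r => H.
  by rewrite -(lerD2r n2); exact: le_trans n12 H.
have E1 : Ia = n1 by apply/eqP; rewrite eq_le Ian1.
have E2 : Ib = (n1 + n2)%R by apply/eqP; rewrite eq_le Ib12.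
split; first by rewrite E1 E2 mulrDr -slopes; ring.
by exists g2; split => //; rewrite E1 E2 in2 addrC addKr.
Qed.

(** Zero capacity is known only for levels strictly below the essential infimum, so [u < b] is
    exhausted by the sets [u < b - 1 / (n + 1)]. *)
Lemma avoided_essinf b : b%:E <= cap_ess_inf p mu E u ->
  avoided mu p (E `&` [set x | u x < b%:E]).
Proof.
move=> bE; apply: (@avoided_subset _ _ _ _ _
  (\bigcup_n (E `&` [set x | u x < (b - n.+1%:R^-1)%:E]))).
  move=> x [Ex /= ub].
  have [n un] : exists n, u x < (b - n.+1%:R^-1)%:E.
    move: ub; case: (u x) => [r| |] //; last by exists 0%N; rewrite ltNyr.
    rewrite lte_fin -subr_gt0 => br.
    have [n _ nP] := near_infty_natSinv_lt (PosNum br).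
    exists n; rewrite lte_fin.
    have nb : (n.+1%:R^-1 < b - r)%R := nP n (leqnn n).
    by rewrite ltrBrDl -ltrBrDr.
  by exists n.
apply: avoided_bigcup => // n.
have : (b - n.+1%:R^-1)%:E < cap_ess_inf p mu E u.
  by apply: lt_le_trans bE; rewrite lte_fin ltrBlDr ltrDl invr_gt0.
move=> /ereal_sup_gt[_ [k capk <-] bk].
apply: avoided_subset (avoided_capacity0 mu_borel p_gt0 capk) => x [Ex /= ux].
by split => //; exact: lt_trans bk.
Qed.


Hypothesis mu_poincare : poincare p mu.
Hypothesis Omega_nonempty : Omega !=set0.
Hypothesis Omega_capacity : 0 < capacity p mu (~` Omega).

(* A level with vanishing energy is a.e. equal to a constant c, by the Poincare
   inequality; c = 0 contradicts u > 0, and otherwise 1 - level / c shows that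
   the complement of Omega has capacity zero. *)
Lemma level_energy_gt0 b m : (0 < b)%R -> energy_minimal mu p (EFin \o level b) m ->
  0 < \int[mu]_x (m x `^ p).
Proof.
move=> b0 [Lm Wm _]; have bm := Lm.1; have mlev := measurable_level (ltW b0).
rewrite lt_neqAle integral_ge0 ?andbT; last by move=> x _; exact: poweR_ge0.
apply/eqP => /esym I0.
have mm := borel_poweR_measurable p mu_borel bm.
have W0 : wug mu p setT (EFin \o level b) (cst 0).
  pose N := [set x | m x != 0].
  have bN : borel_set N.
    rewrite /borel_set -[X in measurable X]setTI.
    by apply: (@emeasurable_neq _ (@borelType _ _ X)) => //; case: bm.
  have mN := borel_measurable mu_borel bN.
  have N0 : mu N = 0.
    have /(ae_eq_integral_abs _ measurableT mm) ae0 : \int[mu]_x `|m x `^ p| = 0.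
      by rewrite -[RHS]I0; apply: eq_integral => x _; rewrite gee0_abs// poweR_ge0.
    apply/negligibleP => //; apply: (negligibleS _ ae0) => x Nx /(_ Logic.I) /= /eqP.
    by rewrite poweR_eq0 ?(negPf Nx)//; case: bm.
  apply: (wug_ae mu_borel p_gt0 bm (Lp_cst0 mu p_gt0).1 bN N0 _ Wm).
  by move=> x /negP; rewrite negbK => /eqP.
have b00 : borel_ge0 (cst 0 : X -> \bar R) by case: (Lp_cst0 mu p_gt0).
have out0 x : ~ Omega x -> level b x = 0%R by exact: level_out.
have lev_norm x : (`|level b x| <= b)%R by rewrite ger0_norm ?level_ge0 ?level_le ?ltW.
have Ilev : mu.-integrable setT (EFin \o level b).
  apply/integrableP; split => //.
  have := bounded_in_Lp ltr01 mlev lev_norm out0.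
  by under eq_integral do rewrite poweRe1//.
have [c lc] := zero_gradient_constant mu_borel mu_balls p_gt0 mu_poincare Ilev
  (wug_to_weak mu_borel measurableT b00 W0).
have c0 : c != 0%R.
  apply/eqP => c0; have [x Ox] := Omega_nonempty.
  have /nbhs_ballP[r /= r0 rO] : nbhs x Omega by apply: open_nbhs_nbhs.
  have [y /rO Oy] := @ae_meets_ball _ _ _ mu mu_borel mu_balls _ x r r0 lc.
  by apply/eqP; rewrite c0 gt_eqF// level_pos.
pose w x : R := (1 - c^-1 * level b x)%R.
have Ww : wug mu p setT (EFin \o w) (cst 0).
  rewrite (_ : cst 0 = fun x : X => (`|c^-1|%R)%:E * cst 0 x); last first.
    by apply/funext => x; rewrite mule0.
  apply: (wug_contraction _ b00 _ W0) => // x y _ _; rewrite /= -EFinM lee_fin.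
  rewrite -normrM [leRHS](_ : _ = `|c^-1 * level b y - c^-1 * level b x|)%R; last first.
    by rewrite distrC mulrBr.
  by rewrite /w opprB addrC addrA subrK.
have mw : measurable_fun setT (EFin \o w).
  rewrite (_ : EFin \o w = fun x => 1 - c^-1%:E * (EFin \o level b) x)//.
  apply: emeasurable_funB; first exact: measurable_cst.
  by apply: emeasurable_funM => //; exact: measurable_cst.
have mwp : measurable_fun setT (fun x => `|(EFin \o w) x| `^ p).
  by apply: (measurableT_comp (measurable_poweR p)); exact: measurableT_comp.
have iw : \int[mu]_x (`|(EFin \o w) x| `^ p) = 0.
  rewrite -[RHS](integral0 mu setT); apply: ge0_ae_eq_integral => //.
    by move=> x _; exact: poweR_ge0.
  apply: filterS lc => x lx _; rewrite /= /w lx mulVf// subrr normr0.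
  by apply: poweR0r; rewrite gt_eqF.
have i0 : \int[mu]_x ((cst 0 x : \bar R) `^ p) = 0.
  by apply: integral0_eq => x _; apply: poweR0r; rewrite gt_eqF.
have Nw : N1p p mu setT (EFin \o w).
  by apply: (wug_N1p mu_borel mw _ (Lp_cst0 mu p_gt0) Ww); rewrite iw.
suff : capacity p mu (~` Omega) <= 0 by rewrite leNgt Omega_capacity.
apply: (@le_trans _ _ (N1p_norm_pow p mu setT (EFin \o w))).
  apply: ereal_inf_lbound; exists (EFin \o w) => //; split => // x nO.
  by rewrite /= /w level_out// mulr0 subr0.
rewrite /N1p_norm_pow iw add0e -[leRHS]i0; apply: ereal_inf_lbound.
by exists (cst 0) => //; exact: wug_to_weak.
Qed.

Lemma linear_energies : 0 < cap_ess_inf p mu E u -> exists2 La : R, (0 < La)%R &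
  forall b m, (0 < b)%R -> b%:E <= cap_ess_inf p mu E u ->
    energy_minimal mu p (EFin \o level b) m -> \int[mu]_x (m x `^ p) = (La * b)%:E.
Proof.
move=> ess0.
(* One admissible level fixes the slope; every other level is compared with it. *)
have [c0 c0_gt0 c0E] : exists2 c0 : R, (0 < c0)%R & c0%:E <= cap_ess_inf p mu E u.
  case: (cap_ess_inf p mu E u) ess0 => [r| |] // r0; first by exists r.
  by exists 1%R => //; rewrite leey.
have [m0 Em0] := exists_level_gradient c0_gt0.
have [I0 _ iI0] := Lp_energy (let: And3 L _ _ := Em0 in L).
have I0_gt0 : (0 < I0)%R by rewrite -lte_fin -iI0; exact: level_energy_gt0 Em0.
exists (I0 / c0)%R; first exact: divr_gt0.
move=> b m b0 bE Em; have [I _ iI] := Lp_energy (let: And3 L _ _ := Em in L).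
rewrite iI; congr EFin; have c00 : c0 != 0%R by rewrite gt_eqF.
suff H : (c0 * I = b * I0)%R by apply: (mulfI c00); rewrite H; field.
case: (ltgtP b c0) => bc.
- by have [] := level_energies b0 bc (avoided_essinf c0E) Em Em0 iI iI0.
- by have [] := level_energies c0_gt0 bc (avoided_essinf bE) Em0 Em iI0 iI.
- rewrite bc; congr (_ * _)%R; apply: EFin_inj; rewrite -iI -iI0.
  have [[b1 _] W1 min1] := Em; have [[b2 _] W2 min2] := Em0; rewrite bc in W1 min1.
  by apply/eqP; rewrite eq_le min1//= min2.
Qed.

(** * The capacity formula *)

Section capacity_formula.
Variable La : R.
Hypothesis p_gt1 : (1 < p)%R.
Hypothesis La_gt0 : (0 < La)%R.
Hypothesis energyE : forall b m, (0 < b)%R -> b%:E <= cap_ess_inf p mu E u ->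
  energy_minimal mu p (EFin \o level b) m -> \int[mu]_x (m x `^ p) = (La * b)%:E.

(** With [x = b - a], a gradient of energy [La x] is scaled by [1 / x] to become one of the ramp. *)
Let gap_powE (x : R) : (0 < x)%R -> (La * (x^-1 `^ p * x) = La * x `^ (1 - p))%R.
Proof.
move=> x0; congr (_ * _)%R.
have -> : (x `^ (1 - p) = x * x `^ (- p))%R.
  by rewrite -{2}(powRr1 (ltW x0)) -powRD// (gt_eqF x0) implybT.
have xp : (x^-1 `^ p * x `^ p = 1)%R.
  by rewrite -powRM ?invr_ge0 ?(ltW x0)// mulVf ?gt_eqF// powR1.
rewrite powRN mulrC; congr (_ * _)%R; have xp0 : (x `^ p != 0)%R by rewrite gt_eqF ?powR_gt0.
by apply: (mulIf xp0); rewrite xp mulVf.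
Qed.

(** Asking only for some gradient with this energy includes the level [a = 0]. *)
Lemma level_gradient_energy a : (0 <= a)%R -> a%:E <= cap_ess_inf p mu E u ->
  exists k, [/\ Lp_borel mu p k, wug mu p setT (EFin \o level a) k &
    \int[mu]_x (k x `^ p) = (La * a)%:E].
Proof.
rewrite le_eqVlt => /predU1P[<- _|a0 aE]; last first.
  by have [m Em] := exists_level_gradient a0; exists m; have [? ? _] := Em; split => //; exact: energyE Em.
have L0 := Lp_cst0 mu p_gt0; exists (cst 0); split => //.
  exists (cst 0) => // l c ac _.
  have lev0 x : level 0%R x = 0%R by apply/eqP; rewrite eq_le level_ge0// level_le.
  by rewrite /= !lev0 subrr normr0; apply: integral_ge0.
by rewrite mulr0; apply: integral0_eq => x _; apply: poweR0r; rewrite gt_eqF.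
Qed.

Lemma capacity_levels_le a b : (0 <= a)%R -> (a < b)%R -> b%:E <= cap_ess_inf p mu E u ->
  rel_capacity p mu (superlevel_ge Omega u b%:E) (superlevel_gt Omega u a%:E) <=
  (La * (b - a) `^ (1 - p))%:E.
Proof.
move=> a0 ab bE; have b0 := le_lt_trans a0 ab; have ba0 : (0 < b - a)%R by rewrite subr_gt0.
have i0 : (0 <= (b - a)^-1)%R by rewrite invr_ge0 ltW.
have [k [Lk Wk ik]] : exists k, [/\ Lp_borel mu p k,
    wug mu p setT (EFin \o (fun x => level b x - level a x)%R) k &
    \int[mu]_x (k x `^ p) = (La * (b - a))%:E].
  move: a0 ab bE {ba0 i0}; rewrite le_eqVlt => /predU1P[<- _ bE|a0 ab bE].
    have [k [Lk Wk ik]] := level_gradient_energy (ltW b0) bE; exists k; split => //.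
      apply: (wug_eq _ Wk) => x _ /=; congr EFin.
      have -> : level 0%R x = 0%R by apply/eqP; rewrite eq_le level_ge0// level_le.
      by rewrite subr0.
    by rewrite subr0.
  have aE : a%:E <= cap_ess_inf p mu E u by apply: le_trans bE; rewrite lee_fin ltW.
  have [ma Ea] := exists_level_gradient a0; have [mb Eb] := exists_level_gradient b0.
  have [_ [k [Lk Wk ik]]] := level_energies a0 ab (avoided_essinf bE) Ea Eb
    (energyE a0 aE Ea) (energyE b0 bE Eb).
  by exists k; split => //; rewrite ik mulrBr.
have Wr := wug_ramp a0 ab Lk.1 Wk.
have mr := measurable_ramp a0 ab.
have Nr : N1p p mu setT (EFin \o ramp a b).
  apply: (wug_N1p mu_borel mr _ (Lp_scale mu_borel i0 Lk) Wr).
  apply: (@bounded_in_Lp p _ 1%R p_gt0 mr) => x.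
    by have /andP[r0 r1] := ramp_ge0_le1 x a0 ab; rewrite ger0_norm.
  by move=> nO; apply: ramp_out => // -[].
apply: le_trans (rel_capacity_le mu_borel mu_balls mu_doubling p_gt0 Nr _ _ _ Wr) _.
- by move=> x bx; rewrite /= ramp_top.
- by move=> x ax; rewrite /= ramp_out.
- by apply: borel_scale => //; case: Lk.
rewrite (@int_poweR_scale _ _ _ mu p mu_borel)//; last by case: Lk.
by rewrite ik -EFinM lee_fin mulrCA gap_powE.
Qed.

Definition unit_clamp (t : \bar R) : R := fine (Order.min 1 (Order.max 0 t)).

Lemma unit_clampE t : (unit_clamp t)%:E = Order.min 1 (Order.max 0 t).
Proof.
rewrite /unit_clamp fineK//; case: t => [r| |].
- by rewrite -EFin_max -EFin_min.
- by rewrite max_r ?leey// min_l ?leey.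
- by rewrite max_l ?leNye// min_r.
Qed.

(** Truncating a test function to [[0, 1]] keeps its gradients. At infinite values the right-hand
    side is [+oo], also for two equal ones. *)
Lemma unit_clamp_contraction s t :
  `|(unit_clamp s)%:E - (unit_clamp t)%:E| <= `|s - t|.
Proof.
have uE r : unit_clamp r%:E = Order.min 1%R (Order.max 0%R r).
  by apply: EFin_inj; rewrite unit_clampE -EFin_max -EFin_min.
case: s t => [s| |] [t| |] /=; rewrite ?leey// lee_fin !uE.
exact: le_trans (min_contraction _ _ _) (max_contraction _ _ _).
Qed.

Lemma capacity_levels_ge a b : (0 <= a)%R -> (a < b)%R -> b%:E <= cap_ess_inf p mu E u ->
  (La * (b - a) `^ (1 - p))%:E <=
  rel_capacity p mu (superlevel_ge Omega u b%:E) (superlevel_ge Omega u a%:E).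
Proof.
move=> a0 ab bE; have b0 := le_lt_trans a0 ab; have ba0 : (0 < b - a)%R by rewrite subr_gt0.
have aE : a%:E <= cap_ess_inf p mu E u by apply: le_trans bE; rewrite lee_fin ltW.
apply: (rel_capacity_ge mu_borel mu_balls mu_doubling p_gt0) => v g [mv _] v1 v0 Lg Wg.
pose v' x := unit_clamp (v x).
have mv' : measurable_fun setT (EFin \o v').
  rewrite (_ : EFin \o v' = (fun x => Order.min 1 (Order.max 0 (v x)))); last first.
    by apply/funext => x; rewrite /= unit_clampE.
  apply: measurable_mine; first exact: measurable_cst.
  by apply: measurable_maxe => //; exact: measurable_cst.
have v01 x : (0 <= v' x <= 1)%R.
  by rewrite -!lee_fin unit_clampE ge_min lexx/= le_min le_max lexx lee01.
have v'0 x : ~ superlevel_ge Omega u a%:E x -> v' x = 0%R.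
  by move=> /v0 vx; apply: EFin_inj; rewrite unit_clampE vx maxxx min_r.
have v'1 x : superlevel_ge Omega u b%:E x -> v' x = 1%R.
  move=> /v1 vx; apply: EFin_inj; rewrite unit_clampE min_l//.
  by rewrite le_max vx orbT.
have Wv' : wug mu p setT (EFin \o v') g.
  by apply: (wug_lip Lg.1 _ Wg) => x y _ _; exact: unit_clamp_contraction.
have [k [Lk Wk ik]] := level_gradient_energy a0 aE.
have [m Em] := exists_level_gradient b0.
have albe : (1 * a + 1 * (b - a) = b)%R by rewrite !mul1r addrC subrK.
(* With energy [r] of [g] this reads [La b <= La a + (b - a)^p r]; dividing by [(b - a)^p] gives the
   claim. *)
have := competitor_energy a0 ab (avoided_essinf bE) Em mv' v01 v'0 v'1 Lk Wk Lg Wv' ler01 ler01 albe.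
have [r r0 ->] := Lp_energy Lg; rewrite ik (energyE b0 bE Em) powR1 mul1e mul1r.
rewrite -EFinM -EFinD !lee_fin -gap_powE// => H.
have c0 : (0 < (b - a)^-1 `^ p)%R by rewrite powR_gt0// invr_gt0.
have cc : ((b - a)^-1 `^ p * (b - a) `^ p = 1)%R.
  by rewrite -powRM ?invr_ge0 ?(ltW ba0)// mulVf ?gt_eqF// powR1.
rewrite -[leRHS]mul1r -cc mulrCA -mulrA ler_pM2l// mulrBr.
by rewrite lerBlDl.
Qed.

Lemma superlevel_gt_ge (a : \bar R) : superlevel_gt Omega u a `<=` superlevel_ge Omega u a.
Proof. by move=> x [Ox /ltW]. Qed.

Lemma capacity_levels a b : (0 <= a)%R -> (a < b)%R -> b%:E <= cap_ess_inf p mu E u ->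
  rel_capacity p mu (superlevel_ge Omega u b%:E) (superlevel_ge Omega u a%:E)
    = (La * (b - a) `^ (1 - p))%:E /\
  rel_capacity p mu (superlevel_ge Omega u b%:E) (superlevel_gt Omega u a%:E)
    = (La * (b - a) `^ (1 - p))%:E.
Proof.
move=> a0 ab bE; have le1 := capacity_levels_le a0 ab bE; have ge1 := capacity_levels_ge a0 ab bE.
have le2 := le_rel_capacity mu p (@subset_refl _ (superlevel_ge Omega u b%:E)) (@superlevel_gt_ge a%:E).
split; apply/eqP; rewrite eq_le; apply/andP; split => //.
  exact: le_trans le2 le1.
exact: le_trans ge1 le2.
Qed.

Lemma rel_capacity_ge0 (A B : set X) : 0 <= rel_capacity p mu A B.
Proof.
apply: le_ereal_inf_tmp => _ [v _ <-]; apply: integral_ge0 => x _; exact: poweR_ge0.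
Qed.

Lemma capacity_levels_top a : (0 <= a)%R -> cap_ess_inf p mu E u = +oo ->
  rel_capacity p mu (superlevel_ge Omega u +oo) (superlevel_ge Omega u a%:E) = 0 /\
  rel_capacity p mu (superlevel_ge Omega u +oo) (superlevel_gt Omega u a%:E) = 0.
Proof.
move=> a0 Eoo.
have le2 := le_rel_capacity mu p (@subset_refl _ (superlevel_ge Omega u +oo)) (@superlevel_gt_ge a%:E).
suff le1 : rel_capacity p mu (superlevel_ge Omega u +oo) (superlevel_gt Omega u a%:E) <= 0.
  split; apply/eqP; rewrite eq_le rel_capacity_ge0 andbT//; exact: le_trans le2 le1.
apply/lee_addgt0Pr => e e0; rewrite add0e.
(* This is the gap at which the capacity equals [e]. The set where [u] is infinite lies in every
   level set, so its capacity is at most [e]. *)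
pose x := ((La / e) `^ (p - 1)^-1)%R.
have Le0 : (0 < La / e)%R by exact: divr_gt0.
have x0 : (0 < x)%R by exact: powR_gt0.
have xE : (x `^ (1 - p) = e / La)%R.
  rewrite -powRrM [X in (_ `^ X)%R](_ : _ = -1)%R; last by field; rewrite gt_eqF// subr_gt0.
  by rewrite powR_inv1 ?ltW// invf_div.
have ax : (a < a + x)%R by rewrite ltrDl.
have axE : (a + x)%:E <= cap_ess_inf p mu E u by rewrite Eoo leey.
have [_] := capacity_levels a0 ax axE; rewrite addrAC subrr add0r xE mulrC divfK ?gt_eqF// => <-.
by apply: le_rel_capacity => // y [Oy uy]; split => //; apply: le_trans uy; exact: leey.
Qed.

(** The upper bound is monotonicity. For the lower bound, the set where [u > b] contains the set
    where [u >= c] for each [c > b]; the strict bound on [b] leaves room for such [c], and the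
    formula is continuous as [c] decreases to [b]. *)
Lemma capacity_strict_levels a b : (0 <= a)%R -> (a < b)%R -> b%:E < cap_ess_inf p mu E u ->
  rel_capacity p mu (superlevel_gt Omega u b%:E) (superlevel_gt Omega u a%:E)
    = (La * (b - a) `^ (1 - p))%:E /\
  rel_capacity p mu (superlevel_gt Omega u b%:E) (superlevel_ge Omega u a%:E)
    = (La * (b - a) `^ (1 - p))%:E.
Proof.
move=> a0 ab bE; have le1 := capacity_levels_le a0 ab (ltW bE).
have le0 := le_rel_capacity mu p (@superlevel_gt_ge b%:E) (@subset_refl _ (superlevel_gt Omega u a%:E)).
have le2 := le_rel_capacity mu p (@subset_refl _ (superlevel_gt Omega u b%:E)) (@superlevel_gt_ge a%:E).
suff ge1 : (La * (b - a) `^ (1 - p))%:E <=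
    rel_capacity p mu (superlevel_gt Omega u b%:E) (superlevel_ge Omega u a%:E).
  split; apply/eqP; rewrite eq_le; apply/andP; split => //.
  - exact: le_trans le0 le1.
  - exact: le_trans ge1 le2.
  - exact: le_trans le2 (le_trans le0 le1).
have [b1 bb1 b1E] : exists2 b1 : R, (b < b1)%R & b1%:E <= cap_ess_inf p mu E u.
  case: (cap_ess_inf p mu E u) bE => [r| |] //; first by exists r.
  by exists (b + 1)%R; [rewrite ltrDl|rewrite leey].
have approx c : (b < c)%R -> (c <= b1)%R -> (La * (c - a) `^ (1 - p))%:E <=
    rel_capacity p mu (superlevel_gt Omega u b%:E) (superlevel_ge Omega u a%:E).
  move=> bc cb1; have cE : c%:E <= cap_ess_inf p mu E u by apply: le_trans b1E; rewrite lee_fin.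
  apply: le_trans (capacity_levels_ge a0 (lt_trans ab bc) cE) _.
  apply: le_rel_capacity => // y [Oy uy]; split => //; apply: lt_le_trans uy.
  by rewrite lte_fin.
move: approx; case: (rel_capacity _ _ _ _) => [r| |] approx.
- rewrite lee_fin leNgt; apply/negP => rlt.
  have ba0 : (0 < b - a)%R by rewrite subr_gt0.
  have pc : {for (b - a)%R, continuous (fun y : R => y `^ (1 - p))%R}.
    by apply/differentiable_continuous/derivable1_diffP; case: (is_derive1_powR (1 - p) ba0).
  have /nbhs_ballP[e /= e0 eP] := pc _ (open_nbhs_nbhs
    (conj (@open_gt R (r / La)%R) (etrans (ltr_pdivrMr _ _ La_gt0) (etrans (congr1 _ (mulrC _ _)) rlt)))).
  (* This level is above [b], still admissible, and close enough to [b] for the power of the gap to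
     stay above [r / La]. *)
  have bc : (b < Order.min b1 (b + e / 2))%R by rewrite lt_min bb1/= ltrDl divr_gt0.
  have cb1 : (Order.min b1 (b + e / 2) <= b1)%R by rewrite ge_min lexx.
  have ce : (Order.min b1 (b + e / 2) <= b + e / 2)%R by rewrite ge_min lexx orbT.
  have := approx _ bc cb1; set c := Order.min _ _ in bc ce *; rewrite lee_fin leNgt => /negP; apply.
  rewrite mulrC -ltr_pdivrMr//; apply: (eP (c - a)%R).
  rewrite /ball /= opprB addrA subrK distrC ger0_norm ?subr_ge0 ?(ltW bc)//.
  by rewrite ltrBlDl; apply: le_lt_trans ce _; rewrite ltrD2l ltr_pdivrMr// ltr_pMr// ltr1n.
- by rewrite leey.
- by have := approx b1 bb1 (lexx _); rewrite leeNy_eq.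
Qed.

End capacity_formula.

End truncations.

Theorem lemma9p1 (R : realType) (d : measure_display)
    (X : completeMetricMeasurableType d R) (mu : {measure set X -> \bar R})
    (p : R) (Omega E : set X) (u : X -> \bar R)
    (X_two_points : exists x y : X, x <> y)
    (mu_borel : borel_completion mu)
    (mu_balls : balls_pos_finite mu)
    (p_gt1 : (1 < p)%R)
    (mu_doubling : doubling mu)
    (mu_poincare : poincare p mu)
    (Omega_nonempty : Omega !=set0)
    (Omega_bounded : metric_bounded Omega)
    (Omega_open : open Omega)
    (Omega_capacity : 0 < capacity p mu (~` Omega))
    (E_rel_closed : exists2 F : set X, closed F & E = F `&` Omega)
    (u_gt0 : forall x, Omega x -> 0 < u x)
    (u_superharmonic : superharmonic p mu Omega u)
    (u_harmonic : p_harmonic p mu (Omega `\` E) u)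
    (u_trunc : forall k : R, (0 < k)%R ->
       N1p_0 p mu Omega (fun x => Order.min (u x) k%:E)) :
  exists2 Lambda : R, (0 < Lambda)%R &
    (forall (a : R) (b : \bar R),
       (0 <= a)%R -> a%:E < b -> b <= cap_ess_inf p mu E u ->
       rel_capacity p mu (superlevel_ge Omega u b) (superlevel_ge Omega u a%:E)
         = Lambda%:E * gap_pow p a b /\
       rel_capacity p mu (superlevel_ge Omega u b) (superlevel_gt Omega u a%:E)
         = Lambda%:E * gap_pow p a b) /\
    (forall (a : R) (b : \bar R),
       (0 <= a)%R -> a%:E < b -> b < cap_ess_inf p mu E u ->
       rel_capacity p mu (superlevel_gt Omega u b) (superlevel_gt Omega u a%:E)
         = Lambda%:E * gap_pow p a b /\
       rel_capacity p mu (superlevel_gt Omega u b) (superlevel_ge Omega u a%:E)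
         = Lambda%:E * gap_pow p a b).
Proof.
have p_gt0 : (0 < p)%R := lt_trans ltr01 p_gt1.
(* If the essential infimum is not positive, no pair [0 <= a < b] is admissible and any constant
   will do. *)
have [ess0|ess0] := leP (cap_ess_inf p mu E u) 0.
  exists 1%R => //; split => a b a0 ab bE; exfalso; move: ab; apply/negP; rewrite -leNgt.
    by apply: le_trans bE (le_trans ess0 _); rewrite lee_fin.
  by apply: le_trans (ltW bE) (le_trans ess0 _); rewrite lee_fin.
have [La La0 energyE] := linear_energies mu_borel mu_balls mu_doubling p_gt0 Omega_bounded
  Omega_open E_rel_closed u_gt0 u_harmonic u_trunc mu_poincare Omega_nonempty
  Omega_capacity ess0.
exists La => //; split => a b a0; case: b => [b| |] //= ab bE.
- rewrite lte_fin in ab; rewrite -EFinM.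
  exact: (capacity_levels mu_borel mu_balls mu_doubling p_gt0 Omega_bounded
    Omega_open E_rel_closed u_gt0 u_harmonic u_trunc energyE).
- rewrite mule0.
  apply: (capacity_levels_top mu_borel mu_balls mu_doubling p_gt0 Omega_bounded
    Omega_open E_rel_closed u_gt0 u_harmonic u_trunc p_gt1 La0 energyE a0).
  by apply/eqP; rewrite -leye_eq.
- rewrite lte_fin in ab; rewrite -EFinM.
  exact: (capacity_strict_levels mu_borel mu_balls mu_doubling p_gt0 Omega_bounded
    Omega_open E_rel_closed u_gt0 u_harmonic u_trunc La0 energyE).
- by move: bE; rewrite ltNge leey.
Qed.
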